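(* Let $G$ be a connected cograph with countably many vertices. Then the number of pairwise non-isomorphic connected graphs that are equimorphic to $G$ is either exactly $1$ or infinite.
   Context: Graphs are undirected and loopless. A graph $G$ embeds into $G'$ if $G$ is isomorphic to an induced subgraph of $G'$; $G$ and $G'$ are equimorphic if each embeds into the other. A cograph is a graph with no induced subgraph isomorphic to the path $P_4$ on four vertices. A connected sibling of $G$ is a connected graph equimorphic to $G$; these are counted up to isomorphism. *)

(* Defs.v *)
From Stdlib Require Import Relations Lia.

Record graph : Type := Graph {
  vtx : Type;
  adj : vtx -> vtx -> Prop;
  adj_sym : forall x y, adj x y -> adj y x;
  adj_irr : forall x, ~ adj x x
}.

Definition injective {A B : Type} (f : A -> B) : Prop :=
  forall x y, f x = f y -> x = y.

Definition surjective {A B : Type} (f : A -> B) : Prop :=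
  forall y, exists x, f x = y.

Definition embeds (G H : graph) : Prop :=
  exists f : vtx G -> vtx H, injective f /\
    forall x y, adj G x y <-> adj H (f x) (f y).

Definition isomorphic (G H : graph) : Prop :=
  exists f : vtx G -> vtx H, injective f /\ surjective f /\
    forall x y, adj G x y <-> adj H (f x) (f y).

Definition equimorphic (G H : graph) : Prop := embeds G H /\ embeds H G.

Definition connected (G : graph) : Prop :=
  inhabited (vtx G) /\ forall x y, clos_refl_trans (vtx G) (adj G) x y.

Definition countable_graph (G : graph) : Prop :=
  exists f : vtx G -> nat, injective f.

Definition P4_vtx : Type := { n : nat | n < 4 }.
Definition P4_adj (x y : P4_vtx) : Prop :=
  proj1_sig x + 1 = proj1_sig y \/ proj1_sig y + 1 = proj1_sig x.
Lemma P4_sym : forall x y, P4_adj x y -> P4_adj y x.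
Proof. unfold P4_adj; intros; tauto. Qed.
Lemma P4_irr : forall x, ~ P4_adj x x.
Proof. unfold P4_adj; intros x H; lia. Qed.
Definition P4 : graph := Graph P4_vtx P4_adj P4_sym P4_irr.

Definition cograph (G : graph) : Prop := ~ embeds P4 G.

Definition connected_sibling (G H : graph) : Prop :=
  connected H /\ equimorphic H G.

(* Main.v *)
(* Siblings are counted among the subsets of a fixed countable cograph, up to isomorphism, and
   all notions are invariant under complementation.  Suppose that [A] has finitely many siblings
   (with the same connectedness of the graph and of its complement).

   Rigidity: a strong module of [A] never embeds into a properly smaller one, and a self-embedding
   [g] of [A] maps a strong module [P] into itself once it sends some point of [P] into [P].
   Otherwise iterating an embedding gives a sequence of nested strong modules along which any
   sequence of bits can be coded, so that there are continuum many siblings, whereas finitely many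
   countable graphs with two named vertices have only countably many.

   Uniqueness: by induction on a bound [m] for the number of siblings.  Let [K] be a strong module
   of [A] which is not isomorphic to all its siblings.  Replacing simultaneously all modules
   equimorphic to [K] by a sibling [X] of [K] loses no information on [X]; hence, by the induction
   hypothesis for [K], every sibling of [A] arises in this way, [K] is the only module of [A] of
   its type, and a sibling of [A] is [A] with [K] replaced.  Such [K] form a chain, which has no
   minimum: a disconnected graph is determined by its components (Cantor-Bernstein), and a graph
   connected together with its complement by the chain of strong modules around a vertex.  So a
   sibling of [A] is glued from isomorphic pieces along a sequence of such [K] and isomorphic
   intersections. *)

(* A coded graph has to stay equimorphic to the original, so its word of letters is interrupted by
   copies of whole regions, and beyond such a copy the next letters are no longer definable. The
   obstacle is therefore to show that an isomorphism between two coded graphs carries each part of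
   one word to the corresponding part of the other. For a descending sequence these parts are strong
   modules, hence disjoint or nested. If they are disjoint, many independent copies fit side by side
   and bits can be coded by the sizes of components. If they are strictly nested, the inverse
   isomorphism can be iterated outside them and produces a word that starts from a named module and
   needs no copies, so it can be read letter by letter. These two codes come before the descending
   one for this reason. For an ascending sequence, the rigidity obtained from the descending case
   identifies the parts directly. *)
From Stdlib Require Import Relations Lia List Arith Cantor FinFun.
From Stdlib Require Import Classical ClassicalEpsilon FunctionalExtensionality PropExtensionality.
Require Import Defs.

Set Implicit Arguments.
Unset Strict Implicit.

(** * Cographs on a fixed vertex type: complements and components *)

Definition set (U : Type) := U -> Prop.
Definition sub {U} (A B : set U) := forall x, A x -> B x.
Definition img {U} (f : U -> U) (A : set U) : set U := fun y => exists x, A x /\ f x = y.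

Lemma set_ext U (A B : set U) : (forall x, A x <-> B x) -> A = B.
Proof.
  intros h; apply functional_extensionality; intros x; apply propositional_extensionality; auto.
Qed.

Definition co {U} (E : U -> U -> Prop) : U -> U -> Prop := fun x y => x <> y /\ ~ E x y.

Record cog {U} (E : U -> U -> Prop) : Prop := Cog {
  cog_sym : forall x y, E x y -> E y x;
  cog_irr : forall x, ~ E x x;
  cog_p4 : forall a b c d, E a b -> E b c -> E c d -> ~ E a c -> ~ E b d -> ~ E a d -> False
}.

Ltac ea := repeat split; auto; try match goal with h : cog ?E |- ?E _ _ => solve [apply (cog_sym h); auto] end.

Lemma co_co U (E : U -> U -> Prop) : cog E -> co (co E) = E.
Proof.
  intros hE; apply functional_extensionality; intros x; apply functional_extensionality; intros y.
  apply propositional_extensionality; unfold co; split.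
  - intros [h1 h2]. destruct (classic (E x y)) as [h|h]; auto. exfalso; apply h2; auto.
  - intros h; split; [intros e; subst; exact (cog_irr hE h) | intros [_ h2]; auto].
Qed.

Lemma cog_co U (E : U -> U -> Prop) : cog E -> cog (co E).
Proof.
  intros hE; split.
  - intros x y [h1 h2]; split; [auto | intros h; apply h2, (cog_sym hE), h].
  - intros x [h _]; auto.
  - intros a b c d [n1 h1] [n2 h2] [n3 h3] h4 h5 h6.
    assert (hac : E a c).
    { apply NNPP; intros h; apply h4; split; auto. intros e; subst; apply h6; split; auto. }
    assert (had : E a d).
    { apply NNPP; intros h; apply h6; split; auto. intros e; subst. apply h3, (cog_sym hE); auto. }
    assert (hbd : E b d).
    { apply NNPP; intros h; apply h5; split; auto. intros e; subst; apply h1; auto. }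
    (* The complement of the path [a b c d] is the path [c a d b]. *)
    apply (cog_p4 hE (a:=c) (b:=a) (c:=d) (d:=b)); auto.
    + apply (cog_sym hE); auto.
    + apply (cog_sym hE); auto.
    + intros h; apply h2, (cog_sym hE), h.
Qed.

(* In a graph without induced [P4] two vertices of a component are at distance at most 2. *)
Definition near {U} (E : U -> U -> Prop) (A : set U) x y :=
  x = y \/ E x y \/ exists z, A z /\ E x z /\ E z y.
Definition conn {U} (E : U -> U -> Prop) (A : set U) := forall x y, A x -> A y -> near E A x y.

Lemma near_refl U (E : U -> U -> Prop) A x : near E A x x.
Proof. left; auto. Qed.

Lemma near_sym U (E : U -> U -> Prop) (hE : cog E) A x y : near E A x y -> near E A y x.
Proof.
  intros [h|[h|[z [h1 [h2 h3]]]]]; [left; auto | right; left; apply (cog_sym hE), h|].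
  right; right; exists z; ea.
Qed.

Lemma near_sub U (E : U -> U -> Prop) A B x y : sub A B -> near E A x y -> near E B x y.
Proof.
  intros hs [h|[h|[z [h1 [h2 h3]]]]]; [left; auto | right; left; auto|].
  right; right; exists z; auto.
Qed.

(** A walk [x y w z] without a shortcut would be an induced path on four vertices. *)
Lemma near_step U (E : U -> U -> Prop) (hE : cog E) A x y z :
  A y -> E x y -> near E A y z -> near E A x z.
Proof.
  intros hy h [h1|[h1|[w [hw [h1 h2]]]]].
  - subst; right; left; auto.
  - right; right; exists y; auto.
  - destruct (classic (E x z)) as [|nxz]; [right; left; auto|].
    destruct (classic (E x w)) as [|nxw]; [right; right; exists w; auto|].
    destruct (classic (E y z)) as [|nyz]; [right; right; exists y; auto|].
    exfalso; apply (cog_p4 hE h h1 h2); auto.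
Qed.

Lemma near_trans U (E : U -> U -> Prop) (hE : cog E) A x y z :
  A x -> A y -> near E A x y -> near E A y z -> near E A x z.
Proof.
  intros hx hy [h|[h|[w [hw [h1 h2]]]]] h'.
  - subst; auto.
  - apply near_step with y; auto.
  - apply near_step with w; auto. apply near_step with y; auto.
Qed.

Definition comp {U} (E : U -> U -> Prop) (A : set U) x : set U := fun y => A y /\ near E A x y.

Lemma comp_self U (E : U -> U -> Prop) (A : set U) x : A x -> comp E A x x.
Proof. split; auto using near_refl. Qed.

Lemma comp_eq U (E : U -> U -> Prop) (hE : cog E) (A : set U) x y :
  A x -> A y -> near E A x y -> comp E A x = comp E A y.
Proof.
  intros hx hy h; apply set_ext; intros z; split; intros [hz h']; split; auto.
  - apply (near_trans hE) with x; auto. apply near_sym; auto.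
  - apply (near_trans hE) with y; auto.
Qed.

Lemma comp_conn U (E : U -> U -> Prop) (hE : cog E) (A : set U) x :
  A x -> conn E (comp E A x).
Proof.
  intros hx y z [hy h1] [hz h2].
  assert (h : near E A y z) by (apply (near_trans hE) with x; auto; apply near_sym; auto).
  destruct h as [h|[h|[w [hw [h3 h4]]]]]; [left; auto | right; left; auto|].
  right; right; exists w; repeat split; auto.
  apply (near_trans hE) with y; auto. right; left; auto.
Qed.

Lemma comp_nonadj U (E : U -> U -> Prop) (hE : cog E) (A : set U) x y z :
  A x -> A z -> comp E A x y -> ~ comp E A x z -> ~ E y z.
Proof.
  intros hx hz [hy h] hn he; apply hn; split; auto.
  apply (near_trans hE) with y; auto. right; left; auto.
Qed.

(** * Modules and strong modules *)

Definition module {U} (E : U -> U -> Prop) (A M : set U) :=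
  sub M A /\ forall u x y, A u -> ~ M u -> M x -> M y -> E u x -> E u y.

(* For a module [M], overlapping another module is possible only if [M] or its complement graph is
   disconnected; the vertex [u] excludes the modules made of some components of [M] and of [z]. *)
Definition halfstrong {U} (E : U -> U -> Prop) (A M : set U) :=
  ~ conn E M -> forall z, A z -> ~ M z -> (forall x, M x -> ~ E z x) ->
  exists u, A u /\ ~ M u /\ (forall x, M x -> E u x) /\ ~ E u z.

Record strong {U} (E : U -> U -> Prop) (A M : set U) : Prop := Strong {
  strong_ne : exists x, M x;
  strong_mod : module E A M;
  strong_half : halfstrong E A M;
  strong_cohalf : halfstrong (co E) A M
}.

Lemma strong_sub U (E : U -> U -> Prop) A M : strong E A M -> sub M A.
Proof. intros h; apply (strong_mod h). Qed.

Lemma module_co U (E : U -> U -> Prop) (hE : cog E) A M : module E A M -> module (co E) A M.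
Proof.
  intros [h1 h2]; split; auto. intros u x y hu hn hx hy [h3 h4]; split.
  - intros e; subst; auto.
  - intros h; apply h4; apply (h2 u y x); auto.
Qed.

Lemma strong_co U (E : U -> U -> Prop) (hE : cog E) A M : strong E A M -> strong (co E) A M.
Proof.
  intros h; split; [apply h | apply module_co, h; auto | apply h | rewrite (co_co hE); apply h].
Qed.

Lemma strong_co_iff U (E : U -> U -> Prop) (hE : cog E) A M : strong (co E) A M <-> strong E A M.
Proof.
  split; [|apply strong_co; auto].
  intros h; rewrite <- (co_co hE); apply strong_co; auto using cog_co.
Qed.

(** If [m] lay outside [M'], the part of [M] outside [M'] would have no neighbour in [M'], so [M]
    would be disconnected. The vertex [u] that [halfstrong] then supplies for [y] is adjacent to all
    of [M] but not to [y], which is impossible both inside and outside [M']. *)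
Lemma strong_nested_half U (E : U -> U -> Prop) (hE : cog E) A M M' w y m :
  strong E A M -> module E A M' -> M w -> M' w -> M' y -> ~ M y -> ~ E y w -> M m -> M' m.
Proof.
  intros hM [hs' hm'] hw hw' hy hny hE' hm.
  destruct (strong_mod hM) as [hs hmod].
  apply NNPP; intros hnm.
  assert (hyM : forall x, M x -> ~ E y x).
  { intros x hx hh; apply hE'; apply (hmod y x w); auto. }
  assert (hsep : forall m0, M m0 -> ~ M' m0 -> forall v, M' v -> ~ E m0 v).
  { intros m0 h1 h2 v h3 h4. apply (hyM m0); auto. apply (cog_sym hE).
    apply (hm' m0 v y); auto. }
  assert (hnc : ~ conn E M).
  { intros hc. destruct (hc m w hm hw) as [h|[h|[z [hz [h1 h2]]]]].
    - subst; auto.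
    - apply (hsep m hm hnm w); auto.
    - destruct (classic (M' z)) as [hz'|hz'].
      + apply (hsep m hm hnm z); auto.
      + apply (hsep z hz hz' w); auto. }
  destruct (strong_half hM hnc (hs' y hy) hny hyM) as [u [hu [hnu [hu1 hu2]]]].
  destruct (classic (M' u)) as [hu'|hu'].
  - apply (hsep m hm hnm u); auto. apply (cog_sym hE); auto.
  - apply hu2. apply (hm' u w y); auto.
Qed.

Lemma strong_nested U (E : U -> U -> Prop) (hE : cog E) A M M' w :
  strong E A M -> module E A M' -> M w -> M' w -> sub M' M \/ sub M M'.
Proof.
  intros hM hM' hw hw'. apply NNPP; intros hn. apply not_or_and in hn; destruct hn as [h1 h2].
  apply not_all_ex_not in h1; destruct h1 as [y h1]. apply imply_to_and in h1; destruct h1 as [hy hny].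
  apply not_all_ex_not in h2; destruct h2 as [m h2]. apply imply_to_and in h2; destruct h2 as [hm hnm].
  apply hnm. destruct (classic (E y w)) as [he|he].
  - apply (strong_nested_half (cog_co hE) (A:=A) (M:=M) (w:=w) (y:=y)); auto.
    + apply strong_co; auto.
    + apply module_co; auto.
    + intros [_ h]; auto.
  - apply (strong_nested_half hE (A:=A) (M:=M) (w:=w) (y:=y)); auto.
Qed.

Lemma strong_self U (E : U -> U -> Prop) (A : set U) : (exists x, A x) -> strong E A A.
Proof.
  intros h; split; auto.
  - split; [intros x; auto | intros; contradiction].
  - intros _ z hz hnz; contradiction.
  - intros _ z hz hnz; contradiction.
Qed.

Lemma strong_single U (E : U -> U -> Prop) (A : set U) x : A x -> strong E A (fun y => y = x).
Proof.
  intros h; split.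
  - exists x; auto.
  - split; [intros y ->; auto | intros u y z _ _ -> ->; auto].
  - intros hn; exfalso; apply hn; intros y z -> ->; apply near_refl.
  - intros hn; exfalso; apply hn; intros y z -> ->; apply near_refl.
Qed.

Lemma conn_exit U (E : U -> U -> Prop) (hE : cog E) (M N : set U) n m :
  conn E M -> sub N M -> N n -> M m -> ~ N m -> exists u k, M u /\ ~ N u /\ N k /\ E u k.
Proof.
  intros hc hs hn hm hnm. destruct (hc n m (hs n hn) hm) as [h|[h|[k [hk [h1 h2]]]]].
  - subst; contradiction.
  - exists m, n; ea.
  - destruct (classic (N k)).
    + exists m, k; ea.
    + exists k, n; ea.
Qed.

(* If [M] is disconnected its own separating vertex works for [N]; otherwise [M] has a vertex
   outside [N] adjacent to [N]. *)
Lemma half_inherit U (E : U -> U -> Prop) (hE : cog E) A M N z :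
  strong E A M -> sub N M -> module E M N -> ~ conn E N -> (exists x, N x) ->
  A z -> ~ M z -> (forall x, N x -> ~ E z x) ->
  exists u, A u /\ ~ N u /\ (forall x, N x -> E u x) /\ ~ E u z.
Proof.
  intros hM hs [hs' hmod] hnc [n hn] hz hnz hzN.
  destruct (strong_mod hM) as [hsM hmM].
  assert (hzM : forall x, M x -> ~ E z x).
  { intros x hx h; apply (hzN n hn). apply (hmM z x n); auto. }
  destruct (classic (conn E M)) as [hc|hc].
  - assert (hm : exists m, M m /\ ~ N m).
    { apply NNPP; intros h. apply hnc. intros x y hx hy.
      apply near_sub with M; auto.
      intros v hv; apply NNPP; intros hv'; apply h; exists v; auto. }
    destruct hm as [m [hm hnm]].
    destruct (conn_exit hE hc hs hn hm hnm) as [u [k [hu [hnu [hk hek]]]]].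
    exists u; repeat split; auto.
    + intros x hx; apply (hmod u k x); auto.
    + intros h; apply (hzM u); auto. apply (cog_sym hE); auto.
  - destruct (strong_half hM hc hz hnz hzM) as [u [hu [hnu [h1 h2]]]].
    exists u; repeat split; auto.
Qed.

Lemma module_trans U (E : U -> U -> Prop) A M N :
  module E A M -> module E M N -> module E A N.
Proof.
  intros [h1 h2] [h3 h4]; split; [intros x hx; auto|].
  intros u x y hu hnu hx hy he. destruct (classic (M u)); [apply (h4 u x y); auto | apply (h2 u x y); auto].
Qed.

Lemma half_trans U (E : U -> U -> Prop) (hE : cog E) A M N :
  strong E A M -> (exists x, N x) -> module E M N -> halfstrong E M N -> halfstrong E A N.
Proof.
  intros hM hne hN hh hc z hz hnz hzN.
  destruct (classic (M z)) as [hzM|hzM].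
  - destruct (hh hc z hzM hnz hzN) as [u [hu h]]. exists u; split; auto. apply (strong_sub hM); auto.
  - apply (half_inherit hE) with M; auto. apply hN.
Qed.

Lemma strong_trans U (E : U -> U -> Prop) (hE : cog E) A M N :
  strong E A M -> strong E M N -> strong E A N.
Proof.
  intros hM hN; split.
  - apply hN.
  - apply module_trans with M; [apply hM | apply hN].
  - apply (half_trans hE) with M; auto; apply hN.
  - apply (half_trans (cog_co hE)) with M; auto; try apply hN.
    + apply strong_co; auto.
    + apply module_co; auto; apply hN.
Qed.

Lemma module_restrict U (E : U -> U -> Prop) A B M :
  module E A M -> sub M B -> sub B A -> module E B M.
Proof. intros [h1 h2] h3 h4; split; auto. intros u x y hu; apply h2; auto. Qed.

Lemma half_restrict U (E : U -> U -> Prop) A B M :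
  strong E A M -> sub M B -> module E A B -> halfstrong E B M.
Proof.
  intros hM hs [hB hmB] hc z hz hnz hzM.
  destruct (strong_half hM hc (hB z hz) hnz hzM) as [u [hu [hnu [h1 h2]]]].
  exists u; repeat split; auto.
  apply NNPP; intros hnB. apply h2. destruct (strong_ne hM) as [m hm].
  apply (hmB u m z); auto.
Qed.

Lemma strong_restrict U (E : U -> U -> Prop) (hE : cog E) A B M :
  strong E A M -> sub M B -> module E A B -> strong E B M.
Proof.
  intros hM hs hB; split.
  - apply hM.
  - apply module_restrict with A; auto; [apply hM | apply hB].
  - apply half_restrict with A; auto.
  - apply half_restrict with A; auto.
    + apply strong_co; auto.
    + apply module_co; auto.
Qed.

Lemma inter_half U (E : U -> U -> Prop) (hE : cog E) A (F : set U -> Prop) M0 :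
  (forall M, F M -> strong E A M) -> F M0 -> (exists x, forall M, F M -> M x) ->
  halfstrong E A (fun x => forall M, F M -> M x).
Proof.
  intros hF h0 [n hn] hc z hz hnz hzN.
  apply not_all_ex_not in hnz; destruct hnz as [M hnz].
  apply imply_to_and in hnz; destruct hnz as [hM hnz].
  apply (half_inherit hE) with M; auto.
  - intros x hx; apply hx; auto.
  - split; [intros x hx; apply hx; auto|].
    intros u x y hu hnu hx hy he.
    apply not_all_ex_not in hnu; destruct hnu as [M' hnu].
    apply imply_to_and in hnu; destruct hnu as [hM' hnu].
    destruct (strong_mod (hF M' hM')) as [_ hm].
    apply (hm u x y); [apply (strong_sub (hF M hM)) | | apply hx | apply hy | ]; auto.
  - exists n; auto.
Qed.

Lemma strong_inter U (E : U -> U -> Prop) (hE : cog E) A (F : set U -> Prop) M0 :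
  (forall M, F M -> strong E A M) -> F M0 -> (exists x, forall M, F M -> M x) ->
  strong E A (fun x => forall M, F M -> M x).
Proof.
  intros hF h0 hne; split.
  - exact hne.
  - split; [intros x hx; apply (strong_sub (hF M0 h0)), hx; auto|].
    intros u x y hu hnu hx hy he.
    apply not_all_ex_not in hnu; destruct hnu as [M' hnu].
    apply imply_to_and in hnu; destruct hnu as [hM' hnu].
    destruct (strong_mod (hF M' hM')) as [_ hm].
    apply (hm u x y); [ | | apply hx | apply hy | ]; auto.
  - apply (inter_half hE) with M0; auto.
  - apply (inter_half (cog_co hE)) with M0; auto. intros M h; apply strong_co; auto.
Qed.

(** A component is connected and no edge leaves it, so both overlap conditions hold vacuously. *)
Lemma strong_comp U (E : U -> U -> Prop) (hE : cog E) (A : set U) x : A x -> strong E A (comp E A x).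
Proof.
  intros hx.
  assert (hs : forall u y, A u -> ~ comp E A x u -> comp E A x y -> ~ E u y).
  { intros u y hu hnu hy h. apply (comp_nonadj hE (A:=A) (x:=x) (y:=y) (z:=u)); auto.
    apply (cog_sym hE); auto. }
  split.
  - exists x; apply comp_self; auto.
  - split; [intros y [h _]; auto|]. intros u y z hu hnu hy hz he. exfalso; apply (hs u y); auto.
  - intros hc; exfalso; apply hc, comp_conn; auto.
  - intros _ z hz hnz h. exfalso. apply (h x (comp_self E hx)). split.
    + intros e; subst; apply hnz, comp_self; auto.
    + apply hs; auto using comp_self.
Qed.

(** * Embeddings, equimorphy and siblings *)

Record emb {U} (E : U -> U -> Prop) (f : U -> U) (A B : set U) : Prop := Emb {
  emb_in : forall x, A x -> B (f x);
  emb_inj : forall x y, A x -> A y -> f x = f y -> x = y;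
  emb_adj : forall x y, A x -> A y -> (E x y <-> E (f x) (f y))
}.
Lemma emb_pos U (E : U -> U -> Prop) f A B x y : emb E f A B -> A x -> A y -> E x y -> E (f x) (f y).
Proof. intros h hx hy; apply (proj1 (emb_adj h hx hy)). Qed.
Lemma emb_neg U (E : U -> U -> Prop) f A B x y : emb E f A B -> A x -> A y -> E (f x) (f y) -> E x y.
Proof. intros h hx hy; apply (proj2 (emb_adj h hx hy)). Qed.
Definition isof {U} (E : U -> U -> Prop) f (A B : set U) :=
  emb E f A B /\ forall y, B y -> exists x, A x /\ f x = y.
Definition le {U} (E : U -> U -> Prop) (A B : set U) := exists f, emb E f A B.
Definition eqm {U} (E : U -> U -> Prop) (A B : set U) := le E A B /\ le E B A.
Definition iso {U} (E : U -> U -> Prop) (A B : set U) := exists f, isof E f A B.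

Lemma emb_id U (E : U -> U -> Prop) A : emb E (fun x => x) A A.
Proof. split; auto; tauto. Qed.

Lemma emb_incl U (E : U -> U -> Prop) (A B : set U) : sub A B -> emb E (fun x => x) A B.
Proof. intros h; split; auto; tauto. Qed.

Lemma emb_comp U (E : U -> U -> Prop) f g A B C :
  emb E f A B -> emb E g B C -> emb E (fun x => g (f x)) A C.
Proof.
  intros hf hg; split.
  - intros x hx; apply hg, hf, hx.
  - intros x y hx hy h. apply (emb_inj hf); auto. apply (emb_inj hg); auto; apply hf; auto.
  - intros x y hx hy. rewrite (emb_adj hf hx hy). apply hg; apply hf; auto.
Qed.

Lemma emb_restrict U (E : U -> U -> Prop) f A B A' B' :
  emb E f A B -> sub A' A -> (forall x, A' x -> B' (f x)) -> emb E f A' B'.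
Proof. intros hf hs hb; split; auto; intros x y hx hy; apply hf; auto. Qed.

Lemma emb_iter U (E : U -> U -> Prop) f A n : emb E f A A -> emb E (fun x => Nat.iter n f x) A A.
Proof.
  intros hf; induction n; [apply emb_id|].
  apply (emb_comp (f:=fun x => Nat.iter n f x)) with A; auto.
Qed.

Lemma le_refl U (E : U -> U -> Prop) A : le E A A.
Proof. exists (fun x => x); apply emb_id. Qed.

Lemma le_sub U (E : U -> U -> Prop) (A B : set U) : sub A B -> le E A B.
Proof. intros h; exists (fun x => x); apply emb_incl; auto. Qed.

Lemma le_trans U (E : U -> U -> Prop) A B C : le E A B -> le E B C -> le E A C.
Proof. intros [f hf] [g hg]; exists (fun x => g (f x)); apply emb_comp with B; auto. Qed.

Lemma eqm_refl U (E : U -> U -> Prop) A : eqm E A A.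
Proof. split; apply le_refl. Qed.
Lemma eqm_sym U (E : U -> U -> Prop) A B : eqm E A B -> eqm E B A.
Proof. intros [h1 h2]; split; auto. Qed.
Lemma eqm_trans U (E : U -> U -> Prop) A B C : eqm E A B -> eqm E B C -> eqm E A C.
Proof. intros [h1 h2] [h3 h4]; split; apply le_trans with B; auto. Qed.

Definition inv {U} (f : U -> U) (A : set U) y := epsilon (inhabits y) (fun x => A x /\ f x = y).

Lemma inv_spec U (f : U -> U) (A : set U) y :
  (exists x, A x /\ f x = y) -> A (inv f A y) /\ f (inv f A y) = y.
Proof. intros h; unfold inv; apply epsilon_spec; auto. Qed.

Lemma isof_inv U (E : U -> U -> Prop) f A B : isof E f A B -> isof E (inv f A) B A.
Proof.
  intros [hf hs]. assert (h : forall y, B y -> A (inv f A y) /\ f (inv f A y) = y).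
  { intros y hy; apply inv_spec, hs, hy. }
  split; [split|].
  - intros y hy; apply h, hy.
  - intros y z hy hz e. rewrite <- (proj2 (h y hy)), <- (proj2 (h z hz)), e; auto.
  - intros y z hy hz. rewrite (emb_adj hf (proj1 (h y hy)) (proj1 (h z hz))).
    rewrite (proj2 (h y hy)), (proj2 (h z hz)); tauto.
  - intros x hx. exists (f x). split; [apply hf; auto|].
    destruct (h (f x)) as [h1 h2]; [apply hf; auto|]. apply (emb_inj hf); auto.
Qed.

Lemma isof_inv_l U (E : U -> U -> Prop) f A B x : isof E f A B -> A x -> inv f A (f x) = x.
Proof.
  intros [hf hs] hx. destruct (@inv_spec U f A (f x)) as [h1 h2]; [eauto|].
  apply (emb_inj hf); auto.
Qed.

Lemma isof_inv_r U (E : U -> U -> Prop) f A B y : isof E f A B -> B y -> f (inv f A y) = y.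
Proof. intros [hf hs] hy. apply inv_spec, hs, hy. Qed.

Lemma isof_comp U (E : U -> U -> Prop) f g A B C :
  isof E f A B -> isof E g B C -> isof E (fun x => g (f x)) A C.
Proof.
  intros [hf sf] [hg sg]; split; [apply emb_comp with B; auto|].
  intros z hz. destruct (sg z hz) as [y [hy <-]]. destruct (sf y hy) as [x [hx <-]]. eauto.
Qed.

Lemma isof_img U (E : U -> U -> Prop) f A B : emb E f A B -> isof E f A (img f A).
Proof.
  intros hf; split; [|intros y [x [h1 h2]]; eauto].
  apply emb_restrict with A B; [auto | intros x; auto | intros x hx; exists x; auto].
Qed.

Lemma iso_refl U (E : U -> U -> Prop) A : iso E A A.
Proof. exists (fun x => x); split; [apply emb_id | eauto]. Qed.
Lemma iso_sym U (E : U -> U -> Prop) A B : iso E A B -> iso E B A.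
Proof. intros [f hf]; exists (inv f A); apply isof_inv; auto. Qed.
Lemma iso_trans U (E : U -> U -> Prop) A B C : iso E A B -> iso E B C -> iso E A C.
Proof. intros [f hf] [g hg]; exists (fun x => g (f x)); apply isof_comp with B; auto. Qed.
Lemma iso_le U (E : U -> U -> Prop) A B : iso E A B -> le E A B.
Proof. intros [f [hf _]]; exists f; auto. Qed.
Lemma iso_eqm U (E : U -> U -> Prop) A B : iso E A B -> eqm E A B.
Proof. intros h; split; apply iso_le; auto using iso_sym. Qed.
Lemma iso_img U (E : U -> U -> Prop) f A B : emb E f A B -> iso E A (img f A).
Proof. intros h; exists f; apply isof_img with B; auto. Qed.

Lemma img_sub U (E : U -> U -> Prop) f (A B : set U) : emb E f A B -> sub (img f A) B.
Proof. intros h y [x [hx <-]]; apply h; auto. Qed.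

Lemma emb_near U (E : U -> U -> Prop) f A B x y :
  emb E f A B -> A x -> A y -> near E A x y -> near E B (f x) (f y).
Proof.
  intros hf hx hy [h|[h|[z [hz [h1 h2]]]]]; [left; subst; auto | right; left; apply (emb_pos hf); auto|].
  right; right; exists (f z); split; [apply hf; auto|]. split; apply (emb_pos hf); auto.
Qed.

Lemma isof_near U (E : U -> U -> Prop) f A B x y :
  isof E f A B -> A x -> A y -> (near E A x y <-> near E B (f x) (f y)).
Proof.
  intros hf hx hy; split; [apply emb_near; auto; apply hf|].
  intros h. pose proof (isof_inv hf) as hi.
  apply (emb_near (proj1 hi)) in h; try (apply hf; auto).
  rewrite !(isof_inv_l hf) in h; auto.
Qed.

Lemma isof_conn U (E : U -> U -> Prop) f A B : isof E f A B -> conn E A -> conn E B.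
Proof.
  intros hf hc x y hx hy. destruct hf as [hf sf].
  destruct (sf x hx) as [x' [hx' <-]]. destruct (sf y hy) as [y' [hy' <-]].
  apply emb_near with A; auto.
Qed.

Lemma iso_conn U (E : U -> U -> Prop) A B : iso E A B -> (conn E A <-> conn E B).
Proof.
  intros h; split; [destruct h as [f hf] | apply iso_sym in h; destruct h as [f hf]];
    apply isof_conn with f; auto.
Qed.

Lemma emb_co U (E : U -> U -> Prop) f A B : emb E f A B -> emb (co E) f A B.
Proof.
  intros hf; split; try apply hf. intros x y hx hy; unfold co.
  rewrite <- (emb_adj hf hx hy). split; intros [h1 h2]; split; auto; intros e; apply h1.
  - apply (emb_inj hf); auto.
  - subst; auto.
Qed.

Lemma emb_co_iff U (E : U -> U -> Prop) (hE : cog E) f A B : emb (co E) f A B <-> emb E f A B.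
Proof. split; [|apply emb_co]. intros h. rewrite <- (co_co hE). apply emb_co; auto. Qed.

Lemma isof_co U (E : U -> U -> Prop) f A B : isof E f A B -> isof (co E) f A B.
Proof. intros [h1 h2]; split; auto; apply emb_co; auto. Qed.
Lemma iso_co U (E : U -> U -> Prop) A B : iso E A B -> iso (co E) A B.
Proof. intros [f h]; exists f; apply isof_co; auto. Qed.
Lemma le_co U (E : U -> U -> Prop) A B : le E A B -> le (co E) A B.
Proof. intros [f h]; exists f; apply emb_co; auto. Qed.
Lemma le_co_iff U (E : U -> U -> Prop) (hE : cog E) A B : le (co E) A B <-> le E A B.
Proof. split; [|apply le_co]. intros h. rewrite <- (co_co hE). apply le_co; auto. Qed.
Lemma eqm_co U (E : U -> U -> Prop) A B : eqm E A B -> eqm (co E) A B.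
Proof. intros [h1 h2]; split; apply le_co; auto. Qed.

(* Equimorphism alone does not preserve connectedness of the graph or of its complement. *)
Record ksib {U} (E : U -> U -> Prop) (A Y : set U) : Prop := Ksib {
  ksib_eqm : eqm E A Y;
  ksib_conn : conn E A <-> conn E Y;
  ksib_coconn : conn (co E) A <-> conn (co E) Y
}.

Lemma ksib_refl U (E : U -> U -> Prop) A : ksib E A A.
Proof. split; [apply eqm_refl | tauto | tauto]. Qed.
Lemma ksib_sym U (E : U -> U -> Prop) A B : ksib E A B -> ksib E B A.
Proof. intros [h1 h2 h3]; split; [apply eqm_sym; auto | tauto | tauto]. Qed.
Lemma ksib_trans U (E : U -> U -> Prop) A B C : ksib E A B -> ksib E B C -> ksib E A C.
Proof. intros [h1 h2 h3] [h4 h5 h6]; split; [apply eqm_trans with B; auto | tauto | tauto]. Qed.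
Lemma iso_ksib U (E : U -> U -> Prop) A B : iso E A B -> ksib E A B.
Proof.
  intros h; split; [apply iso_eqm; auto | apply iso_conn; auto | apply iso_conn, iso_co; auto].
Qed.
Lemma ksib_co U (E : U -> U -> Prop) (hE : cog E) A B : ksib E A B -> ksib (co E) A B.
Proof. intros [h1 h2 h3]; split; [apply eqm_co; auto | auto | rewrite (co_co hE); auto]. Qed.
Lemma ksib_co_iff U (E : U -> U -> Prop) (hE : cog E) A B : ksib (co E) A B <-> ksib E A B.
Proof.
  split; [|apply ksib_co; auto]. intros h. rewrite <- (co_co hE).
  apply ksib_co; auto using cog_co.
Qed.

(** The bound [m] is explicit because the uniqueness proof is an induction on it. *)
Definition finl {U} (E : U -> U -> Prop) m (A : set U) :=
  exists l, length l <= m /\ forall Y, ksib E A Y -> exists Z, In Z l /\ iso E Y Z.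
Definition uniq {U} (E : U -> U -> Prop) (A : set U) := forall Y, ksib E A Y -> iso E A Y.

Lemma finl_ksib U (E : U -> U -> Prop) m A B : ksib E A B -> finl E m A -> finl E m B.
Proof.
  intros h [l [h1 h2]]; exists l; split; auto. intros Y hY; apply h2. apply ksib_trans with B; auto.
Qed.
Lemma finl_co U (E : U -> U -> Prop) (hE : cog E) m A : finl E m A -> finl (co E) m A.
Proof.
  intros [l [h1 h2]]; exists l; split; auto. intros Y hY. apply (ksib_co_iff hE) in hY.
  destruct (h2 Y hY) as [Z [h3 h4]]; exists Z; split; auto using iso_co.
Qed.
Lemma finl_co_iff U (E : U -> U -> Prop) (hE : cog E) m A : finl (co E) m A <-> finl E m A.
Proof.
  split; [|apply finl_co; auto]. intros h. rewrite <- (co_co hE).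
  apply finl_co; auto using cog_co.
Qed.
Lemma uniq_co U (E : U -> U -> Prop) (hE : cog E) A : uniq E A -> uniq (co E) A.
Proof. intros h Y hY. apply (ksib_co_iff hE) in hY. apply iso_co; auto. Qed.
Lemma uniq_co_iff U (E : U -> U -> Prop) (hE : cog E) A : uniq (co E) A <-> uniq E A.
Proof.
  split; [|apply uniq_co; auto]. intros h. rewrite <- (co_co hE).
  apply uniq_co; auto using cog_co.
Qed.

(** * Strong modules under isomorphisms and embeddings *)

Lemma half_img U (E : U -> U -> Prop) f A B M :
  isof E f A B -> sub M A -> halfstrong E A M -> halfstrong E B (img f M).
Proof.
  intros hf hs hh hc z hz hnz hzM. destruct hf as [hf sf].
  destruct (sf z hz) as [z' [hz' <-]].
  destruct (hh) with (z := z') as [u [hu [hnu [h1 h2]]]]; auto.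
  - intros h; apply hc. apply isof_conn with f M; auto. apply isof_img with B.
    apply emb_restrict with A B; auto. intros x hx; apply hf; auto.
  - intros h; apply hnz; exists z'; auto.
  - intros x hx h. apply (hzM (f x)); [exists x; auto|]. apply (emb_pos hf); auto.
  - exists (f u); split; [apply hf; auto|]. split; [|split].
    + intros [u' [h3 h4]]. apply hnu. assert (u' = u) by (apply (emb_inj hf); auto). subst; auto.
    + intros x [x' [hx' <-]]. apply (emb_pos hf); auto.
    + intros h; apply h2. apply (emb_neg hf); auto.
Qed.

Lemma strong_img U (E : U -> U -> Prop) (hE : cog E) f A B M :
  isof E f A B -> strong E A M -> strong E B (img f M).
Proof.
  intros hf hM. pose proof (strong_sub hM) as hs. split.
  - destruct (strong_ne hM) as [x hx]; exists (f x), x; auto.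
  - destruct (strong_mod hM) as [_ hm]. destruct hf as [hf sf]. split.
    + intros y [x [hx <-]]; apply hf; auto.
    + intros u x y hu hnu [x' [hx <-]] [y' [hy <-]]. destruct (sf u hu) as [u' [hu' <-]].
      intros h; apply (emb_pos hf); auto. apply (hm u' x' y'); auto.
      * intros h'; apply hnu; exists u'; auto.
      * apply (emb_neg hf); auto.
  - apply half_img with A; auto; apply hM.
  - apply half_img with A; auto using isof_co; apply hM.
Qed.

(* For non-adjacent [x], [y]: the least strong module containing both. *)
Definition Lset {U} (E : U -> U -> Prop) (A : set U) x y : set U :=
  fun z => A z /\ forall w, A w -> E w x -> E w y -> E w z.

Lemma Lset_l U (E : U -> U -> Prop) (A : set U) x y : A x -> Lset E A x y x.
Proof. split; auto. Qed.
Lemma Lset_r U (E : U -> U -> Prop) (A : set U) x y : A y -> Lset E A x y y.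
Proof. split; auto. Qed.

Lemma Lset_far U (E : U -> U -> Prop) (hE : cog E) A x y :
  x <> y -> ~ E x y -> ~ near E (Lset E A x y) x y.
Proof.
  intros h1 h2 [h|[h|[z [[hz h3] [h4 h5]]]]]; auto.
  (* A common neighbour of [x] and [y] inside [Lset] would be adjacent to itself. *)
  apply (@cog_irr _ _ hE z). apply h3; ea.
Qed.

Lemma far_Lset_disc U (E : U -> U -> Prop) (hE : cog E) A x y :
  A x -> A y -> x <> y -> ~ E x y -> ~ conn E (Lset E A x y).
Proof. intros hx hy h1 h2 hc. apply (Lset_far hE (A:=A) h1 h2). apply hc; [apply Lset_l | apply Lset_r]; auto. Qed.

Lemma disc_coconn U (E : U -> U -> Prop) (hE : cog E) (A : set U) : ~ conn E A -> conn (co E) A.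
Proof.
  intros hc x y hx hy.
  destruct (classic (E x y)) as [hxy|hxy].
  - assert (h : exists z, A z /\ ~ near E A x z).
    { apply NNPP; intros h. apply hc. intros a b ha hb. apply (near_trans hE) with x; auto.
      - apply (near_sym hE). apply NNPP; intros h'; apply h; exists a; auto.
      - apply NNPP; intros h'; apply h; exists b; auto. }
    destruct h as [z [hz hn]]. right; right; exists z; split; auto.
    assert (hyz : ~ near E A y z).
    { intros h; apply hn. apply (near_step hE) with y; auto. }
    split; split.
    + intros e; subst; apply hn, near_refl.
    + intros h; apply hn; right; left; auto.
    + intros e; subst; apply hyz, near_refl.
    + intros h; apply hyz; right; left; ea.
  - destruct (classic (x = y)); [left; auto | right; left; split; auto].
Qed.

Lemma strong_Lset U (E : U -> U -> Prop) (hE : cog E) A x y :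
  A x -> A y -> x <> y -> ~ E x y -> strong E A (Lset E A x y).
Proof.
  intros hx hy hne hxy. split.
  - exists x; apply Lset_l; auto.
  - split; [intros z [hz _]; auto|].
    (* A vertex [u] outside [Lset] misses some common neighbour [w] of [x] and [y]. Every deviation
       from the equivalence gives an induced path on four vertices through [w], or a vertex [d]
       adjacent to itself. *)
    assert (key : forall u d, A u -> ~ Lset E A x y u -> Lset E A x y d -> (E u d <-> (E u x /\ E u y))).
    { intros u d hu hnu [hd hd2].
      assert (hw : exists w, A w /\ E w x /\ E w y /\ ~ E w u).
      { apply NNPP; intros h; apply hnu; split; auto. intros w hw h1 h2; apply NNPP; intros h3.
        apply h; exists w; auto. }
      destruct hw as [w [hw [hwx [hwy hwu]]]].
      split; [|intros [h1 h2]; apply hd2; auto].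
      intros hud.
      assert (hwd : E w d) by (apply hd2; auto).
      assert (huw : ~ E u w) by (intros h; apply hwu; ea).
      assert (hux : E u x \/ E d x).
      { apply NNPP; intros h; apply not_or_and in h; destruct h as [h1 h2].
        apply (cog_p4 hE (a:=u) (b:=d) (c:=w) (d:=x)); ea. }
      assert (huy : E u y \/ E d y).
      { apply NNPP; intros h; apply not_or_and in h; destruct h as [h1 h2].
        apply (cog_p4 hE (a:=u) (b:=d) (c:=w) (d:=y)); ea. }
      assert (hnd : ~ (E d x /\ E d y)).
      { intros [h1 h2]. apply (@cog_irr _ _ hE d). apply hd2; auto. }
      assert (h1 : E u x -> E u y).
      { intros h; apply NNPP; intros h'.
        apply (cog_p4 hE (a:=u) (b:=x) (c:=w) (d:=y)); ea. }
      assert (h2 : E u y -> E u x).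
      { intros h; apply NNPP; intros h'.
        apply (cog_p4 hE (a:=u) (b:=y) (c:=w) (d:=x)); ea. intros h3; apply hxy; ea. }
      tauto. }
    intros u a b hu hnu ha hb hab. apply (key u b); auto. apply (key u a); auto.
  - intros _ z hz hnz _.
    assert (hw : exists w, A w /\ E w x /\ E w y /\ ~ E w z).
    { apply NNPP; intros h; apply hnz; split; auto. intros w hw h1 h2; apply NNPP; intros h3.
      apply h; exists w; auto. }
    destruct hw as [w [hw [hwx [hwy hwz]]]]. exists w; split; [auto|split; [|split; auto]].
    + intros [_ h]. apply (@cog_irr _ _ hE w). apply h; auto.
    + intros d [_ hd]; auto.
  - intros hc. exfalso; apply hc. apply disc_coconn; auto. apply far_Lset_disc; auto.
Qed.

(** Since [x] and [y] lie in different components of [M], their common neighbours are outside [M]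
    and so adjacent to all of [M]. Conversely, for [z] outside [M] the vertex given by [halfstrong]
    is a common neighbour of [x] and [y] that misses [z]. *)
Lemma strong_eq_Lset U (E : U -> U -> Prop) (hE : cog E) A M x y :
  strong E A M -> M x -> M y -> ~ near E M x y -> M = Lset E A x y.
Proof.
  intros hM hx hy hn. destruct (strong_mod hM) as [hs hm]. apply set_ext; intros z; split.
  - intros hz; split; auto. intros w hw h1 h2.
    apply (hm w x z); auto. intros hw'; apply hn; right; right; exists w; ea.
  - intros [hz h]. apply NNPP; intros hnz.
    assert (hzx : ~ E z x).
    { intros h1. assert (h2 : E z y) by (apply (hm z x y); auto).
      apply (@cog_irr _ _ hE z). auto. }
    destruct (strong_half hM) with (z := z) as [u [hu [hnu [h1 h2]]]]; auto.
    + intros x' hx' h'. apply hzx. apply (hm z x' x); auto.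
Qed.

(** The module is the component of [b] in the least strong module containing [b] and [v]. *)
Lemma strong_sep U (E : U -> U -> Prop) (hE : cog E) A B v b :
  sub B A -> conn E B -> B b -> A v -> ~ B v -> (forall x, B x -> ~ E v x) ->
  exists M, strong E A M /\ sub B M /\ ~ M v.
Proof.
  intros hs hc hb hv hnv hvB.
  assert (hne : b <> v) by (intros e; subst; auto).
  assert (hbv : ~ E b v) by (intros h; apply (hvB b hb); ea).
  set (L := Lset E A b v).
  assert (hL : strong E A L) by (apply strong_Lset; auto).
  assert (hLb : L b) by (apply Lset_l; auto).
  (* Otherwise [v w c c'] would be an induced path; so adjacency to [w] spreads along the edges of
     [B]. *)
  assert (st : forall w c c', E w v -> B c -> B c' -> E w c -> E c c' -> E w c').
  { intros w c c' h1 h2 h3 h4 h5. apply NNPP; intros h6.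
    apply (cog_p4 hE (a:=v) (b:=w) (c:=c) (d:=c')); ea. }
  assert (hBL : sub B L).
  { intros x hx; split; auto. intros w hw h1 h2.
    destruct (hc b x hb hx) as [h|[h|[c [h3 [h4 h5]]]]].
    - subst; auto.
    - apply (st w b x); auto.
    - apply (st w c x); auto. apply (st w b c); auto. }
  exists (comp E L b); split; [|split].
  - apply (strong_trans hE) with L; auto. apply strong_comp; auto.
  - intros x hx; split; auto. apply near_sub with B; auto.
  - intros [_ h]. apply (Lset_far hE (A:=A) hne hbv h).
Qed.

Definition hull {U} (E : U -> U -> Prop) (A X : set U) : set U :=
  fun z => forall M, strong E A M /\ sub X M -> M z.

Lemma hull_co U (E : U -> U -> Prop) (hE : cog E) A X : hull (co E) A X = hull E A X.
Proof.
  apply set_ext; intros z; split; intros h M [h1 h2]; apply h; split; auto; apply (strong_co_iff hE); auto.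
Qed.
Lemma hull_ge U (E : U -> U -> Prop) A X : sub X (hull E A X).
Proof. intros x hx M [h1 h2]; auto. Qed.
Lemma hull_le U (E : U -> U -> Prop) A X M : strong E A M -> sub X M -> sub (hull E A X) M.
Proof. intros h1 h2 x hx; apply hx; auto. Qed.
Lemma hull_strong U (E : U -> U -> Prop) (hE : cog E) A X :
  sub X A -> (exists x, X x) -> strong E A (hull E A X).
Proof.
  intros hs [x hx]. apply (strong_inter hE (M0:=A)).
  - intros M [h _]; auto.
  - split; auto. apply strong_self; eauto.
  - exists x; intros M [_ h]; auto.
Qed.

(** When [M] is connected, so is its image, and [strong_sep] applies to it. A disconnected [M] is
    first enlarged by the vertex [u] of [halfstrong], which connects [M] without reaching [z]. *)
Lemma hull_escape_half U (E : U -> U -> Prop) (hE : cog E) f A0 A1 M z m :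
  strong E A0 M -> A0 z -> ~ M z -> M m -> ~ E z m -> emb E f A0 A1 ->
  exists M', strong E A1 M' /\ sub (img f M) M' /\ ~ M' (f z).
Proof.
  intros hM hz hnz hm hzm hf. destruct (strong_mod hM) as [hs hmod].
  assert (hzM : forall x, M x -> ~ E z x) by (intros x hx h; apply hzm, (hmod z x m); auto).
  assert (main : forall B, sub B A0 -> conn E B -> sub M B -> ~ B z -> (forall x, B x -> ~ E z x) ->
     exists M', strong E A1 M' /\ sub (img f M) M' /\ ~ M' (f z)).
  { intros B hBA hBc hMB hBz hzB.
    assert (hfB : emb E f B A1) by (apply emb_restrict with A0 A1; auto; intros x hx; apply hf; auto).
    destruct (@strong_sep U E hE A1 (img f B) (f z) (f m)) as [M' [h1 [h2 h3]]].
    - apply img_sub with E; auto.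
    - apply isof_conn with f B; auto. apply isof_img with A1; auto.
    - exists m; auto.
    - apply hf; auto.
    - intros [x [h1 h2]]. apply hBz. assert (x = z) by (apply (emb_inj hf); auto). subst; auto.
    - intros y [x [hx <-]] h. apply (hzB x hx). apply (emb_neg hf); auto.
    - exists M'; split; auto; split; auto. intros y [x [hx <-]]; apply h2; exists x; auto. }
  destruct (classic (conn E M)) as [hc|hc].
  - apply (main M); auto. intros x; auto.
  - destruct (strong_half hM hc hz hnz hzM) as [u [hu [hnu [h1 h2]]]].
    apply (main (fun x => M x \/ x = u)).
    + intros x [h|h]; subst; auto.
    + intros x y [hx|hx] [hy|hy]; subst.
      * right; right; exists u; ea.
      * right; left; ea.
      * right; left; auto.
      * left; auto.
    + intros x hx; auto.
    + intros [h|h]; subst; auto.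
    + intros x [hx|hx]; subst; auto. intros h; apply h2; ea.
Qed.

(** This is how proper inclusions of strong modules survive an embedding, although the image of a
    strong module need not be a module. *)
Lemma hull_escape U (E : U -> U -> Prop) (hE : cog E) f A0 A1 M z :
  strong E A0 M -> A0 z -> ~ M z -> emb E f A0 A1 -> ~ hull E A1 (img f M) (f z).
Proof.
  intros hM hz hnz hf hh. destruct (strong_ne hM) as [m hm].
  assert (h : exists M', strong E A1 M' /\ sub (img f M) M' /\ ~ M' (f z)).
  { destruct (classic (E z m)) as [he|he].
    - destruct (@hull_escape_half U (co E) (cog_co hE) f A0 A1 M z m) as [M' [h1 [h2 h3]]]; auto.
      + apply strong_co; auto.
      + intros [_ h]; auto.
      + apply emb_co; auto.
      + exists M'; split; auto. apply (strong_co_iff hE); auto.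
    - apply (hull_escape_half hE) with A0 m; auto. }
  destruct h as [M' [h1 [h2 h3]]]. apply h3, hh; auto.
Qed.

(** * Rigidity of strong modules and connectedness of siblings *)

Definition nonest {U} (E : U -> U -> Prop) (A : set U) :=
  forall S S', strong E A S -> strong E A S' -> sub S S' -> le E S' S -> sub S' S.

Lemma nonest_co U (E : U -> U -> Prop) (hE : cog E) A : nonest E A -> nonest (co E) A.
Proof.
  intros h S S' h1 h2 h3 h4; apply h; auto.
  - apply (strong_co_iff hE); auto.
  - apply (strong_co_iff hE); auto.
  - apply (le_co_iff hE); auto.
Qed.

Lemma nonest_strong U (E : U -> U -> Prop) (hE : cog E) A M : strong E A M -> nonest E A -> nonest E M.
Proof.
  intros hM h S S' h1 h2; apply h; apply (strong_trans hE) with M; auto.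
Qed.

(** The image of [A] lies in one component of [B]. As [B] embeds into [A], it embeds into that
    component, and rigidity leaves no other one. *)
Lemma conn_le_disc U (E : U -> U -> Prop) (hE : cog E) A B :
  (exists x, A x) -> eqm E A B -> nonest E B -> conn E A -> conn E B.
Proof.
  intros [x hx] [[f hf] h2] hB hA.
  assert (hfx : B (f x)) by (apply hf; auto).
  assert (hs : sub B (comp E B (f x))).
  { apply hB.
    - apply strong_comp; auto.
    - apply strong_self; eauto.
    - intros y [h _]; auto.
    - apply le_trans with A; auto. exists f. apply emb_restrict with A B; auto.
      + intros y; auto.
      + intros y hy; split; [apply hf; auto | apply emb_near with A; auto]. }
  intros y z hy hz. destruct (hs y hy) as [_ h3]. destruct (hs z hz) as [_ h4].
  apply (near_trans hE) with (f x); auto. apply near_sym; auto.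
Qed.

Lemma eqm_ksib U (E : U -> U -> Prop) (hE : cog E) A B :
  (exists x, A x) -> eqm E A B -> nonest E A -> nonest E B -> ksib E A B.
Proof.
  intros hne h hA hB.
  assert (hne' : exists x, B x).
  { destruct hne as [x hx]; destruct h as [[f hf] _]; exists (f x); apply hf; auto. }
  split; auto; split.
  - apply conn_le_disc; auto.
  - apply conn_le_disc; auto using eqm_sym.
  - apply conn_le_disc; auto using cog_co, eqm_co, nonest_co.
  - apply conn_le_disc; auto using cog_co, eqm_co, nonest_co, eqm_sym.
Qed.

(** * Replacing disjoint modules *)

(* [N] with every module [M] of the family [F] shrunk to [B M]. *)
Definition repl {U} (N : set U) (F : set U -> Prop) (B : set U -> set U) : set U :=
  fun z => N z /\ forall M, F M -> M z -> B M z.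

(** When no replaced module is all of [N], the graph with these modules contracted decides
    connectedness; the last two fields cover the remaining case. *)
Record replable {U} (E : U -> U -> Prop) (N : set U) (F : set U -> Prop) (B : set U -> set U) : Prop := {
  rp_mod : forall M, F M -> module E N M;
  rp_disj : forall M M' z, F M -> F M' -> M z -> M' z -> M = M';
  rp_sub : forall M, F M -> sub (B M) M;
  rp_le : forall M, F M -> le E M (B M);
  rp_ne : forall M, F M -> exists z, M z;
  rp_conn : F N -> (conn E N <-> conn E (B N));
  rp_coconn : F N -> (conn (co E) N <-> conn (co E) (B N))
}.

Lemma replable_co U (E : U -> U -> Prop) (hE : cog E) N F B : replable E N F B -> replable (co E) N F B.
Proof.
  intros h; split; try apply h.
  - intros M hM; apply module_co; auto; apply (rp_mod h); auto.
  - intros M hM; apply le_co, (rp_le h); auto.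
  - rewrite (co_co hE); apply h.
Qed.

(** The two vertices coincide once every module of [F] is contracted to a point. *)
Definition place {U} (F : set U -> Prop) (z z' : U) := z = z' \/ exists M, F M /\ M z /\ M z'.

Lemma place_adj U (E : U -> U -> Prop) (hE : cog E) N F B x y x' y' :
  replable E N F B -> N x -> N y -> N x' -> N y' -> place F x x' -> place F y y' ->
  ~ (exists M, F M /\ M x /\ M y) -> E x y -> E x' y'.
Proof.
  intros hr hx hy hx' hy' px py hn h.
  assert (h1 : E x y').
  { destruct py as [->|[M [hM [h1 h2]]]]; auto.
    destruct (rp_mod hr hM) as [_ hm]. apply (hm x y y'); auto. intros h3; apply hn; eauto. }
  destruct px as [->|[M [hM [h2 h3]]]]; auto.
  destruct (rp_mod hr hM) as [_ hm]. apply (cog_sym hE). apply (hm y' x x'); ea.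
  intros h4. destruct py as [->|[M' [hM' [h5 h6]]]]; [apply hn; eauto|].
  assert (M = M') by (apply (rp_disj hr hM hM' h4 h6)). subst. apply hn; eauto.
Qed.

Lemma place_sym U (F : set U -> Prop) (z z' : U) : place F z z' -> place F z' z.
Proof. intros [->|[M [h1 [h2 h3]]]]; [left; auto | right; exists M; auto]. Qed.

Lemma place_sep U (E : U -> U -> Prop) N F B x y x' y' : replable E N F B ->
  place F x x' -> place F y y' -> 
  ~ (exists M, F M /\ M x /\ M y) -> ~ (exists M, F M /\ M x' /\ M y').
Proof.
  intros hr px py hn [M [hM [h1 h2]]]. apply hn. exists M; split; auto. split.
  - destruct px as [->|[M' [hM' [h5 h6]]]]; auto.
    rewrite (rp_disj hr hM hM' h1 h6); auto.
  - destruct py as [->|[M' [hM' [h5 h6]]]]; auto.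
    rewrite (rp_disj hr hM hM' h2 h6); auto.
Qed.

Lemma repl_map U (E : U -> U -> Prop) (hE : cog E) N F B : replable E N F B ->
  exists r, emb E r N (repl N F B) /\ (forall M z, F M -> M z -> B M (r z)) /\
    (forall z, N z -> place F z (r z)).
Proof.
  intros hr.
  assert (hrho : forall M : set U, exists g : U -> U, F M -> emb E g M (B M)).
  { intros M. destruct (classic (F M)) as [h|h].
    - destruct (rp_le hr h) as [g hg]; exists g; auto.
    - exists (fun x => x); tauto. }
  apply choice in hrho. destruct hrho as [rho hrho].
  assert (hr0 : forall z, exists z', (forall M, F M -> M z -> z' = rho M z) /\ ((forall M, F M -> ~ M z) -> z' = z)).
  { intros z. destruct (classic (exists M, F M /\ M z)) as [[M [hM hz]]|h].
    - exists (rho M z); split.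
      + intros M' hM' hz'. rewrite (rp_disj hr hM hM' hz hz'); auto.
      + intros h; exfalso; apply (h M); auto.
    - exists z; split; auto. intros M hM hz; exfalso; apply h; eauto. }
  apply choice in hr0. destruct hr0 as [r hr0].
  assert (hB : forall M z, F M -> M z -> B M (r z)).
  { intros M z hM hz. rewrite (proj1 (hr0 z) M hM hz). apply (hrho M hM); auto. }
  assert (hP : forall z, place F z (r z)).
  { intros z. destruct (classic (exists M, F M /\ M z)) as [[M [hM hz]]|h].
    - right; exists M; split; auto; split; auto. apply (rp_sub hr hM); auto.
    - left. symmetry; apply (hr0 z). intros M hM hz; apply h; eauto. }
  assert (hN : forall z, N z -> N (r z)).
  { intros z hz. destruct (classic (exists M, F M /\ M z)) as [[M [hM hz']]|h].
    - apply (rp_mod hr hM). apply (rp_sub hr hM); auto.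
    - rewrite (proj2 (hr0 z)); auto. intros M hM hz'; apply h; eauto. }
  exists r; split; [|split; auto]. split.
  - intros z hz; split; auto. intros M hM hz'.
    destruct (classic (M z)) as [h|h]; auto.
    destruct (hP z) as [e|[M' [hM' [h1 h2]]]]; [rewrite <- e in hz'; contradiction|].
    rewrite (rp_disj hr hM hM' hz' h2) in h; contradiction.
  - intros x y hx hy e.
    destruct (classic (exists M, F M /\ M x /\ M y)) as [[M [hM [h1 h2]]]|h].
    + rewrite (proj1 (hr0 x) M hM h1), (proj1 (hr0 y) M hM h2) in e.
      apply (emb_inj (hrho M hM)); auto.
    + destruct (hP x) as [e1|[M [hM [h1 h2]]]]; destruct (hP y) as [e2|[M' [hM' [h3 h4]]]].
      * congruence.
      * exfalso; apply h; exists M'; rewrite e1, e; auto.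
      * exfalso; apply h; exists M; rewrite e2, <- e; auto.
      * exfalso; apply h; exists M; split; auto; split; auto.
        rewrite e in h2. rewrite (rp_disj hr hM hM' h2 h4); auto.
  - intros x y hx hy.
    destruct (classic (exists M, F M /\ M x /\ M y)) as [[M [hM [h1 h2]]]|h].
    + rewrite (proj1 (hr0 x) M hM h1), (proj1 (hr0 y) M hM h2). apply (hrho M hM); auto.
    + split; apply (place_adj hE hr); auto using place_sym.
      apply (place_sep hr (hP x) (hP y) h).
Qed.

Lemma repl_sub U (N : set U) F B : sub (repl N F B) N.
Proof. intros z [h _]; auto. Qed.

Lemma repl_conn U (E : U -> U -> Prop) (hE : cog E) N F B : replable E N F B ->
  (conn E N <-> conn E (repl N F B)).
Proof.
  intros hr. destruct (repl_map hE hr) as [r [hr1 [hr2 hr3]]].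
  destruct (classic (F N)) as [hFN|hFN].
  { replace (repl N F B) with (B N); [apply hr; auto|].
    apply set_ext; intros z; split.
    - intros h. assert (N z) by (apply (rp_sub hr hFN); auto). split; auto.
      intros M hM hz. rewrite (rp_disj hr hM hFN (z:=z)); auto.
    - intros [h1 h2]; auto. }
  assert (hprop : forall M, F M -> exists m, N m /\ ~ M m).
  { intros M hM. apply NNPP; intros h. apply hFN.
    replace N with M; auto. apply set_ext; intros z; split; [apply (rp_mod hr hM)|].
    intros hz; apply NNPP; intros hz'; apply h; eauto. }
  split; intros hc x y hx hy.
  - assert (hx0 : N x) by apply hx. assert (hy0 : N y) by apply hy.
    (* A middle vertex [w] may be lost inside the module of [x]. If [y] lies there too, an outside
       neighbour of the module replaces [w]; otherwise [y] is already adjacent to [x]. *)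
    assert (hout : forall M w, F M -> M x -> M w -> N w -> E w y -> near E (repl N F B) x y).
    { intros M w hM hxM hwM hw hwy. destruct (classic (M y)) as [hyM|hyM].
      - destruct (hprop M hM) as [m [hm hnm]].
        destruct (conn_exit hE hc (proj1 (rp_mod hr hM)) hxM hm hnm) as [u [k [hu [hnu [hk huk]]]]].
        destruct (rp_mod hr hM) as [_ hmod].
        assert (hux : E u x) by (apply (hmod u k x); auto).
        assert (huy : E u y) by (apply (hmod u k y); auto).
        assert (hno : forall v, M v -> ~ (exists M, F M /\ M u /\ M v)).
        { intros v hv [M' [hM' [h1 h2]]]. rewrite (rp_disj hr hM' hM h2 hv) in h1; auto. }
        right; right; exists (r u). split; [apply hr1; auto|].
        assert (N (r u)) by (apply repl_sub with F B, hr1; auto).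
        split; [apply (cog_sym hE); apply (place_adj hE hr (x:=u) (y:=x)) | apply (place_adj hE hr (x:=u) (y:=y))];
          auto; left; auto.
      - destruct (rp_mod hr hM) as [_ hmod]. right; left. apply (cog_sym hE).
        apply (hmod y w x); ea. }
    destruct (hc x y hx0 hy0) as [h|[h|[w [hw [h1 h2]]]]]; [left; auto | right; left; auto|].
    destruct (classic (exists M, F M /\ M x /\ M w)) as [[M [hM [h3 h4]]]|hno].
    { apply (hout M w); auto. }
    destruct (classic (exists M, F M /\ M w /\ M y)) as [[M [hM [h3 h4]]]|hno'].
    { right; left. destruct (rp_mod hr hM) as [_ hmod].
      apply (hmod x w y); auto. intros h; apply hno; eauto. }
    right; right. exists (r w). split; [apply hr1; auto|].
    assert (N (r w)) by (apply repl_sub with F B, hr1; auto).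
    split; [apply (place_adj hE hr (x:=x) (y:=w)) | apply (place_adj hE hr (x:=w) (y:=y))]; auto;
      left; auto.
  - assert (hrN : forall z, N z -> N (r z)) by (intros z hz; apply repl_sub with F B, hr1; auto).
    destruct (classic (exists M, F M /\ M x /\ M y)) as [[M [hM [hxM hyM]]]|hno].
    + destruct (hprop M hM) as [m [hm hnm]].
      destruct (@conn_exit U E hE (repl N F B) (B M) (r x) (r m)) as [u [k [hu [hnu [hk huk]]]]]; auto.
      * intros z hz. assert (hzM : M z) by (apply (rp_sub hr hM); auto).
        split; [apply (rp_mod hr hM); auto|]. intros M' hM' hz'.
        rewrite (rp_disj hr hM' hM hz' hzM); auto.
      * apply hr1; auto.
      * intros h. apply (rp_sub hr hM) in h.
        destruct (hr3 m hm) as [e|[M' [hM' [h1 h2]]]]; [rewrite <- e in h; auto|].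
        rewrite (rp_disj hr hM' hM h2 h) in h1; auto.
      * assert (hnuM : ~ M u) by (intros h; apply hnu; apply hu; auto).
        apply (rp_sub hr hM) in hk. destruct (rp_mod hr hM) as [_ hmod].
        right; right; exists u; split; [apply hu|].
        split; [apply (cog_sym hE); apply (hmod u k x) | apply (hmod u k y)]; auto; apply hu.
    + assert (hno' := place_sep hr (hr3 x hx) (hr3 y hy) hno).
      destruct (hc (r x) (r y)) as [h|[h|[w [hw [h1 h2]]]]]; try (apply hr1; auto).
      * left. apply (emb_inj hr1); auto.
      * right; left. apply (emb_neg hr1); auto.
      * assert (hw0 : N w) by apply hw.
        destruct (classic (exists M, F M /\ M (r x) /\ M w)) as [[M [hM [h3 h4]]]|hno1].
        { right; left. apply (emb_neg hr1); auto.
          destruct (rp_mod hr hM) as [_ hmod]. apply (cog_sym hE).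
          apply (hmod (r y) w (r x)); ea. intros h; apply hno'; eauto. }
        destruct (classic (exists M, F M /\ M w /\ M (r y))) as [[M [hM [h3 h4]]]|hno2].
        { right; left. apply (emb_neg hr1); auto.
          destruct (rp_mod hr hM) as [_ hmod].
          apply (hmod (r x) w (r y)); auto. intros h; apply hno'; eauto. }
        right; right; exists w; split; auto.
        split; [apply (place_adj hE hr (x:=r x) (y:=w)) | apply (place_adj hE hr (x:=w) (y:=r y))];
          auto using place_sym; left; auto.
Qed.

Lemma repl_ksib U (E : U -> U -> Prop) (hE : cog E) N F B : replable E N F B ->
  ksib E N (repl N F B).
Proof.
  intros hr; split.
  - split; [|apply le_sub, repl_sub].
    destruct (repl_map hE hr) as [r [h _]]; exists r; auto.
  - apply repl_conn; auto.
  - apply repl_conn; auto using cog_co, replable_co.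
Qed.

(** * Coding bit sequences in siblings *)

(* Diagonal argument: finitely many countable graphs with two named vertices cannot code all bit
   sequences. *)
Lemma cantor U (E : U -> U -> Prop) (code : U -> nat) m A (H : (nat -> bool) -> set U) a b :
  injective code -> finl E m A -> (forall s, ksib E A (H s)) -> (forall s, H s (a s) /\ H s (b s)) ->
  (forall s t phi, isof E phi (H s) (H t) -> phi (a s) = a t -> phi (b s) = b t -> forall n, s n = t n) ->
  False.
Proof.
  intros hcode [l [_ hl]] hk hab hdec.
  (* The number [c] encodes the position of the isomorphism type in the list and the images of both
     named vertices. *)
  assert (hc : forall s, exists c : nat, exists i Z phi, nth_error l i = Some Z /\ isof E phi (H s) Z /\
     c = Cantor.to_nat (Cantor.to_nat (i, code (phi (a s))), code (phi (b s)))).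
  { intros s. destruct (hl (H s) (hk s)) as [Z [hZ [phi hphi]]].
    apply In_nth_error in hZ. destruct hZ as [i hi]. eexists; exists i, Z, phi; auto. }
  apply choice in hc. destruct hc as [c hc].
  assert (hinj : forall s t, c s = c t -> forall n, s n = t n).
  { intros s t e. destruct (hc s) as [i [Z [f [h1 [h2 h3]]]]]. destruct (hc t) as [j [Z' [g [h4 [h5 h6]]]]].
    rewrite e, h6 in h3. apply to_nat_inj in h3.
    assert (h7 := f_equal snd h3); assert (h8 := f_equal fst h3); cbn [fst snd] in h7, h8.
    apply to_nat_inj in h8.
    assert (h9 := f_equal snd h8); assert (h10 := f_equal fst h8); cbn [fst snd] in h9, h10. subst j.
    rewrite h1 in h4; injection h4; intros <-. apply hcode in h7. apply hcode in h9.
    apply (hdec s t (fun x => inv g (H t) (f x))).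
    - apply isof_comp with Z; auto. apply isof_inv; auto.
    - rewrite <- h9. apply isof_inv_l with E Z; auto. apply hab.
    - rewrite <- h7. apply isof_inv_l with E Z; auto. apply hab. }
  (* [dec] inverts [c] on its range, and [d] is the diagonal sequence against it. Since [dec (c d)]
     and [d] have the same number, they agree everywhere, in particular at [c d]. *)
  set (dec := fun n => epsilon (inhabits (fun _ : nat => true)) (fun s => c s = n)).
  set (d := fun n => negb (dec n n)).
  assert (hd : c (dec (c d)) = c d).
  { unfold dec. apply epsilon_spec. exists d; auto. }
  assert (h : dec (c d) (c d) = negb (dec (c d) (c d))) by exact (hinj _ _ hd (c d)).
  destruct (dec (c d) (c d)); discriminate.
Qed.

Notation it n f x := (Nat.iter n f x).

Lemma iter_add U (f : U -> U) i j x : it (i + j) f x = it i f (it j f x).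
Proof. induction i; simpl; congruence. Qed.

Definition swap {U} (A L Y : set U) : set U := fun z => (A z /\ ~ L z) \/ Y z.

Lemma swap_ksib U (E : U -> U -> Prop) (hE : cog E) A L Y :
  module E A L -> (exists x, L x) -> sub Y L -> le E L Y ->
  (sub A L -> (conn E L <-> conn E Y) /\ (conn (co E) L <-> conn (co E) Y)) ->
  ksib E A (swap A L Y).
Proof.
  intros hm hne hs hle hk.
  replace (swap A L Y) with (repl A (fun M => M = L) (fun _ => Y)).
  - apply repl_ksib; auto. split.
    + intros M ->; auto.
    + intros M M' z -> ->; auto.
    + intros M ->; auto.
    + intros M ->; auto.
    + intros M ->; auto.
    + intros ->. apply hk; intros x; auto.
    + intros ->. apply hk; intros x; auto.
  - apply set_ext; intros z; unfold repl, swap; split.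
    + intros [h1 h2]. destruct (classic (L z)); [right; apply (h2 L) | left]; auto.
    + intros [[h1 h2]|h].
      * split; auto. intros M -> h; contradiction.
      * split; [apply hm; auto | intros; auto].
Qed.

Definition size {U} (A : set U) n := exists l, NoDup l /\ length l = n /\ forall z, A z <-> In z l.

Lemma size_inj U (E : U -> U -> Prop) f (A B : set U) n : isof E f A B -> size A n -> size B n.
Proof.
  intros [hf hs] [l [h1 [h2 h3]]]. exists (map f l); split; [|split].
  - apply NoDup_map_NoDup_ForallPairs; auto. intros x y hx hy. apply (emb_inj hf); apply h3; auto.
  - rewrite length_map; auto.
  - intros z; rewrite in_map_iff; split.
    + intros hz; destruct (hs z hz) as [x [hx <-]]; exists x; split; auto; apply h3; auto.
    + intros [x [<- hx]]; apply hf, h3; auto.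
Qed.

Lemma size_fun U (A : set U) n m : size A n -> size A m -> n = m.
Proof.
  intros [l [h1 [h2 h3]]] [k [h4 [h5 h6]]]. subst.
  apply Nat.le_antisymm; apply NoDup_incl_length; auto; intros z hz; [apply h6, h3 | apply h3, h6]; auto.
Qed.

Lemma seq_not_size U (A : set U) (s : nat -> U) n :
  (forall i, A (s i)) -> (forall i j, s i = s j -> i = j) -> ~ size A n.
Proof.
  intros hA hs [l [h1 [h2 h3]]].
  assert (h : length (map s (seq 0 (S n))) <= length l).
  { apply NoDup_incl_length.
    - apply FinFun.Injective_map_NoDup; [intros x y; apply hs | apply seq_NoDup].
    - intros z hz; apply in_map_iff in hz; destruct hz as [i [<- _]]; apply h3; auto. }
  rewrite length_map, length_seq in h. lia.
Qed.

(* The lowest level above [Z] among the vertices not adjacent to [Z]. *)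
Definition Wset {U} (E : U -> U -> Prop) (H Z : set U) : set U :=
  fun z => H z /\ ~ Z z /\ (forall x, Z x -> ~ E z x) /\
    (forall u, H u -> ~ Z u -> (forall x, Z x -> E u x) -> E u z).

Lemma Wset_img_in U (E : U -> U -> Prop) phi H H' Z :
  isof E phi H H' -> sub Z H -> sub (img phi (Wset E H Z)) (Wset E H' (img phi Z)).
Proof.
  intros [hf hs] hZ y [z [[h1 [h2 [h3 h4]]] <-]]. split; [apply hf; auto|]. split; [|split].
  - intros [x [hx e]]. apply h2. replace z with x; auto. apply (emb_inj hf); auto.
  - intros x' [x [hx <-]] h. apply (h3 x hx). apply (emb_neg hf); auto.
  - intros u' hu' hnu' h. destruct (hs u' hu') as [u [hu <-]].
    apply (emb_pos hf); auto. apply h4; auto.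
    + intros h5; apply hnu'; exists u; auto.
    + intros x hx. apply (emb_neg hf); auto. apply h; exists x; auto.
Qed.

Lemma img_inv U (E : U -> U -> Prop) phi H H' Z :
  isof E phi H H' -> sub Z H -> img (inv phi H) (img phi Z) = Z.
Proof.
  intros hf hZ. apply set_ext; intros z; split.
  - intros [y [[x [hx <-]] <-]]. rewrite (isof_inv_l hf); auto.
  - intros hz. exists (phi z); split; [exists z; auto|]. apply (isof_inv_l hf); auto.
Qed.

Lemma Wset_img U (E : U -> U -> Prop) phi H H' Z :
  isof E phi H H' -> sub Z H -> img phi (Wset E H Z) = Wset E H' (img phi Z).
Proof.
  intros hf hZ. apply set_ext; intros y; split; [apply (Wset_img_in hf hZ)|].
  intros hy. pose proof (isof_inv hf) as hi.
  assert (hs : sub (img phi Z) H') by (intros x [x' [hx <-]]; apply hf; auto).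
  assert (h : Wset E H Z (inv phi H y)).
  { rewrite <- (img_inv hf hZ). apply (Wset_img_in hi hs). exists y; auto. }
  exists (inv phi H y); split; auto. apply (isof_inv_r hf); apply hy.
Qed.

(** The vertex [g] lies above [Z] and [W] and tests membership: an element of [Wset] must be
    adjacent to [g], whereas a vertex beyond [g] is uniform on all of [Z], [W] and [g], so it would
    be adjacent to [Z] as well. *)
Lemma Wset_compute U (E : U -> U -> Prop) (hE : cog E) (H Z W : set U) g x0 :
  Z x0 -> sub W H -> (forall w x, W w -> Z x -> ~ E w x) -> (forall w, W w -> ~ Z w) ->
  H g -> ~ Z g -> (forall x, Z x -> E g x) -> (forall w, W w -> E g w) ->
  (forall u, H u -> ~ Z u -> ~ W u -> u <> g ->
     (forall x, Z x \/ W x \/ x = g -> E u x) \/ (forall x, Z x \/ W x \/ x = g -> ~ E u x)) ->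
  Wset E H Z = W.
Proof.
  intros hx0 hWH hWZ hWn hg hng hgZ hgW hu. apply set_ext; intros z; split.
  - intros [h1 [h2 [h3 h4]]]. apply NNPP; intros hnW.
    assert (hgz : E g z) by (apply h4; auto).
    assert (hzg : z <> g) by (intros e; subst; apply (cog_irr hE hgz)).
    destruct (hu z h1 h2 hnW hzg) as [h|h].
    + apply (h3 x0 hx0); apply h; auto.
    + apply (h g); auto. ea.
  - intros hz; split; [auto|split; [auto|split; [intros x hx; apply hWZ; auto|]]].
    intros u hu1 hu2 hu3.
    destruct (classic (W u)) as [hw|hw]; [exfalso; apply (hWZ u x0); auto|].
    destruct (classic (u = g)) as [->|hug]; auto.
    destruct (hu u hu1 hu2 hw hug) as [h|h]; [apply h; auto|].
    exfalso; apply (h x0); auto.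
Qed.

(** [Lset] is definable from [p] and [r], so an isomorphism fixing these two vertices carries the
    module they name to the module they name. The vertex [g] excludes the vertices that have no
    neighbour in [M]. *)
Lemma Lset_name U (E : U -> U -> Prop) (hE : cog E) (H M : set U) g p r :
  sub M H -> M p -> M r -> ~ near E M p r -> H g -> (forall x, M x -> E g x) ->
  (forall u, H u -> ~ M u -> (forall x, M x -> E u x) \/ ((forall x, M x -> ~ E u x) /\ ~ E u g)) ->
  Lset E H p r = M.
Proof.
  intros hs hp hr hn hg hgM hu. apply set_ext; intros z; split.
  - intros [hz h]. apply NNPP; intros hnz. destruct (hu z hz hnz) as [h1|[h1 h2]].
    + apply (@cog_irr _ _ hE z). apply h; auto.
    + apply h2. apply (cog_sym hE), h; auto.
  - intros hz; split; auto. intros w hw h1 h2.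
    destruct (classic (M w)) as [h3|h3].
    + exfalso; apply hn; right; right; exists w; ea.
    + destruct (hu w hw h3) as [h4|[h4 _]]; auto. exfalso; apply (h4 p); auto.
Qed.

Lemma Lset_img_in U (E : U -> U -> Prop) phi H H' p r :
  isof E phi H H' -> H p -> H r -> sub (img phi (Lset E H p r)) (Lset E H' (phi p) (phi r)).
Proof.
  intros [hf hs] hp hr y [z [[hz h] <-]]. split; [apply hf; auto|].
  intros w' hw' h1 h2. destruct (hs w' hw') as [w [hw <-]].
  apply (emb_pos hf); auto. apply h; auto; apply (emb_neg hf); auto.
Qed.

Lemma Lset_img U (E : U -> U -> Prop) phi H H' p r :
  isof E phi H H' -> H p -> H r -> img phi (Lset E H p r) = Lset E H' (phi p) (phi r).
Proof.
  intros hf hp hr. apply set_ext; intros y; split; [apply (Lset_img_in hf hp hr)|].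
  intros hy. pose proof (isof_inv hf) as hi.
  assert (h : img (inv phi H) (Lset E H' (phi p) (phi r)) (inv phi H y)) by (exists y; auto).
  apply (Lset_img_in hi) in h; try (apply hf; auto).
  rewrite !(isof_inv_l hf) in h by auto.
  exists (inv phi H y); split; auto. apply (isof_inv_r hf); apply hy.
Qed.

(** * Words read outwards from a named module *)

Section Word.
Variables (U : Type) (E : U -> U -> Prop) (hE : cog E) (code : U -> nat) (hcode : injective code).
Variables (m : nat) (A L Z M M' : set U) (v : U) (q : U -> U) (a b p r : U).
Hypotheses (hfin : finl E m A) (hL : module E A L) (hv : A v) (hnv : ~ L v).
Hypotheses (hZL : sub Z L) (hMZ : sub M Z) (hLM : le E L M) (hM'M : sub M' M).
Hypothesis q_in : forall z, Z z -> ~ M' z -> Z (q z) /\ ~ M (q z).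
Hypothesis q_inj : forall x y, Z x -> ~ M' x -> Z y -> ~ M' y -> q x = q y -> x = y.
Hypothesis q_adj : forall x y, Z x -> ~ M' x -> Z y -> ~ M' y -> (E x y <-> E (q x) (q y)).
Hypothesis q_pos : forall z, Z z -> ~ M' z -> (forall x, M' x -> E z x) -> forall x, M x -> E (q z) x.
Hypothesis q_neg : forall z, Z z -> ~ M' z -> (forall x, M' x -> ~ E z x) -> forall x, M x -> ~ E (q z) x.
Hypotheses (ha : M a) (ha' : ~ M' a) (haM' : forall x, M' x -> ~ E a x).
Hypotheses (hb : M b) (hb' : ~ M' b) (hbM' : forall x, M' x -> E b x).
Hypotheses (hp : M p) (hr : M r) (hpr : ~ near E M p r).

(** Outside [M'] the map [q] can be iterated, because its values lie outside [M] and hence outside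
    [M']. From the first step on, the images of the letters [a] and [b] have left [M]. *)
Lemma word_Z x j : M x -> ~ M' x -> Z (it j q x) /\ ~ M' (it j q x) /\ (j <> 0 -> ~ M (it j q x)).
Proof.
  intros hx hx'. induction j; simpl.
  - split; [auto | split; auto].
  - destruct IHj as [h1 [h2 _]]. destruct (q_in h1 h2) as [h3 h4]. split; auto.
Qed.

Lemma word_a x j : M x -> j <> 0 -> ~ E (it j q a) x.
Proof.
  intros hx hj. destruct j as [|j]; [lia|]. clear hj. revert x hx. induction j; intros x hx.
  - simpl. apply q_neg; auto.
  - destruct (word_Z (S j) ha ha') as [h1 [h2 _]]. simpl. apply q_neg; auto.
Qed.

Lemma word_b x j : M x -> j <> 0 -> E (it j q b) x.
Proof.
  intros hx hj. destruct j as [|j]; [lia|]. clear hj. revert x hx. induction j; intros x hx.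
  - simpl. apply q_pos; auto.
  - destruct (word_Z (S j) hb hb') as [h1 [h2 _]]. simpl. apply q_pos; auto.
Qed.

Lemma word_iter_Z z j : Z z -> ~ M' z -> Z (it j q z) /\ ~ M' (it j q z).
Proof.
  intros h1 h2; induction j; simpl; auto. destruct IHj as [h3 h4]. destruct (q_in h3 h4); auto.
Qed.

Lemma word_iter_adj x y j : Z x -> ~ M' x -> Z y -> ~ M' y -> (E x y <-> E (it j q x) (it j q y)).
Proof.
  intros hx hx' hy hy'. induction j; simpl; [tauto|]. rewrite IHj.
  apply q_adj; apply word_iter_Z; auto.
Qed.

Lemma word_iter_inj x y j : Z x -> ~ M' x -> Z y -> ~ M' y -> it j q x = it j q y -> x = y.
Proof.
  intros hx hx' hy hy'. induction j; simpl; auto. intros h; apply IHj.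
  apply q_inj; auto; apply word_iter_Z; auto.
Qed.

Lemma letter_M x : x = a \/ x = b -> M x /\ ~ M' x.
Proof. intros [->| ->]; auto. Qed.

(** [q] preserves adjacency outside [M'], so both vertices can be pulled back along [q^i], which
    leaves a proper iterate of [a] against a letter of [M]. *)
Lemma word_aa i j x : (x = a \/ x = b) -> i < j -> ~ E (it j q a) (it i q x).
Proof.
  intros hx hij h. destruct (letter_M hx) as [hxM hxM'].
  replace j with (i + (j - i)) in h by lia. rewrite iter_add in h.
  destruct (word_Z (j - i) ha ha') as [h1 [h2 _]].
  apply word_iter_adj in h; auto. apply (word_a hxM) in h; auto. lia.
Qed.

Lemma word_bb i j x : (x = a \/ x = b) -> i < j -> E (it j q b) (it i q x).
Proof.
  intros hx hij. destruct (letter_M hx) as [hxM hxM'].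
  replace j with (i + (j - i)) by lia. rewrite iter_add.
  destruct (word_Z (j - i) hb hb') as [h1 [h2 _]].
  apply word_iter_adj; auto. apply word_b; auto. lia.
Qed.

Lemma word_ne i j x y : (x = a \/ x = b) -> (y = a \/ y = b) -> i < j -> it j q x <> it i q y.
Proof.
  intros hx hy hij h. destruct (letter_M hx) as [hxM hxM']. destruct (letter_M hy) as [hyM hyM'].
  replace j with (i + (j - i)) in h by lia. rewrite iter_add in h.
  destruct (word_Z (j - i) hxM hxM') as [h1 [h2 h3]].
  apply word_iter_inj in h; auto. apply h3; [lia | rewrite h; auto].
Qed.

Definition lower J : set U := fun x => M x \/ exists i, i <= J /\ (x = it i q a \/ x = it i q b).

Lemma lower_a J j x : J < j -> lower J x -> ~ E (it j q a) x.
Proof.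
  intros hj [hx|[i [hi [-> | ->]]]]; [apply word_a; auto; lia | apply word_aa; auto; lia | apply word_aa; auto; lia].
Qed.
Lemma lower_b J j x : J < j -> lower J x -> E (it j q b) x.
Proof.
  intros hj [hx|[i [hi [-> | ->]]]]; [apply word_b; auto; lia | apply word_bb; auto; lia | apply word_bb; auto; lia].
Qed.
Lemma lower_not J j x : J < j -> x = a \/ x = b -> ~ lower J (it j q x).
Proof.
  intros hj hx [h|[i [hi h]]].
  - destruct (letter_M hx) as [h1 h2]. apply (word_Z j h1 h2) in h; auto; lia.
  - destruct h as [h|h]; apply word_ne in h; auto; lia.
Qed.
Lemma lower_L J x : lower J x -> L x.
Proof.
  intros [h|[i [hi [-> | ->]]]]; auto; apply hZL; apply word_Z; auto.
Qed.
Lemma lower_mono J J' x : J <= J' -> lower J x -> lower J' x.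
Proof. intros hJ [h|[i [hi h]]]; [left; auto | right; exists i; split; auto; lia]. Qed.

(** Block [k] is the word [b a] or, when the bit is set, [b a a], read outwards. Positions start at
    1 because at position 0 the letters still lie in [M]. The letter [b] separates the runs of [a],
    whose lengths carry the bits. *)
Definition Yk (s : nat -> bool) n : set U := fun z => M z \/ exists k, k < n /\
  (z = it (3*k+1) q b \/ z = it (3*k+2) q a \/ (s k = true /\ z = it (3*k+3) q a)).
Definition Zk s n : set U := fun z => Yk s n z \/ z = it (3*n+1) q b.
Definition Wd (s : nat -> bool) n : set U :=
  fun z => z = it (3*n+2) q a \/ (s n = true /\ z = it (3*n+3) q a).
Definition Nw s : set U := fun z => exists n, Yk s n z.
Definition Hw s := swap A L (Nw s).

Lemma Yk_lower s n x : Yk s n x -> lower (3*n) x.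
Proof.
  intros [h|[k [hk [->|[->|[_ ->]]]]]]; [left; auto | right | right | right]; eexists; (split; [|eauto]); lia.
Qed.
Lemma Zk_lower s n x : Zk s n x -> lower (3*n+1) x.
Proof.
  intros [h| ->]; [apply lower_mono with (3*n); [lia|]; apply Yk_lower with s; auto|].
  right; eexists; split; [|eauto]; lia.
Qed.
Lemma Wd_lower s n x : Wd s n x -> lower (3*n+3) x.
Proof. intros [->|[_ ->]]; right; eexists; (split; [|eauto]); lia. Qed.
Lemma Yk_S s n z : Yk s (S n) z <-> Zk s n z \/ Wd s n z.
Proof.
  unfold Yk, Zk, Wd, Yk; split.
  - intros [h|[k [hk h]]]; [tauto|]. destruct (Nat.eq_dec k n) as [->|hn]; [tauto|].
    left; left; right; exists k; split; auto; lia.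
  - intros [[[h|[k [hk h]]]|h]|h]; auto.
    + right; exists k; split; auto; lia.
    + right; exists n; split; auto.
    + right; exists n; split; auto.
Qed.
Lemma Nw_L s x : Nw s x -> L x.
Proof. intros [n h]; apply Yk_lower in h; eapply lower_L; eauto. Qed.

Lemma outside_const J u : A u -> ~ L u ->
  (forall x, lower J x -> E u x) \/ (forall x, lower J x -> ~ E u x).
Proof.
  intros hu hnu. destruct (classic (E u a)) as [h|h]; [left | right]; intros x hx.
  - apply lower_L in hx. apply (proj2 hL u a x); auto.
  - apply lower_L in hx. intros h'. apply h. apply (proj2 hL u x a); auto.
Qed.

Lemma high_const J j u : J < j -> u = it j q a \/ u = it j q b ->
  (forall x, lower J x -> E u x) \/ (forall x, lower J x -> ~ E u x).
Proof.
  intros hj [->| ->]; [right | left]; intros x hx; [eapply lower_a | eapply lower_b]; eauto.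
Qed.

Lemma Hw_in_b s n : Hw s (it (3*n+1) q b).
Proof. right; exists (S n); right; exists n; auto. Qed.
Lemma Hw_in_a s n : Hw s (it (3*n+2) q a).
Proof. right; exists (S n); right; exists n; auto. Qed.
Lemma Wd_Hw s n : sub (Wd s n) (Hw s).
Proof. intros z h; right; exists (S n); apply Yk_S; auto. Qed.

Lemma Nw_index s n u : Hw s u -> ~ Yk s n u -> (A u /\ ~ L u) \/ u = it (3*n+1) q b \/
  Wd s n u \/ u = it (3*n+4) q b \/ exists j, 3*n+4 < j /\ (u = it j q a \/ u = it j q b).
Proof.
  intros [h|[k h]] hn; auto. right. destruct h as [h|[i [hi h]]]; [exfalso; apply hn; left; auto|].
  destruct (lt_eq_lt_dec i n) as [[h1|h1]|h1].
  - exfalso; apply hn; right; exists i; auto.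
  - subst i. unfold Wd. tauto.
  - destruct h as [->|[->|[_ ->]]].
    + destruct (Nat.eq_dec i (S n)) as [->|h2].
      * right; right; left. f_equal. lia.
      * right; right; right; eexists; split; [|eauto]; lia.
    + right; right; right; eexists; split; [|eauto]; lia.
    + right; right; right; eexists; split; [|eauto]; lia.
Qed.

Lemma co_const u (X : set U) : ~ X u -> ((forall x, X x -> E u x) \/ (forall x, X x -> ~ E u x)) ->
  (forall x, X x -> co E u x) \/ (forall x, X x -> ~ co E u x).
Proof.
  intros hn [h|h]; [right|left]; intros x hx; [intros [_ h']; auto|].
  split; auto. intros e; subst; auto.
Qed.

(** In the complement the letter [b] has no neighbour below it, so it forms the lowest level there;
    the test vertex is the letter [a] that follows it. *)
Lemma Bstep s n : Wset (co E) (Hw s) (Yk s n) = (fun z => z = it (3*n+1) q b).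
Proof.
  assert (hlow : forall x, Yk s n x \/ x = it (3*n+1) q b \/ x = it (3*n+2) q a -> lower (3*n+2) x).
  { intros x [h|[->| ->]].
    - apply lower_mono with (3*n); [lia | eapply Yk_lower; eauto].
    - right; eexists; split; [|eauto]; lia.
    - right; eexists; split; [|eauto]; lia. }
  assert (hY : forall x, Yk s n x -> lower (3*n) x) by (intros x; apply Yk_lower).
  apply (Wset_compute (cog_co hE)) with (g := it (3*n+2) q a) (x0 := a).
  - left; auto.
  - intros z ->; apply Hw_in_b.
  - intros w x -> hx [_ h]; apply h. apply lower_b with (3*n); auto; lia.
  - intros w -> h. apply hY in h. apply lower_not in h; auto; lia.
  - apply Hw_in_a.
  - intros h. apply hY in h. apply lower_not in h; auto; lia.
  - intros x hx. split.
    + intros <-. apply hY in hx. apply lower_not in hx; auto; lia.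
    + apply lower_a with (3*n); auto; lia.
  - intros w ->. split; [apply word_ne; auto; lia | apply word_aa; auto; lia].
  - intros u hu hn1 hn2 hn3. apply co_const.
    { intros [h|[h|h]]; auto. }
    assert (hall : (forall x, lower (3*n+2) x -> E u x) \/ (forall x, lower (3*n+2) x -> ~ E u x)).
    { destruct (Nw_index hu hn1) as [[h1 h2]|[h|[h|[h|[j [hj h]]]]]].
      - apply outside_const; auto.
      - contradiction.
      - destruct h as [h|[_ h]]; [contradiction|]. apply high_const with (3*n+3); auto; lia.
      - apply high_const with (3*n+4); auto; lia.
      - apply high_const with j; auto; lia. }
    destruct hall as [h|h]; [left | right]; intros x hx; apply h; auto.
Qed.

Lemma Wstep s n : Wset E (Hw s) (Zk s n) = Wd s n.
Proof.
  assert (hlow : forall x, Zk s n x \/ Wd s n x \/ x = it (3*n+4) q b -> lower (3*n+4) x).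
  { intros x [h|[h| ->]].
    - apply lower_mono with (3*n+1); [lia | eapply Zk_lower; eauto].
    - apply lower_mono with (3*n+3); [lia | eapply Wd_lower; eauto].
    - right; eexists; split; [|eauto]; lia. }
  assert (hZ : forall x, Zk s n x -> lower (3*n+1) x) by (intros x; apply Zk_lower).
  (* The test vertex is the letter [b] that opens the next block. *)
  apply (Wset_compute hE) with (g := it (3*n+4) q b) (x0 := a).
  - left; left; auto.
  - apply Wd_Hw.
  - intros w x hw hx. apply hZ in hx.
    destruct hw as [->|[_ ->]]; apply lower_a with (3*n+1); auto; lia.
  - intros w hw h. apply hZ in h. destruct hw as [->|[_ ->]]; apply lower_not in h; auto; lia.
  - replace (3*n+4) with (3*(S n)+1) by lia. apply Hw_in_b.
  - intros h. apply hZ in h. apply lower_not in h; auto; lia.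
  - intros x hx. apply lower_b with (3*n+1); auto; lia.
  - intros w hw. apply lower_b with (3*n+3); [lia | eapply Wd_lower; eauto].
  - intros u hu hn1 hn2 hn3.
    assert (hnY : ~ Yk s n u) by (intros h; apply hn1; left; auto).
    assert (hall : (forall x, lower (3*n+4) x -> E u x) \/ (forall x, lower (3*n+4) x -> ~ E u x)).
    { destruct (Nw_index hu hnY) as [[h1 h2]|[h|[h|[h|[j [hj h]]]]]].
      - apply outside_const; auto.
      - exfalso; apply hn1; right; auto.
      - contradiction.
      - contradiction.
      - apply high_const with j; auto; lia. }
    destruct hall as [h|h]; [left | right]; intros x hx; apply h; auto.
Qed.

Lemma Yk_Hw s n : sub (Yk s n) (Hw s).
Proof. intros x hx; right; exists n; auto. Qed.
Lemma Zk_Hw s n : sub (Zk s n) (Hw s).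
Proof. intros x hx; right; exists (S n); apply Yk_S; auto. Qed.

Lemma img_or (f : U -> U) (X Y : set U) : img f (fun z => X z \/ Y z) = (fun z => img f X z \/ img f Y z).
Proof.
  apply set_ext; intros z; split.
  - intros [x [[h|h] e]]; [left|right]; exists x; auto.
  - intros [[x [h e]]|[x [h e]]]; exists x; auto.
Qed.

(** The vertices [p] and [r] name [M]. From there [Wset], taken alternately in the complement and in
    the graph, recovers the next [b] and the next run of [a], which has one or two vertices
    according to the bit. *)
Lemma word_decode s t phi : isof E phi (Hw s) (Hw t) -> phi p = p -> phi r = r ->
  forall n, (forall k, k < n -> s k = t k) /\ img phi (Yk s n) = Yk t n.
Proof.
  intros hphi ep er.
  assert (hname : forall s, Lset E (Hw s) p r = M).
  { intros s0. apply (Lset_name hE) with (g := it 1 q b); try assumption.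
    - intros x hx; right; exists 0; left; auto.
    - apply (Hw_in_b s0 0).
    - intros x hx; apply word_b; auto.
    - intros u hu hn.
      assert (hY0 : ~ Yk s0 0 u) by (intros [h|[k [h _]]]; [auto | lia]).
      assert (hall : (forall x, lower 1 x -> E u x) \/ (forall x, lower 1 x -> ~ E u x) \/ u = it 1 q b).
      { destruct (Nw_index hu hY0) as [[h1 h2]|[h|[h|[h|[j [hj h]]]]]].
        - destruct (outside_const 1 h1 h2); auto.
        - auto.
        - destruct h as [h|[_ h]].
          + destruct (@high_const 1 2 u); auto.
          + destruct (@high_const 1 3 u); auto.
        - destruct (@high_const 1 4 u); auto.
        - destruct (@high_const 1 j u); auto; lia. }
      assert (hl : forall x, M x -> lower 1 x) by (intros x hx; left; auto).
      assert (hl1 : lower 1 (it 1 q b)) by (right; exists 1; auto).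
      destruct hall as [h|[h|h]]; [left; auto | right; split; auto |].
      left; intros x hx; subst; apply word_b; auto. }
  assert (hM : img phi M = M).
  { rewrite <- (hname s) at 1. rewrite (Lset_img hphi).
    - rewrite ep, er; auto.
    - right; exists 0; left; auto.
    - right; exists 0; left; auto. }
  assert (hY0 : forall s, Yk s 0 = M).
  { intros s0; apply set_ext; intros z; split; [intros [h|[k [h _]]]; [auto | lia] | left; auto]. }
  induction n as [|n [IH1 IH2]].
  - split; [intros k hk; lia|]. rewrite !hY0; auto.
  - assert (hZ : img phi (Zk s n) = Zk t n).
    { unfold Zk. rewrite img_or, IH2. apply set_ext; intros z.
      assert (h : img phi (fun z => z = it (3*n+1) q b) = (fun z => z = it (3*n+1) q b)).
      { rewrite <- (Bstep s n) at 1. rewrite (Wset_img (isof_co hphi)), IH2; [apply Bstep | apply Yk_Hw]. }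
      rewrite h; tauto. }
    assert (hW : img phi (Wd s n) = Wd t n).
    { rewrite <- (Wstep s n), (Wset_img hphi), hZ; [apply Wstep | apply Zk_Hw]. }
    assert (hbit : s n = t n).
    { assert (hne : it (3*n+3) q a <> it (3*n+2) q a) by (apply word_ne; auto; lia).
      destruct (s n) eqn:es; destruct (t n) eqn:et; auto; exfalso; apply hne.
      - assert (h1 : Wd t n (phi (it (3*n+3) q a))) by (rewrite <- hW; eexists; split; [right; eauto | auto]).
        assert (h2 : Wd t n (phi (it (3*n+2) q a))) by (rewrite <- hW; eexists; split; [left; eauto | auto]).
        destruct h1 as [h1|[h1 _]]; [|congruence]. destruct h2 as [h2|[h2 _]]; [|congruence].
        apply (emb_inj (proj1 hphi)); [apply (Wd_Hw (n:=n)); right; auto | apply Hw_in_a | congruence].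
      - assert (h1 : img phi (Wd s n) (it (3*n+3) q a)) by (rewrite hW; right; auto).
        assert (h2 : img phi (Wd s n) (it (3*n+2) q a)) by (rewrite hW; left; auto).
        destruct h1 as [x [[->|[h _]] h1]]; [|congruence]. destruct h2 as [y [[->|[h _]] h2]]; congruence. }
    split.
    + intros k hk. destruct (Nat.eq_dec k n) as [->|]; auto. apply IH1; lia.
    + replace (Yk s (S n)) with (fun z => Zk s n z \/ Wd s n z) by (apply set_ext; intros z; symmetry; apply Yk_S).
      rewrite img_or, hZ, hW. apply set_ext; intros z; symmetry; apply Yk_S.
Qed.

Lemma word_false : False.
Proof.
  apply (@cantor U E code m A Hw (fun _ => p) (fun _ => r)); auto.
  - intros s. apply swap_ksib; auto.
    + exists a; auto.
    + intros z; apply Nw_L.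
    (* The word contains [M] itself, and [L] embeds into [M]; hence no copies have to be inserted
       between the letters. *)
    + apply le_trans with M; auto. apply le_sub. intros x hx; exists 0; left; auto.
    + intros h; exfalso; auto.
  - intros s; split; right; exists 0; left; auto.
  - intros s t phi h1 h2 h3 n. apply (word_decode h1 h2 h3 (S n)); auto.
Qed.
End Word.

(** * Components of prescribed sizes *)

Section Stars.
Variables (U : Type) (E : U -> U -> Prop) (hE : cog E) (code : U -> nat) (hcode : injective code).
Variables (m : nat) (A L : set U) (v : U) (j1 j2 p : U -> U) (b c : U) (s : nat -> U).
Hypotheses (hfin : finl E m A) (hL : module E A L) (hv : A v) (hnv : ~ L v).
Hypotheses (hj1 : emb E j1 L L) (hj2 : emb E j2 L L).
Hypothesis hj : forall x y, L x -> L y -> j1 x <> j2 y /\ ~ E (j1 x) (j2 y).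
Hypotheses (hp : emb E p L L) (hb : L b) (hbp : forall x, L x -> E b (p x)).
Hypotheses (hc : L c) (hs : forall i, L (s i)) (hcs : forall i, E c (s i)).
Hypothesis hss : forall i j, i <> j -> s i <> s j /\ ~ E (s i) (s j).

(** The images of [j1] and [j2] are disjoint and non-adjacent, so these maps place infinitely many
    copies of [L] in [L], pairwise disjoint and non-adjacent. *)
Definition cc n x := it n j1 (j2 x).

Lemma cc_emb n : emb E (cc n) L L.
Proof. apply (emb_comp (f:=j2) (g:=fun x => it n j1 x)) with L; auto. apply emb_iter; auto. Qed.

Lemma cc_lt n k x y : n < k -> L x -> L y -> cc k x <> cc n y /\ ~ E (cc k x) (cc n y).
Proof.
  intros h hx hy. unfold cc. replace k with (n + S (k - n - 1)) by lia. rewrite iter_add.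
  set (x' := it (S (k - n - 1)) j1 (j2 x)).
  assert (hx' : L (it (k - n - 1) j1 (j2 x))) by (apply (emb_iter (k-n-1) hj1), hj2; auto).
  assert (hx2 : L x') by (apply hj1; auto). assert (hy2 : L (j2 y)) by (apply hj2; auto).
  destruct (hj hx' hy) as [h1 h2]. pose proof (emb_iter n hj1) as hi.
  split; intros h3; [apply h1, (emb_inj hi); auto | apply h2; apply (emb_neg hi); auto].
Qed.

Lemma cc_ne n k x y : n <> k -> L x -> L y -> cc k x <> cc n y /\ ~ E (cc k x) (cc n y).
Proof.
  intros h hx hy. destruct (lt_eq_lt_dec n k) as [[h1|h1]|h1]; [apply cc_lt; auto | contradiction|].
  destruct (cc_lt h1 hy hx) as [h2 h3]. split; auto. intros h4; apply h3; ea.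
Qed.

Definition Lst : set U := fun w => w = b \/ exists y, L y /\ w = p y.
Definition Star n : set U := fun w => w = c \/ exists i, i <= n /\ w = s i.
(** Each non-empty part becomes one component. Part 0 receives [L] and keeps the graph equimorphic.
    Part 1 is a single vertex which guarantees a second component, so that two vertices can name the
    union. Part [n+2] is a star with [n+2] vertices, present when bit [n] is set. *)
Definition part (t : nat -> bool) k : set U := match k with
  | 0 => Lst | 1 => fun w => w = b | S (S n) => fun w => t n = true /\ Star n w end.
Definition Sst t : set U := fun z => exists k w, part t k w /\ z = p (cc k w).
(** The vertex [b], adjacent to all of [Sst], is the test vertex by which [Sst] is named. *)
Definition Yst t : set U := fun z => z = b \/ Sst t z.
Definition Hst t := swap A L (Yst t).

Lemma part_L t k w : part t k w -> L w.
Proof.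
  destruct k as [|[|n]]; simpl.
  - intros [->|[y [hy ->]]]; auto; apply hp; auto.
  - intros ->; auto.
  - intros [_ [->|[i [_ ->]]]]; auto.
Qed.

Lemma Sst_L t z : Sst t z -> L z.
Proof. intros [k [w [h ->]]]; apply hp, cc_emb; eapply part_L; eauto. Qed.

Lemma Yst_L t z : Yst t z -> L z.
Proof. intros [->|h]; auto; eapply Sst_L; eauto. Qed.

Lemma part_conn t k : conn E (part t k).
Proof.
  destruct k as [|[|n]]; simpl.
  - assert (h : forall y, L y -> E b (p y)) by auto.
    intros x y [->|[x' [hx ->]]] [->|[y' [hy ->]]].
    + left; auto.
    + right; left; auto.
    + right; left; ea.
    + right; right; exists b; split; [left; auto|]. ea.
  - intros x y -> ->; left; auto.
  - intros x y [ht [->|[i [hi ->]]]] [_ [->|[j [hj' ->]]]].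
    + left; auto.
    + right; left; auto.
    + right; left; ea.
    + right; right; exists c; split; [split; auto; left; auto|]. ea.
Qed.

Lemma pcc_emb k : emb E (fun x => p (cc k x)) L L.
Proof. apply emb_comp with L; auto; apply cc_emb. Qed.

Lemma pcc_ne n k x y : n <> k -> L x -> L y -> p (cc k x) <> p (cc n y) /\ ~ E (p (cc k x)) (p (cc n y)).
Proof.
  intros h hx hy. destruct (cc_ne h hx hy) as [h1 h2].
  assert (hx' : L (cc k x)) by (apply cc_emb; auto).
  assert (hy' : L (cc n y)) by (apply cc_emb; auto).
  split; intros h3; [apply h1, (emb_inj hp); auto | apply h2, (emb_neg hp); auto].
Qed.

Lemma part_iso t k : isof E (fun x => p (cc k x)) (part t k) (img (fun x => p (cc k x)) (part t k)).
Proof.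
  apply isof_img with L. apply emb_restrict with L L; [apply pcc_emb | intros y; apply part_L |].
  intros y hy; apply pcc_emb; eapply part_L; eauto.
Qed.

Lemma comp_part t k w : part t k w ->
  comp E (Sst t) (p (cc k w)) = img (fun x => p (cc k x)) (part t k).
Proof.
  intros hw. assert (hwL := part_L hw). apply set_ext; intros z; split.
  - intros [[k' [w' [hw' ->]]] hn]. assert (hwL' := part_L hw').
    assert (hk : k' = k).
    { apply NNPP; intros hne. destruct hn as [h|[h|[u [[k2 [w2 [hw2 ->]]] [h1 h2]]]]].
      - destruct (pcc_ne hne hwL hwL'); auto.
      - destruct (pcc_ne hne hwL hwL'); auto.
      - assert (hwL2 := part_L hw2). destruct (Nat.eq_dec k2 k) as [->|h3].
        + destruct (pcc_ne hne hwL2 hwL'); auto.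
        + destruct (pcc_ne h3 hwL hwL2); auto. }
    subst. exists w'; auto.
  - intros [x [hx <-]]. split; [exists k, x; auto|].
    apply near_sub with (img (fun x => p (cc k x)) (part t k)).
    + intros y [y' [h <-]]; exists k, y'; auto.
    + apply (emb_near (proj1 (part_iso t k))); auto.
      apply part_conn; auto.
Qed.

Lemma star_size t n : t n = true -> size (part t (n + 2)) (n + 2).
Proof.
  intros ht. exists (c :: map s (seq 0 (S n))). split; [|split].
  - constructor.
    + intros h; apply in_map_iff in h; destruct h as [i [h _]].
      apply (@cog_irr _ _ hE c). pose proof (hcs i) as h'. rewrite h in h'. auto.
    + apply Injective_map_NoDup; [|apply seq_NoDup].
      intros i j e; apply NNPP; intros h; destruct (hss h); auto.
  - simpl. rewrite length_map, length_seq. lia.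
  - intros z. replace (n + 2) with (S (S n)) by lia. simpl part.
    change (In z (c :: map s (seq 0 (S n)))) with (c = z \/ In z (map s (seq 0 (S n)))).
    rewrite in_map_iff. split.
    + intros [_ [->|[i [hi ->]]]]; auto. right; exists i; split; auto. apply in_seq; lia.
    + intros [<-|[i [<- hi]]]; split; auto; [left; auto | right; exists i; split; auto].
      apply in_seq in hi; lia.
Qed.

(** Part 0 is infinite, part 1 has a single vertex, and different stars have different sizes, all at
    least 2. *)
Lemma part_size t k n : size (part t k) (n + 2) -> (exists w, part t k w) -> t n = true.
Proof.
  intros h [w hw]. destruct k as [|[|k]].
  - exfalso. apply (@seq_not_size U Lst (fun i => p (s i)) (n+2)); auto.
    + intros i; right; exists (s i); auto.
    + intros i j e. apply (emb_inj hp) in e; auto. apply NNPP; intros hne; destruct (hss hne); auto.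
  - exfalso. assert (h1 : size (part t 1) 1).
    { exists (b :: nil); split; [repeat constructor; simpl; tauto | split; auto].
      intros z; simpl; split; [intros ->; auto | intros [->|[]]; auto]. }
    pose proof (size_fun h h1). lia.
  - destruct hw as [ht _]. assert (h1 := star_size ht). replace (k + 2) with (S (S k)) in h1 by lia.
    pose proof (size_fun h h1). replace n with k by lia. auto.
Qed.

Lemma Sst_b t z : Sst t z -> E b z.
Proof. intros [k [w [h ->]]]. apply hbp, cc_emb. eapply part_L; eauto. Qed.

Definition na := p (cc 0 b).
Definition nx := p (cc 1 b).
Lemma na_in t : Sst t na. Proof. exists 0, b; split; auto; left; auto. Qed.
Lemma nx_in t : Sst t nx. Proof. exists 1, b; split; auto; reflexivity. Qed.

Lemma Hst_name t : Lset E (Hst t) na nx = Sst t.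
Proof.
  apply (Lset_name hE) with (g := b).
  - intros z hz; right; right; auto.
  - apply na_in.
  - apply nx_in.
  - intros h. assert (h1 : comp E (Sst t) (p (cc 0 b)) nx) by (split; [apply nx_in | auto]).
    rewrite comp_part in h1 by (left; auto). destruct h1 as [x [hx e]].
    assert (hxL := part_L hx). assert (h01 : 1 <> 0) by lia.
    destruct (pcc_ne h01 hxL hb) as [h2 _]; auto.
  - right; left; auto.
  - apply Sst_b.
  - intros u [[h1 h2]|[->|h]] hn; [|left; apply Sst_b | contradiction].
    destruct (classic (E u b)) as [h|h].
    + left; intros x hx. apply (proj2 hL u b x); auto. eapply Sst_L; eauto.
    + right; split; auto. intros x hx h'. apply h. apply (proj2 hL u x b); auto. eapply Sst_L; eauto.
Qed.

Lemma star_decode t t' phi n : isof E phi (Hst t) (Hst t') -> phi na = na -> phi nx = nx ->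
  t n = true -> t' n = true.
Proof.
  intros hphi ea' ex ht.
  assert (hSH : forall t, sub (Sst t) (Hst t)) by (intros t0 z hz; right; right; auto).
  assert (hS : img phi (Sst t) = Sst t').
  { rewrite <- (Hst_name t), (Lset_img hphi).
    - rewrite ea', ex. apply Hst_name.
    - apply hSH, na_in.
    - apply hSH, nx_in. }
  assert (hSi : isof E phi (Sst t) (Sst t')).
  { rewrite <- hS. apply isof_img with (Hst t'). apply emb_restrict with (Hst t) (Hst t'); auto.
    - apply hphi.
    - intros x hx; apply (emb_in (proj1 hphi)), hSH; auto. }
  assert (hpc : part t (n + 2) c) by (replace (n+2) with (S (S n)) by lia; split; auto; left; auto).
  set (y := p (cc (n+2) c)).
  assert (hy : Sst t y) by (exists (n+2), c; auto).
  assert (hsz : size (comp E (Sst t) y) (n+2)).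
  { unfold y; rewrite (comp_part hpc). apply size_inj with E (fun x => p (cc (n+2) x)) (part t (n+2)).
    - apply part_iso.
    - apply star_size; auto. }
  assert (hy' : Sst t' (phi y)) by (apply (emb_in (proj1 hSi)); auto).
  assert (hsz' : size (comp E (Sst t') (phi y)) (n+2)).
  { apply size_inj with E phi (comp E (Sst t) y); auto. split.
    - apply emb_restrict with (Sst t) (Sst t'); [apply hSi | intros z [h _]; auto|].
      intros z [hz h]. split; [apply (emb_in (proj1 hSi)); auto | apply (emb_near (proj1 hSi)); auto].
    - intros z' [hz' h]. destruct (proj2 hSi z' hz') as [z [hz <-]]. exists z; split; auto.
      split; auto. apply (isof_near hSi); auto. }
  destruct hy' as [k [w [hw e]]]. rewrite e in hsz'. rewrite (comp_part hw) in hsz'.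
  apply (@part_size t' k); eauto.
  apply size_inj with E (inv (fun x => p (cc k x)) (part t' k)) (img (fun x => p (cc k x)) (part t' k)); auto.
  apply isof_inv, part_iso.
Qed.

Lemma stars_false : False.
Proof.
  apply (@cantor U E code m A Hst (fun _ => na) (fun _ => nx)); auto.
  - intros t. apply swap_ksib; auto.
    + exists b; auto.
    + intros z; apply Yst_L.
    + exists (fun x => p (cc 0 (p x))). split.
      * intros x hx. right. exists 0, (p x); split; auto. right; eauto.
      * intros x y hx hy e. apply (emb_inj hp); auto. apply (emb_inj (pcc_emb 0)); auto; apply hp; auto.
      * intros x y hx hy. rewrite (emb_adj hp hx hy). apply (emb_adj (pcc_emb 0)); apply hp; auto.
    + intros h; exfalso; auto.
  - intros t; split; right; right; [apply na_in | apply nx_in].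
  - intros t t' phi h1 h2 h3 n.
    assert (h4 := isof_inv h1).
    assert (ha : forall t, Hst t na) by (intros; right; right; apply na_in).
    assert (hx : forall t, Hst t nx) by (intros; right; right; apply nx_in).
    assert (h5 : inv phi (Hst t) na = na) by (rewrite <- h2 at 1; apply (isof_inv_l h1); auto).
    assert (h6 : inv phi (Hst t) nx = nx) by (rewrite <- h3 at 1; apply (isof_inv_l h1); auto).
    pose proof (@star_decode t t' phi n h1 h2 h3). pose proof (@star_decode t' t _ n h4 h5 h6).
    destruct (t n), (t' n); auto. symmetry; auto.
Qed.
End Stars.

(** * Words along nested regions *)

(** A common frame for descending and ascending sequences. The regions [Q n] are the successive
    differences, [Cr] is what lies inside all of them, [out i j] says that region [i] surrounds
    region [j], and [lab z] says whether [z] is adjacent to everything further inside. *)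
Record shift {U} (E : U -> U -> Prop) (D Cr : set U) (Q : nat -> set U) (e : U -> U) (lab : U -> Prop)
  (out : nat -> nat -> Prop) (a0 b0 : U) : Prop := {
  sh_D : forall z, D z <-> Cr z \/ exists n, Q n z;
  sh_dis : forall i j z, Q i z -> Q j z -> i = j;
  sh_core : forall i z, Q i z -> ~ Cr z;
  sh_e : emb E e D D;
  sh_Q : forall n z, Q n z -> Q (S n) (e z);
  sh_lab : forall n z, Q n z -> (lab (e z) <-> lab z);
  sh_adj : forall i j z w, Q i z -> Q j w -> out i j -> (E z w <-> lab z);
  sh_adjC : forall i z w, Q i z -> Cr w -> (E z w <-> lab z);
  sh_tot : forall i j, i <> j -> out i j \/ out j i;
  sh_out : forall i j, out i j -> out (5*i+4) (5*j+4);
  sh_a : Q 0 a0;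
  sh_na : ~ lab a0;
  sh_b : Q 0 b0;
  sh_lb : lab b0
}.

(* Block [n] occupies the regions [5n] to [5n+4]: the letters [b a b], with a second [a] exactly when
   the bit [s n] is set, followed by a copy of the region [Q n], which keeps the graph equimorphic. *)
Definition pat {U} (Q : nat -> set U) (e : U -> U) (a0 b0 : U) (s : nat -> bool) (i : nat) (z : U) :=
  (exists n, i = 5*n /\ z = it i e b0) \/
  (exists n, i = 5*n+1 /\ z = it i e a0) \/
  (exists n, i = 5*n+2 /\ s n = true /\ z = it i e a0) \/
  (exists n, i = 5*n+3 /\ z = it i e b0) \/
  (exists n w, i = 5*n+4 /\ Q n w /\ z = it (4*n+4) e w).

Definition Ysig {U} (Cr : set U) (Q : nat -> set U) (e : U -> U) (a0 b0 : U) (s : nat -> bool) : set U :=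
  fun z => Cr z \/ exists i, pat Q e a0 b0 s i z.

Section Shift.
Variables (U : Type) (E : U -> U -> Prop) (hE : cog E).
Variables (D Cr : set U) (Q : nat -> set U) (e : U -> U) (lab : U -> Prop) (out : nat -> nat -> Prop) (a0 b0 : U).
Hypothesis h : shift E D Cr Q e lab out a0 b0.

Lemma sh_itQ k n z : Q n z -> Q (k + n) (it k e z).
Proof. intros hz; induction k; simpl; auto. apply (sh_Q h); auto. Qed.

Lemma sh_itlab k n z : Q n z -> (lab (it k e z) <-> lab z).
Proof.
  intros hz; induction k; simpl; [tauto|]. rewrite (sh_lab h (sh_itQ k hz)); auto.
Qed.

Lemma sh_aQ k : Q k (it k e a0).
Proof. rewrite <- (Nat.add_0_r k) at 1. apply sh_itQ, (sh_a h). Qed.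
Lemma sh_bQ k : Q k (it k e b0).
Proof. rewrite <- (Nat.add_0_r k) at 1. apply sh_itQ, (sh_b h). Qed.
Lemma sh_alab k : ~ lab (it k e a0).
Proof. rewrite (sh_itlab k (sh_a h)). apply (sh_na h). Qed.
Lemma sh_blab k : lab (it k e b0).
Proof. rewrite (sh_itlab k (sh_b h)). apply (sh_lb h). Qed.

Lemma pat_Q s i z : pat Q e a0 b0 s i z -> Q i z.
Proof.
  intros [[n [hn ->]]|[[n [hn ->]]|[[n [hn [_ ->]]]|[[n [hn ->]]|[n [w [hn [hw ->]]]]]]]];
    auto using sh_aQ, sh_bQ.
  replace i with (4*n+4+n) by lia. apply sh_itQ; auto.
Qed.

Lemma Ysig_D s z : Ysig Cr Q e a0 b0 s z -> D z.
Proof. intros [hz|[i hz]]; apply (sh_D h); auto. right; exists i; eapply pat_Q; eauto. Qed.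

Lemma Ysig_pat s i z : Ysig Cr Q e a0 b0 s z -> Q i z -> pat Q e a0 b0 s i z.
Proof.
  intros [hz|[j hz]] hi; [exfalso; apply (sh_core h hi hz)|].
  assert (j = i) by (apply (sh_dis h (pat_Q hz) hi)). subst; auto.
Qed.

(** Region [n] goes to the copy in slot [5n+4], whence the exponent [4n+4]. Adjacencies between
    regions survive because they depend only on the label of the outer vertex, and passing from [n]
    to [5n+4] keeps the order of the regions. *)
Lemma shift_map s : exists f, emb E f D (Ysig Cr Q e a0 b0 s) /\ (forall z, Cr z -> f z = z) /\
  (forall n z, Q n z -> Q (5*n+4) (f z)).
Proof.
  assert (hf : forall z, exists z', (Cr z -> z' = z) /\ (forall n, Q n z -> z' = it (4*n+4) e z)).
  { intros z. destruct (classic (exists n, Q n z)) as [[n hn]|hn].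
    - exists (it (4*n+4) e z); split.
      + intros hc; exfalso; apply (sh_core h hn hc).
      + intros n' hn'. rewrite (sh_dis h hn hn'); auto.
    - exists z; split; auto. intros n hz; exfalso; eauto. }
  apply choice in hf. destruct hf as [f hf].
  assert (fC : forall z, Cr z -> f z = z) by (intros z; apply hf).
  assert (fQ : forall n z, Q n z -> f z = it (4*n+4) e z) by (intros n z; apply hf).
  assert (fQ' : forall n z, Q n z -> Q (5*n+4) (f z)).
  { intros n z hz. rewrite (fQ n z hz). replace (5*n+4) with (4*n+4+n) by lia. apply sh_itQ; auto. }
  assert (flab : forall n z, Q n z -> (lab (f z) <-> lab z)).
  { intros n z hz. rewrite (fQ n z hz). apply (sh_itlab _ hz). }
  assert (hD : forall z n, Q n z -> D z) by (intros z n hz; apply (sh_D h); eauto).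
  assert (hsy : forall x y, E x y <-> E y x) by (intros x y; split; apply (cog_sym hE)).
  exists f; split; [split|split; auto].
  - intros z hz. apply (sh_D h) in hz. destruct hz as [hz|[n hz]].
    + rewrite fC; auto. left; auto.
    + right; exists (5*n+4). do 4 right. exists n, z. split; auto.
  - intros x y hx hy exy. apply (sh_D h) in hx. apply (sh_D h) in hy.
    destruct hx as [hx|[n hx]]; destruct hy as [hy|[k hy]].
    + rewrite !fC in exy; auto.
    + exfalso. apply (sh_core h (fQ' k y hy)). rewrite <- exy, fC; auto.
    + exfalso. apply (sh_core h (fQ' n x hx)). rewrite exy, fC; auto.
    + pose proof (fQ' n x hx) as h1. rewrite exy in h1. pose proof (sh_dis h h1 (fQ' k y hy)).
      assert (n = k) by lia. subst k. rewrite (fQ n x hx), (fQ n y hy) in exy.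
      apply (emb_inj (emb_iter (4*n+4) (sh_e h))) in exy; eauto.
  - intros x y hx hy. apply (sh_D h) in hx. apply (sh_D h) in hy.
    destruct hx as [hx|[n hx]]; destruct hy as [hy|[k hy]].
    + rewrite !fC; tauto.
    + rewrite (hsy x y), (hsy (f x) (f y)), (sh_adjC h hy hx), (sh_adjC h (fQ' k y hy) (w:=f x)), (flab k y hy); [tauto|].
      rewrite fC; auto.
    + rewrite (sh_adjC h hx hy), (sh_adjC h (fQ' n x hx) (w:=f y)), (flab n x hx); [tauto|].
      rewrite fC; auto.
    + destruct (Nat.eq_dec n k) as [->|hnk].
      * rewrite (fQ k x hx), (fQ k y hy). apply (emb_adj (emb_iter (4*k+4) (sh_e h))); eauto.
      * destruct (sh_tot h hnk) as [ho|ho].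
        -- rewrite (sh_adj h hx hy ho), (sh_adj h (fQ' n x hx) (fQ' k y hy) (sh_out h ho)), (flab n x hx); tauto.
        -- rewrite (hsy x y), (hsy (f x) (f y)), (sh_adj h hy hx ho),
             (sh_adj h (fQ' k y hy) (fQ' n x hx) (sh_out h ho)), (flab k y hy); tauto.
Qed.

Lemma shift_le s : le E D (Ysig Cr Q e a0 b0 s).
Proof. destruct (shift_map s) as [f [hf _]]; exists f; auto. Qed.
End Shift.

(** * Descending sequences of modules *)

Section Down.
Variables (U : Type) (E : U -> U -> Prop) (hE : cog E) (code : U -> nat) (hcode : injective code).
Variables (m : nat) (A : set U) (L : nat -> set U) (e : U -> U) (v a0 b0 : U).
Hypotheses (hfin : finl E m A) (hL : forall n, module E A (L n)) (hv : A v) (hnv : ~ L 0 v).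
Hypotheses (hdec : forall n, sub (L (S n)) (L n)) (he : emb E e (L 0) (L 0)).
Hypotheses (heL : forall n z, L n z -> L (S n) (e z)).
Hypotheses (heQ : forall n z, L n z -> ~ L (S n) z -> ~ L (S (S n)) (e z)).
Hypotheses (ha : L 0 a0) (hna : ~ L 1 a0) (hab : forall x, L 1 x -> ~ E a0 x).
Hypotheses (hb : L 0 b0) (hnb : ~ L 1 b0) (hbb : forall x, L 1 x -> E b0 x).

Let Q n : set U := fun z => L n z /\ ~ L (S n) z.
Let Cr : set U := fun z => forall n, L n z.
(** A vertex has at most one region; quantifying over [n] makes the label a property of the vertex
    alone. *)
Let lab z := forall n x, L n z -> ~ L (S n) z -> L (S n) x -> E z x.

Lemma L_mono i j : i <= j -> sub (L j) (L i).
Proof. intros h; induction h; [intros x; auto|]. intros x hx; apply IHh, hdec; auto. Qed.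

Lemma Q_dis i j z : Q i z -> Q j z -> i = j.
Proof.
  intros [h1 h2] [h3 h4]. destruct (lt_eq_lt_dec i j) as [[hij|]|hij]; auto; exfalso.
  - apply h2. apply (@L_mono (S i) j hij); auto.
  - apply h4. apply (@L_mono (S j) i hij); auto.
Qed.

Lemma L_ne n : exists x, L n x.
Proof. exists (it n e a0). induction n; simpl; auto. Qed.

Lemma lab_iff n z x : Q n z -> L (S n) x -> (E z x <-> lab z).
Proof.
  intros [h1 h2] hx; split; [|intros h; apply (h n); auto].
  intros h n' x' h3 h4 hx'. assert (n' = n) by (apply (@Q_dis n' n z); split; auto). subst.
  apply (proj2 (hL (S n)) z x x'); auto. apply (hL n); auto.
Qed.

Lemma down_shift : shift E (L 0) Cr Q e lab lt a0 b0.
Proof.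
  split.
  - intros z; split.
    + intros hz. destruct (classic (Cr z)) as [hc|hc]; auto. right.
      apply not_all_ex_not in hc. destruct hc as [n hn]. induction n.
      * contradiction.
      * destruct (classic (L n z)); [exists n; split; auto | auto].
    + intros [h|[n [h _]]]; [apply h | apply (@L_mono 0 n); auto; lia].
  - apply Q_dis.
  - intros i z [_ h] h'; apply h, h'.
  - auto.
  - intros n z [h1 h2]; split; auto.
  - intros n z [h1 h2]. destruct (L_ne (S n)) as [x hx].
    rewrite <- (@lab_iff n z x); [|split; auto|auto].
    rewrite <- (@lab_iff (S n) (e z) (e x)); [|split; auto|auto].
    symmetry. apply (emb_adj he); [apply (@L_mono 0 n) | apply (@L_mono 0 (S n))]; auto; lia.
  - intros i j z w hz [hw _] hij. apply (lab_iff hz). apply (@L_mono (S i) j hij); auto.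
  - intros i z w hz hw. apply (lab_iff hz). apply hw.
  - intros i j h; lia.
  - intros i j h; lia.
  - split; auto.
  - destruct (L_ne 1) as [x hx]. rewrite <- (@lab_iff 0 a0 x); [|split; auto|auto]. auto.
  - split; auto.
  - destruct (L_ne 1) as [x hx]. rewrite <- (@lab_iff 0 b0 x); [|split; auto|auto]. auto.
Qed.

Let Y s := Ysig Cr Q e a0 b0 s.
Let H s := swap A (L 0) (Y s).
(** The tail of the word just inside the letter [b] that opens block [k]. *)
Let S_ s k : set U := fun z => Y s z /\ L (5*k+1) z.
Let al k := it k e a0.
Let be k := it k e b0.

Lemma al_Q k : Q k (al k). Proof. apply (sh_aQ down_shift). Qed.
Lemma be_Q k : Q k (be k). Proof. apply (sh_bQ down_shift). Qed.
Lemma al_adj k x : L (S k) x -> ~ E (al k) x.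
Proof. intros hx. rewrite (lab_iff (al_Q k) hx). apply (sh_alab down_shift). Qed.
Lemma be_adj k x : L (S k) x -> E (be k) x.
Proof. intros hx. rewrite (lab_iff (be_Q k) hx). apply (sh_blab down_shift). Qed.
Lemma Y_L s z : Y s z -> L 0 z.
Proof. apply (Ysig_D down_shift). Qed.
Lemma Y_be0 s k : Y s (be (5*k)).
Proof. right; exists (5*k); left; eauto. Qed.
Lemma Y_al1 s k : Y s (al (5*k+1)).
Proof. right; exists (5*k+1); right; left; eauto. Qed.
Lemma Y_al2 s k : s k = true -> Y s (al (5*k+2)).
Proof. intros h; right; exists (5*k+2); right; right; left; eauto. Qed.
Lemma Y_be3 s k : Y s (be (5*k+3)).
Proof. right; exists (5*k+3); do 3 right; left; eauto. Qed.

Lemma S_al1 s k : S_ s k (al (5*k+1)).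
Proof. split; [apply Y_al1 | apply al_Q]. Qed.
Lemma S_be3 s k : S_ s k (be (5*k+3)).
Proof. split; [apply Y_be3|]. apply (@L_mono (5*k+1) (5*k+3)); [lia | apply be_Q]. Qed.
Lemma S_al2 s k : s k = true -> S_ s k (al (5*k+2)).
Proof. intros h; split; [apply Y_al2; auto|]. apply (@L_mono (5*k+1) (5*k+2)); [lia | apply al_Q]. Qed.

Lemma S_cases s k z : S_ s k z -> z = al (5*k+1) \/ (s k = true /\ z = al (5*k+2)) \/ z = be (5*k+3) \/ L (5*k+4) z.
Proof.
  intros [hY hz]. destruct (classic (L (5*k+4) z)) as [|hn]; auto.
  assert (hi : exists i, 5*k+1 <= i < 5*k+4 /\ Q i z).
  { destruct (classic (L (5*k+2) z)) as [h2|h2].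
    - destruct (classic (L (5*k+3) z)) as [h3|h3].
      + exists (5*k+3); split; [lia|]. split; auto. replace (S (5*k+3)) with (5*k+4) by lia; auto.
      + exists (5*k+2); split; [lia|]. split; auto. replace (S (5*k+2)) with (5*k+3) by lia; auto.
    - exists (5*k+1); split; [lia|]. split; auto. replace (S (5*k+1)) with (5*k+2) by lia; auto. }
  destruct hi as [i [hi hQ]]. pose proof (Ysig_pat down_shift hY hQ) as hp.
  destruct hp as [[n [hn' hz']]|[[n [hn' hz']]|[[n [hn' [ht hz']]]|[[n [hn' hz']]|[n [w [hn' _]]]]]]];
    try lia; assert (n = k) by lia; subst n i; auto.
Qed.

(** Behind the leading letters [a] comes the letter [b] of slot [5k+3], which is adjacent to
    everything further inside. Counting isolated vertices of the tail therefore recovers bit [k]. *)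
Lemma S_iso s k z : S_ s k z -> (forall x, S_ s k x -> ~ E z x) <-> (z = al (5*k+1) \/ (s k = true /\ z = al (5*k+2))).
Proof.
  intros hz; split.
  - intros h. destruct (S_cases hz) as [h1|[h1|[h1|h1]]]; auto; exfalso.
    + subst. apply (h (be (5*(S k)+3))); [split; [apply Y_be3|]|].
      * apply (@L_mono (5*k+1) (5*(S k)+3)); [lia | apply be_Q].
      * apply be_adj. apply (@L_mono (S (5*k+3)) (5*(S k)+3)); [lia | apply be_Q].
    + apply (h (be (5*k+3)) (S_be3 s k)). apply (cog_sym hE), be_adj.
      replace (S (5*k+3)) with (5*k+4) by lia; auto.
  - assert (h12 : ~ E (al (5*k+2)) (al (5*k+1))).
    { intros h. apply (cog_sym hE) in h. apply (@al_adj (5*k+1)) in h; auto.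
      replace (S (5*k+1)) with (5*k+2) by lia. apply al_Q. }
    intros [->|[hs ->]] x hx h; destruct (S_cases hx) as [h1|[[h0 h1]|[h1|h1]]]; subst.
    + apply (cog_irr hE h).
    + apply h12. ea.
    + apply al_adj in h; auto. apply (@L_mono _ (5*k+3)); [lia | apply be_Q].
    + apply al_adj in h; auto. apply (@L_mono _ (5*k+4)); [lia | auto].
    + auto.
    + apply (cog_irr hE h).
    + apply al_adj in h; auto. apply (@L_mono _ (5*k+3)); [lia | apply be_Q].
    + apply al_adj in h; auto. apply (@L_mono _ (5*k+4)); [lia | auto].
Qed.

Lemma S_far s k : ~ near E (S_ s k) (al (5*k+1)) (be (5*k+3)).
Proof.
  pose proof (proj2 (S_iso (S_al1 s k)) (or_introl eq_refl)) as hi.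
  intros [h|[h|[z [hz [h _]]]]].
  - pose proof (al_Q (5*k+1)) as h1. rewrite h in h1. pose proof (Q_dis h1 (be_Q (5*k+3))). lia.
  - apply (hi _ (S_be3 s k) h).
  - apply (hi _ hz h).
Qed.

Lemma S_mod s k : module E (Y s) (S_ s k).
Proof.
  split; [intros z [hz _]; auto|]. intros u x y hu hnu [hx hx'] [hy hy'] h.
  apply (proj2 (hL (5*k+1)) u x y); auto.
  - apply (hL 0), (Y_L hu).
  - intros h'; apply hnu; split; auto.
Qed.

Lemma S_strong s k : strong E (S_ s 0) (S_ s k).
Proof.
  assert (hsub : sub (S_ s k) (S_ s 0)).
  { intros z [h1 h2]; split; auto. apply (@L_mono _ (5*k+1)); auto; lia. }
  split.
  - exists (al (5*k+1)); apply S_al1.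
  - apply module_restrict with (Y s); [apply S_mod | auto | intros z [hz _]; auto].
  - intros _ z [hz hz0] hnz hzS.
    destruct k as [|k]; [exfalso; apply hnz; split; auto|].
    (* The letter [b] just outside the tail is adjacent to all of it and separates it from any
       further vertex that misses the tail. *)
    exists (be (5*(S k))). split; [|split; [|split]].
    + split; [apply Y_be0|]. apply (@L_mono _ (5*(S k))); [lia | apply be_Q].
    + intros [_ h]. replace (5 * S k + 1) with (S (5 * S k)) in h by lia. apply (be_Q (5*(S k))); auto.
    + intros x [_ hx]. apply be_adj. replace (S (5 * S k)) with (5 * S k + 1) by lia. auto.
    + intros h.
      assert (hzn : ~ L (5*S k) z).
      { intros h1. assert (hQ : Q (5*S k) z).
        { split; auto. intros h2; apply hnz; split; auto. replace (5*S k+1) with (S (5*S k)) by lia; auto. }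
        pose proof (Ysig_pat down_shift hz hQ) as hp.
        destruct hp as [[n [hn' hz']]|[[n [hn' hz']]|[[n [hn' [ht hz']]]|[[n [hn' hz']]|[n [w [hn' _]]]]]]]; try lia.
        rewrite hz' in h. apply (cog_irr hE h). }
      apply (hzS (al (5*S k+1)) (S_al1 s (S k))).
      apply (proj2 (hL (5*S k)) z (be (5*S k)) (al (5*S k+1))); auto.
      * apply (hL 0), (Y_L hz).
      * apply be_Q.
      * apply (@L_mono _ (5*S k+1)); [lia | apply al_Q].
      * ea.
  - intros hc; exfalso; apply hc, disc_coconn; auto. intros hc'. apply (@S_far s k).
    apply hc'; [apply S_al1 | apply S_be3].
Qed.

(** [e^k] pushes [L 0] into [L k], and [shift_map] sends the regions from [k] on to slots from
    [5k+4] on. *)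
Lemma S_le s k : le E (L 0) (S_ s k).
Proof.
  destruct (shift_map hE down_shift s) as [f [hf [fC fQ]]].
  assert (hk : forall z, L 0 z -> L k (it k e z)).
  { intros z hz; clear - hz heL. induction k; simpl; auto. }
  exists (fun z => f (it k e z)).
  apply emb_restrict with (L 0) (Y s); [apply emb_comp with (L 0); auto; apply emb_iter; auto | intros x; auto|].
  intros z hz. split; [apply hf, (emb_iter k he); auto|].
  specialize (hk z hz). set (w := it k e z) in *.
  destruct (proj1 (sh_D down_shift w)) as [hc|[n hn]]; [apply (@L_mono 0 k); auto; lia | |].
  - rewrite fC; auto.
  - assert (hkn : k <= n).
    { apply NNPP; intros hlt. apply (proj2 hn). apply (@L_mono (S n) k); auto; lia. }
    apply (@L_mono (5*k+1) (5*n+4)); [lia|]. apply fQ; auto.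
Qed.

Lemma S_H s k : sub (S_ s k) (H s).
Proof. intros z [hz _]; right; auto. Qed.

Lemma down_name s : Lset E (H s) (al 1) (be 3) = S_ s 0.
Proof.
  apply (Lset_name hE) with (g := be 0).
  - apply S_H.
  - apply (S_al1 s 0).
  - apply (S_be3 s 0).
  - apply (@S_far s 0).
  - right; apply (Y_be0 s 0).
  - intros x [_ hx]; apply be_adj; auto.
  - intros u [[h1 h2]|hu] hn.
    + assert (hb0 : L 0 (be 0)) by apply be_Q.
      destruct (classic (E u (be 0))) as [h|h].
      * left; intros x [hx _]. apply (proj2 (hL 0) u (be 0) x); auto. apply (Y_L hx).
      * right; split; auto. intros x [hx _] h'. apply h.
        apply (proj2 (hL 0) u x (be 0)); auto. apply (Y_L hx).
    + left. intros x [_ hx].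
      assert (hQ : Q 0 u) by (split; [apply (Y_L hu) | intros h; apply hn; split; auto]).
      pose proof (Ysig_pat down_shift hu hQ) as hp.
      destruct hp as [[n [hn' hz']]|[[n [hn' hz']]|[[n [hn' [ht hz']]]|[[n [hn' hz']]|[n [w [hn' _]]]]]]]; try lia.
      rewrite hz'. apply be_adj; auto.
Qed.

Lemma S_not_conn s k : ~ conn E (S_ s k).
Proof. intros hc'. apply (@S_far s k). apply hc'; [apply S_al1 | apply S_be3]. Qed.

Lemma top_agree s t k z : (forall j, j < k -> s j = t j) -> Y s z -> ~ L (5*k+1) z -> Y t z.
Proof.
  intros hst hz hn. destruct hz as [hz|[i hz]]; [exfalso; apply hn, hz|].
  pose proof (pat_Q down_shift hz) as hQ. right; exists i.
  assert (hi : i < 5*k+1).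
  { apply NNPP; intros h; apply hn. apply (@L_mono _ i); [lia | apply hQ]. }
  destruct hz as [hz|[hz|[[n [h1 [h2 h3]]]|hz]]].
  - left; auto.
  - right; left; auto.
  - right; right; left. exists n; split; auto; split; auto. rewrite <- hst; auto; lia.
  - do 3 right; auto.
Qed.

Lemma down_Z s t phi : isof E phi (H s) (H t) -> phi (al 1) = al 1 -> phi (be 3) = be 3 ->
  isof E phi (S_ s 0) (S_ t 0).
Proof.
  intros hphi h1 h3.
  assert (hS : img phi (S_ s 0) = S_ t 0).
  { rewrite <- (down_name s), (Lset_img hphi).
    - rewrite h1, h3. apply down_name.
    - right; apply (Y_al1 s 0).
    - right; apply (Y_be3 s 0). }
  rewrite <- hS. apply isof_img with (H t). apply emb_restrict with (H s) (H t); [apply hphi | apply S_H|].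
  intros x hx; apply (emb_in (proj1 hphi)), (@S_H s 0); auto.
Qed.

Lemma S_0 s k : sub (S_ s k) (S_ s 0).
Proof. intros z [h1 h2]; split; auto. apply (@L_mono _ (5*k+1)); auto; lia. Qed.

Lemma L_const k u x y : L 0 u -> ~ L k u -> L k x -> L k y -> E u x -> E u y.
Proof. intros h1 h2 h3 h4. apply (proj2 (hL k) u x y); auto. apply (hL 0); auto. Qed.

(** If the image [M'] were strictly smaller than the tail, the inverse of [phi] would carry
    everything outside [M'] to vertices outside the tail, in the portion where both words agree. It
    could then be iterated, and the first letters [a] and [b] of the tail would generate a word
    excluded by [word_false]. *)
Lemma not_lt s t phi k : isof E phi (S_ s 0) (S_ t 0) -> (forall j, j < k -> s j = t j) ->
  sub (img phi (S_ s k)) (S_ t k) -> sub (S_ t k) (img phi (S_ s k)).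
Proof.
  intros hphi hst hsub w hw. apply NNPP; intros hnw.
  set (M' := img phi (S_ s k)) in *.
  assert (hM' : strong E (S_ t 0) M') by (apply strong_img with (S_ s 0); auto; apply S_strong).
  assert (hM'c : ~ conn E M').
  { intros hc. apply (@S_not_conn s k). apply (iso_conn (B:=M')); auto.
    exists phi. apply isof_img with (S_ t 0). apply emb_restrict with (S_ s 0) (S_ t 0); [apply hphi | apply S_0|].
    intros x hx; apply (emb_in (proj1 hphi)), (@S_0 s k); auto. }
  (* If [M'] contained an isolated vertex [i] of the tail, [w] would miss [M'], and the separating
     vertex [u] would see [i] from inside the tail or distinguish [i] from [w] from outside it. *)
  assert (hiso : forall i, S_ t k i -> (forall x, S_ t k x -> ~ E i x) -> ~ M' i).
  { intros i hi hii hMi.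
    destruct (strong_half hM' hM'c (z:=w)) as [u [hu [hnu [h1 h2]]]]; auto.
    - apply (@S_0 t k); auto.
    - intros x hx h. apply (hii w hw). apply (cog_sym hE).
      apply (proj2 (strong_mod hM') w x i); auto. apply (@S_0 t k); auto.
    - destruct (classic (S_ t k u)) as [hu'|hu'].
      + apply (hii u hu'). apply (cog_sym hE); auto.
      + apply h2. apply (proj2 (strong_mod (S_strong t k)) u i w); auto. }
  assert (ha' : ~ M' (al (5*k+1))).
  { apply hiso; [apply S_al1|]. apply S_iso; auto; apply S_al1. }
  assert (hb' : ~ M' (be (5*k+3)) /\ forall x, M' x -> E (be (5*k+3)) x).
  { assert (hcs : forall x, M' x -> x = be (5*k+3) \/ L (5*k+4) x).
    { intros x hx. destruct (S_cases (hsub x hx)) as [->|[[h0 ->]|h1]]; auto; [contradiction|].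
      exfalso. assert (h2 := S_al2 h0).
      exact (hiso _ h2 (proj2 (S_iso h2) (or_intror (conj h0 eq_refl))) hx). }
    assert (hadj : forall x, L (5*k+4) x -> E (be (5*k+3)) x).
    { intros x hx; apply be_adj. replace (S (5*k+3)) with (5*k+4) by lia; auto. }
    assert (hnb' : ~ M' (be (5*k+3))).
    (* With the isolated vertices excluded, this letter [b] would connect [M']. *)
    { intros hMb. apply hM'c. intros x y hx hy.
      destruct (hcs x hx) as [->|h1]; destruct (hcs y hy) as [->|h2].
      - left; auto.
      - right; left; auto.
      - right; left; ea.
      - right; right; exists (be (5*k+3)); ea. }
    split; auto. intros x hx. destruct (hcs x hx) as [->|h1]; auto. contradiction. }
  set (q := inv phi (S_ s 0)).
  pose proof (isof_inv hphi) as hq. fold q in hq.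
  assert (hq1 : forall z, S_ t 0 z -> ~ M' z -> S_ s 0 (q z) /\ ~ L (5*k+1) (q z)).
  { intros z hz hnz. assert (h1 : S_ s 0 (q z)) by (apply (emb_in (proj1 hq)); auto).
    split; auto. intros h2. apply hnz. exists (q z); split; [split; auto; apply h1|].
    apply (isof_inv_r hphi); auto. }
  assert (hS0L : forall s z, S_ s 0 z -> L 0 z) by (intros s0 z [hz _]; apply (Y_L hz)).
  apply (@word_false U E hE code hcode m A (L 0) (S_ t 0) (S_ t k) M' v q (al (5*k+1)) (be (5*k+3)) (al (5*k+1)) (be (5*k+3))); auto.
  - intros z; apply hS0L.
  - apply S_0.
  - apply S_le.
  - intros z hz hnz. destruct (hq1 z hz hnz) as [[h1 h2] h3]. split.
    + split; auto. apply (top_agree hst); auto.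
    + intros [_ h]; auto.
  - intros x y hx _ hy _ exy. apply (emb_inj (proj1 hq)); auto.
  - intros x y hx _ hy _. apply (emb_adj (proj1 hq)); auto.
  - intros z hz hnz hpos x [_ hx]. destruct (hq1 z hz hnz) as [h1 h3].
    assert (h4 : E (q z) (al (5*k+1))).
    { apply (emb_neg (proj1 hphi)); [auto | apply (@S_0 s k), S_al1|].
      unfold q; rewrite (isof_inv_r hphi); auto. apply hpos. eexists; split; [apply S_al1 | auto]. }
    apply (@L_const (5*k+1) _ (al (5*k+1))); auto; [eapply hS0L; eauto | apply al_Q].
  - intros z hz hnz hneg x [_ hx] h. destruct (hq1 z hz hnz) as [h1 h3].
    apply (hneg (phi (al (5*k+1)))); [eexists; split; [apply S_al1 | auto]|].
    rewrite <- (isof_inv_r hphi hz). apply (emb_pos (proj1 hphi)); [auto | apply (@S_0 s k), S_al1|].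
    apply (@L_const (5*k+1) _ x); auto; [eapply hS0L; eauto | apply al_Q].
  - apply S_al1.
  - intros x hx. apply (proj2 (S_iso (S_al1 t k))); auto.
  - apply S_be3.
  - apply hb'.
  - apply hb'.
  - apply S_al1.
  - apply S_be3.
  - apply S_far.
Qed.

(** Two disjoint modules are fully joined or fully non-adjacent, and [L 0] embeds into both of
    these. In the graph or in its complement this gives the two separated copies that [stars_false]
    needs, with letters of the word as centre and leaves. *)
Lemma disjoint_false s t phi k : isof E phi (S_ s 0) (S_ t 0) ->
  ~ (forall x, img phi (S_ s k) x -> ~ S_ t k x).
Proof.
  intros hphi hdis. set (M' := img phi (S_ s k)) in *.
  assert (hM' : strong E (S_ t 0) M') by (apply strong_img with (S_ s 0); auto; apply S_strong).
  assert (hM := S_strong t k).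
  assert (hS0L : forall s z, S_ s 0 z -> L 0 z) by (intros s0 z [hz _]; apply (Y_L hz)).
  destruct (S_le t k) as [j2 hj2].
  assert (hj1 : exists j1, emb E j1 (L 0) M').
  { destruct (S_le s k) as [j1 hj1]. exists (fun x => phi (j1 x)).
    apply emb_comp with (S_ s k); auto. apply emb_restrict with (S_ s 0) (S_ t 0); [apply hphi | apply S_0|].
    intros x hx; exists x; auto. }
  destruct hj1 as [j1 hj1].
  assert (hconst : forall x y x' y', M' x -> M' x' -> S_ t k y -> S_ t k y' -> E x y -> E x' y').
  { intros x y x' y' hx hx' hy hy' hxy.
    assert (h1 : E x y').
    { apply (proj2 (strong_mod hM) x y y'); auto. apply (strong_sub hM'); auto. }
    assert (hy0 : S_ t 0 y') by (apply (@S_0 t k); auto).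
    assert (hny : ~ M' y') by (intros h; apply (hdis y'); auto).
    apply (cog_sym hE). apply (proj2 (strong_mod hM') y' x x'); auto. apply (cog_sym hE); auto. }
  assert (hj1' : emb E j1 (L 0) (L 0)).
  { apply emb_restrict with (L 0) M'; auto; [intros x; auto|].
    intros x hx; eapply hS0L; apply (strong_sub hM'); apply hj1; auto. }
  assert (hj2' : emb E j2 (L 0) (L 0)).
  { apply emb_restrict with (L 0) (S_ t k); auto; [intros x; auto|].
    intros x hx; eapply hS0L; apply (@S_0 t k); apply hj2; auto. }
  assert (hne : forall x y, L 0 x -> L 0 y -> j1 x <> j2 y).
  { intros x y hx hy h. apply (hdis (j1 x)); [apply hj1; auto | rewrite h; apply hj2; auto]. }
  assert (hL1 : forall i, L 1 (al (S i)) /\ L 1 (be (S i)) /\ L 0 (al (S i)) /\ L 0 (be (S i))).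
  { intros i. assert (L 1 (al (S i))) by (apply (@L_mono 1 (S i)); [lia | apply al_Q]).
    assert (L 1 (be (S i))) by (apply (@L_mono 1 (S i)); [lia | apply be_Q]).
    repeat split; auto; apply hdec; auto. }
  assert (hinj : forall f, (f = al \/ f = be) -> forall i j, i <> j -> f (S i) <> f (S j)).
  { intros f hf i j hij hh. apply hij. apply Nat.succ_inj.
    apply (@Q_dis _ _ (f (S i))); [|rewrite hh]; destruct hf; subst; auto using al_Q, be_Q. }
  assert (haa : forall i j, i <> j -> ~ E (al (S i)) (al (S j))).
  { intros i j hij hh. destruct (le_lt_dec i j) as [h|h].
    - apply al_adj in hh; auto. apply (@L_mono _ (S j)); [lia | apply al_Q].
    - apply (cog_sym hE) in hh. apply al_adj in hh; auto. apply (@L_mono _ (S i)); [lia | apply al_Q]. }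
  assert (hbe : forall i j, i <> j -> E (be (S i)) (be (S j))).
  { intros i j hij. destruct (le_lt_dec i j) as [h|h].
    - apply be_adj; auto. apply (@L_mono _ (S j)); [lia | apply be_Q].
    - apply (cog_sym hE). apply be_adj; auto. apply (@L_mono _ (S i)); [lia | apply be_Q]. }
  destruct (classic (E (j1 a0) (j2 a0))) as [hE1|hE1].
  - apply (@stars_false U (co E) (cog_co hE) code hcode m A (L 0) v j1 j2 e a0 a0 (fun i => be (S i))); auto using finl_co, module_co, emb_co.
    + intros x y hx hy; split; auto. intros [_ h]; apply h.
      apply (hconst (j1 a0) (j2 a0)); auto; apply hj1 || apply hj2; auto.
    + intros x hx; split; auto. intros hh; apply hna; rewrite hh; auto.
    + intros i; apply hL1.
    + intros i; split; [|apply hab; apply hL1]. intros hh; apply hna; rewrite hh; apply hL1.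
    + intros i j hij; split; [apply (hinj be); auto|]. intros [_ h]; apply h; auto.
  - apply (@stars_false U E hE code hcode m A (L 0) v j1 j2 e b0 b0 (fun i => al (S i))); auto.
    + intros x y hx hy; split; auto. intros h; apply hE1.
      apply (hconst (j1 x) (j2 y)); auto; apply hj1 || apply hj2; auto.
    + intros i; apply hL1.
    + intros i; apply hbb; apply hL1.
Qed.

Lemma down_step s t phi k : isof E phi (S_ s 0) (S_ t 0) -> (forall j, j < k -> s j = t j) ->
  img phi (S_ s k) = S_ t k.
Proof.
  intros hphi hst.
  assert (hM' : strong E (S_ t 0) (img phi (S_ s k))) by (apply strong_img with (S_ s 0); auto; apply S_strong).
  assert (hM := S_strong t k).
  assert (hex : exists x, img phi (S_ s k) x /\ S_ t k x).
  { apply NNPP; intros h. apply (@disjoint_false s t phi k hphi). intros x h1 h2; apply h; eauto. }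
  destruct hex as [x [hx1 hx2]].
  destruct (strong_nested hE hM (strong_mod hM') hx2 hx1) as [h|h].
  - apply set_ext; intros z; split; auto. apply (not_lt hphi hst); auto.
  (* The other inclusion is the same situation for the inverse isomorphism. *)
  - assert (hi := isof_inv hphi).
    assert (h2 : sub (S_ s k) (img (inv phi (S_ s 0)) (S_ t k))).
    { apply (not_lt hi); [intros j hj; symmetry; auto|].
      intros y [z [hz <-]]. destruct (h z hz) as [y' [hy' <-]].
      rewrite (isof_inv_l hphi); auto. apply (@S_0 s k); auto. }
    apply set_ext; intros z; split; auto. intros [y [hy <-]].
    destruct (h2 y hy) as [z' [hz' <-]]. rewrite (isof_inv_r hphi); auto. apply (@S_0 t k); auto.
Qed.

Lemma down_bit s t phi k : isof E phi (S_ s 0) (S_ t 0) -> img phi (S_ s k) = S_ t k ->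
  s k = true -> t k = true.
Proof.
  intros hphi himg hs. destruct (t k) eqn:et; auto. exfalso.
  assert (hi : forall i, S_ s k i -> (forall x, S_ s k x -> ~ E i x) -> phi i = al (5*k+1)).
  { intros i hi hii.
    assert (h1 : S_ t k (phi i)) by (rewrite <- himg; exists i; auto).
    destruct (proj1 (S_iso h1)) as [h|[h _]]; auto; [|congruence].
    intros x hx. rewrite <- himg in hx. destruct hx as [x' [hx' <-]]. intros h.
    apply (hii x' hx'). apply (emb_neg (proj1 hphi)); auto; apply (@S_0 s k); auto. }
  assert (h1 := S_al1 s k). assert (h2 := S_al2 hs).
  assert (e1 := hi _ h1 (proj2 (S_iso h1) (or_introl eq_refl))).
  assert (e2 := hi _ h2 (proj2 (S_iso h2) (or_intror (conj hs eq_refl)))).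
  assert (e3 : al (5*k+1) = al (5*k+2)).
  { apply (emb_inj (proj1 hphi)); [apply (@S_0 s k); auto | apply (@S_0 s k); auto | congruence]. }
  pose proof (al_Q (5*k+1)) as h4. rewrite e3 in h4. pose proof (Q_dis h4 (al_Q (5*k+2))). lia.
Qed.

Lemma down_false : False.
Proof.
  apply (@cantor U E code m A H (fun _ => al 1) (fun _ => be 3)); auto.
  - intros s. apply swap_ksib; auto.
    + exists a0; auto.
    + intros z; apply Y_L.
    + apply (shift_le hE down_shift).
    + intros h; exfalso; auto.
  - intros s; split; right; [apply (Y_al1 s 0) | apply (Y_be3 s 0)].
  - intros s t phi h1 h2 h3.
    assert (hphi := down_Z h1 h2 h3). assert (hi := isof_inv hphi).
    assert (hall : forall n k, k < n -> s k = t k).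
    { induction n; intros k hk; [lia|].
      destruct (Nat.eq_dec k n) as [->|hkn]; [|apply IHn; lia].
      assert (hA := down_step hphi (fun j hj => IHn j hj)).
      assert (hB := down_step hi (fun j hj => eq_sym (IHn j hj))).
      pose proof (@down_bit s t phi n hphi hA). pose proof (@down_bit t s _ n hi hB).
      destruct (s n), (t n); auto. symmetry; auto. }
    intros n. apply (hall (S n)). lia.
Qed.
End Down.

(** Two consecutive differences always contain both labels. If [L2] is connected, one of its edges
    leaves [L3]; otherwise [halfstrong] applied to [z] yields the vertex. *)
Lemma up_label U (E : U -> U -> Prop) (hE : cog E) A L1 L2 L3 x z :
  strong E A L1 -> strong E A L2 -> strong E A L3 -> sub L2 L1 -> sub L3 L2 ->
  L2 x -> ~ L3 x -> L1 z -> ~ L2 z -> (forall y, L2 y -> ~ E z y) ->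
  exists u, L1 u /\ ~ L3 u /\ forall y, L3 y -> E u y.
Proof.
  intros h1 h2 h3 h21 h32 hx hnx hz hnz hzn. destruct (strong_ne h3) as [w hw].
  destruct (classic (conn E L2)) as [hc|hc].
  - destruct (conn_exit hE hc h32 hw hx hnx) as [u [k [hu [hnu [hk huk]]]]].
    exists u; split; [auto|split; auto]. intros y hy.
    apply (proj2 (strong_mod h3) u k y); auto. apply (strong_sub h2); auto.
  - destruct (strong_half h2 hc (z:=z)) as [u [hu [hnu [hu1 hu2]]]]; auto.
    { apply (strong_sub h1); auto. }
    assert (hL1 : L1 u).
    { apply NNPP; intros hn. apply hu2. apply (proj2 (strong_mod h1) u w z); auto. }
    exists u; split; [auto|split; auto].
Qed.

Lemma img_mono U (f : U -> U) (X Y : set U) : sub X Y -> sub (img f X) (img f Y).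
Proof. intros h y [x [hx <-]]; exists x; auto. Qed.

Lemma hull_mono U (E : U -> U -> Prop) A (X Y : set U) : sub X Y -> sub (hull E A X) (hull E A Y).
Proof. intros h z hz M [h1 h2]; apply hz; split; auto. intros x hx; apply h2; auto. Qed.

Theorem fin_nonest U (E : U -> U -> Prop) (hE : cog E) (code : U -> nat) (hcode : injective code) m A :
  finl E m A -> nonest E A.
Proof.
  intros hfin T0 T1 hS hT1 hsub [e he] z0 hz0. apply NNPP; intros hnz0.
  (* Hulls are taken because images of strong modules need not be modules; [hull_escape] keeps the
     inclusions proper. *)
  set (L := fix L n := match n with 0 => T1 | S n => hull E A (img e (L n)) end : set U).
  assert (hLS : forall n, L (S n) = hull E A (img e (L n))) by reflexivity.
  assert (hL0 : L 0 = T1) by reflexivity. clearbody L.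
  assert (heA : emb E e T1 A).
  { apply emb_restrict with T1 T0; auto; [intros x; auto|]. intros x hx. apply (strong_sub hS), he; auto. }
  assert (h1 : forall n, strong E A (L n) /\ sub (L n) T1).
  { induction n as [|n [h1 h2]]; [rewrite hL0; split; auto; intros x; auto|]. rewrite hLS. split.
    - apply hull_strong; auto.
      + intros y [x [hx <-]]. apply heA; auto.
      + destruct (strong_ne h1) as [x hx]; exists (e x), x; auto.
    - intros y hy. apply hsub. apply hy. split; auto.
      intros y' [x [hx <-]]; apply he; auto. }
  assert (hL1S : sub (L 1) T0).
  { rewrite hLS, hL0. apply hull_le; auto. intros y' [x [hx <-]]; apply he; auto. }
  assert (hdec : forall n, sub (L (S n)) (L n)).
  { induction n as [|n IH].
    - rewrite hL0. intros x hx; apply hsub, hL1S; auto.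
    - assert (h := hull_mono (E:=E) (A:=A) (img_mono (f:=e) IH)). rewrite <- !hLS in h; exact h. }
  assert (heL : forall n z, L n z -> L (S n) (e z)).
  { intros n z hz. rewrite hLS. apply hull_ge. exists z; auto. }
  assert (heQ : forall n z, L n z -> ~ L (S n) z -> ~ L (S (S n)) (e z)).
  { intros n z hz hnz. rewrite (hLS (S n)). apply (hull_escape hE) with (A0 := T1); auto.
    - apply (strong_restrict hE) with A; auto; [apply h1 | apply h1 | apply hT1].
    - apply (h1 n); auto. }
  assert (hz1 : L 1 (e z0) /\ ~ L 2 (e z0)).
  { assert (hz0' : L 0 z0) by (rewrite hL0; auto). split; [apply (heL 0); auto | apply (heQ 0); auto]. }
  assert (hz2 : L 2 (e (e z0)) /\ ~ L 3 (e (e z0))).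
  { split; [apply (heL 1); apply hz1 | apply (heQ 1); apply hz1]. }
  assert (h31 : sub (L 3) (L 2)) by (apply (hdec 2)).
  assert (h21 : sub (L 2) (L 1)) by (apply (hdec 1)).
  assert (hab : exists a b, (L 1 a /\ ~ L 3 a /\ forall x, L 3 x -> ~ E a x) /\ (L 1 b /\ ~ L 3 b /\ forall x, L 3 x -> E b x)).
  { destruct (strong_ne (proj1 (h1 2))) as [w hw].
    destruct (strong_mod (proj1 (h1 2))) as [_ hm2].
    assert (hA1 : A (e z0)) by (apply (strong_sub (proj1 (h1 1))), hz1).
    destruct (classic (E (e z0) w)) as [hlab|hlab].
    - destruct (@up_label U (co E) (cog_co hE) A (L 1) (L 2) (L 3) (e (e z0)) (e z0)) as [u [hu [hnu hu1]]];
        try apply hz1; try apply hz2; auto; try (apply strong_co; auto; apply h1).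
      + intros y hy [_ h]. apply h. apply (hm2 (e z0) w y); auto. apply hz1.
      + exists u, (e z0). split; [split; [auto|split; [auto|]]|].
        * intros x hx; apply (hu1 x hx).
        * split; [apply hz1|split]. { intros h; apply hz1; auto. }
          intros x hx. apply (hm2 (e z0) w x); auto. apply hz1.
    - destruct (@up_label U E hE A (L 1) (L 2) (L 3) (e (e z0)) (e z0)) as [u [hu [hnu hu1]]];
        try apply hz1; try apply hz2; auto; try apply h1.
      + intros y hy h. apply hlab. apply (hm2 (e z0) y w); auto. apply hz1.
      + exists (e z0), u. split; [|auto].
        split; [apply hz1|split]. { intros h; apply hz1; auto. }
        intros x hx h. apply hlab. apply (hm2 (e z0) x w); auto. apply hz1. }
  destruct hab as [a [b [[ha1 [ha2 ha3]] [hb1 [hb2 hb3]]]]].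
  (* Every second module is used, so that each region has vertices of both labels; the odd indices
     leave [z0] outside the first module. *)
  apply (@down_false U E hE code hcode m A (fun n => L (2*n+1)) (fun x => e (e x)) z0 a b); auto.
  - intros n; apply (h1 (2*n+1)).
  - apply (strong_sub hT1); auto.
  - intros n x hx. replace (2 * S n + 1) with (1 + (1 + (2*n+1))) in hx by lia. apply hdec, hdec; auto.
  - apply emb_restrict with T1 A.
    + apply emb_comp with T1; auto. apply emb_restrict with T1 T0; auto; [intros x; auto|].
      intros x hx; apply hsub, he; auto.
    + apply (h1 1).
    + intros x hx. apply (hdec 1), (hdec 2), (heL 2), (heL 1); auto.
  - intros n z hz. replace (2 * S n + 1) with (1 + (1 + (2*n+1))) by lia. apply heL, heL; auto.
  - intros n z hz hnz.
    replace (2 * S (S n) + 1) with (2 + (1 + (1 + (2*n+1)))) by lia.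
    replace (2 * S n + 1) with (1 + (1 + (2*n+1))) in hnz by lia.
    destruct (classic (L (1 + (2*n+1)) z)) as [hz'|hz'].
    + apply heQ; [apply heL; auto|]. apply (heQ (1 + (2*n+1)) z); auto.
    + intros h. apply (heQ (1 + (2*n+1)) (e z)); [apply heL; auto | apply (heQ (2*n+1) z); auto|].
      apply (hdec (2 + (1 + (2*n+1)))); auto.
Qed.

(** * Ascending sequences of modules *)

Section Up.
Variables (U : Type) (E : U -> U -> Prop) (hE : cog E) (code : U -> nat) (hcode : injective code).
Variables (m : nat) (A : set U) (L : nat -> set U) (e : U -> U) (x0 a0 b0 : U).
Hypotheses (hfin : finl E m A) (hL : forall n, module E A (L n)).
Hypotheses (hinc : forall n, sub (L n) (L (S n))) (he : emb E e A A).
Hypotheses (heL : forall n z, L n z -> L (S n) (e z)).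
Hypotheses (heQ : forall n z, L (S n) z -> ~ L n z -> ~ L (S n) (e z)).
Hypothesis hx0 : L 0 x0.
Hypotheses (ha : L 1 a0) (hna : ~ L 0 a0) (hab : forall x, L 0 x -> ~ E a0 x).
Hypotheses (hb : L 1 b0) (hnb : ~ L 0 b0) (hbb : forall x, L 0 x -> E b0 x).

Let Q n : set U := fun z => L (S n) z /\ ~ L n z.
Let D : set U := fun z => exists n, L n z.
Let lab z := E z x0.

Lemma Lu_mono i j : i <= j -> sub (L i) (L j).
Proof. intros h; induction h; [intros x; auto|]. intros x hx; apply hinc, IHh; auto. Qed.

Lemma Qu_dis i j z : Q i z -> Q j z -> i = j.
Proof.
  intros [h1 h2] [h3 h4]. destruct (lt_eq_lt_dec i j) as [[hij|]|hij]; auto; exfalso.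
  - apply h4. apply (@Lu_mono (S i) j hij); auto.
  - apply h2. apply (@Lu_mono (S j) i hij); auto.
Qed.

Lemma labu_iff n z x : Q n z -> L n x -> (E z x <-> lab z).
Proof.
  intros [h1 h2] hx. assert (hx0n : L n x0) by (apply (@Lu_mono 0 n); auto; lia).
  assert (hz : A z) by (apply (hL (S n)); auto).
  split; intros h; [apply (proj2 (hL n) z x x0) | apply (proj2 (hL n) z x0 x)]; auto.
Qed.

Lemma D_split n z : L n z -> L 0 z \/ exists i, i < n /\ Q i z.
Proof.
  induction n; auto. intros hz. destruct (classic (L n z)) as [h|h].
  - destruct (IHn h) as [|[i [hi h']]]; auto. right; exists i; split; auto.
  - right; exists n; split; auto; split; auto.
Qed.

Lemma up_shift : shift E D (L 0) Q e lab (fun i j => j < i) a0 b0.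
Proof.
  assert (hDA : forall z, D z -> A z) by (intros z [n h]; apply (hL n); auto).
  assert (hQD : forall n z, Q n z -> D z) by (intros n z [h _]; exists (S n); auto).
  split.
  - intros z; split.
    + intros [n hn]. destruct (D_split hn) as [|[i [_ h]]]; eauto.
    + intros [h|[n h]]; [exists 0; auto | eauto].
  - apply Qu_dis.
  - intros i z [_ h] h'. apply h, (@Lu_mono 0 i); auto; lia.
  - apply emb_restrict with A A; auto. intros z [n hn]; exists (S n); auto.
  - intros n z [h1 h2]; split; auto.
  - intros n z [h1 h2]. assert (hx0n : L n x0) by (apply (@Lu_mono 0 n); auto; lia).
    assert (hQ' : Q (S n) (e z)) by (split; auto).
    rewrite <- (@labu_iff n z x0); [|split; auto|auto].
    rewrite <- (@labu_iff (S n) (e z) (e x0)); auto.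
    symmetry; apply (emb_adj he); [apply (hL (S n)) | apply (hL 0)]; auto.
  - intros i j z w hz [hw _] hij. apply (labu_iff hz). apply (@Lu_mono (S j) i hij); auto.
  - intros i z w hz hw. apply (labu_iff hz). apply (@Lu_mono 0 i); auto; lia.
  - intros i j h; lia.
  - intros i j h; lia.
  - split; auto.
  - unfold lab; auto.
  - split; auto.
  - unfold lab; auto.
Qed.

Let Y s := Ysig (L 0) Q e a0 b0 s.
Let H s := swap A D (Y s).
(** The word up to and including the letter [b] that opens block [k]. *)
Let Z s k : set U := fun z => Y s z /\ L (5*k+1) z.
Let al k := it k e a0.
Let be k := it k e b0.

Lemma alu_Q k : Q k (al k). Proof. apply (sh_aQ up_shift). Qed.
Lemma beu_Q k : Q k (be k). Proof. apply (sh_bQ up_shift). Qed.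
Lemma alu_adj k x : L k x -> ~ E (al k) x.
Proof. intros hx. rewrite (labu_iff (alu_Q k) hx). apply (sh_alab up_shift). Qed.
Lemma beu_adj k x : L k x -> E (be k) x.
Proof. intros hx. rewrite (labu_iff (beu_Q k) hx). apply (sh_blab up_shift). Qed.
Lemma Yu_D s z : Y s z -> D z.
Proof. apply (Ysig_D up_shift). Qed.
Lemma Yu_be0 s k : Y s (be (5*k)).
Proof. right; exists (5*k); left; eauto. Qed.
Lemma Yu_al1 s k : Y s (al (5*k+1)).
Proof. right; exists (5*k+1); right; left; eauto. Qed.
Lemma Yu_al2 s k : s k = true -> Y s (al (5*k+2)).
Proof. intros h; right; exists (5*k+2); right; right; left; eauto. Qed.
Lemma Yu_be3 s k : Y s (be (5*k+3)).
Proof. right; exists (5*k+3); do 3 right; left; eauto. Qed.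

Lemma D_mod : module E A D.
Proof.
  split; [intros z [n h]; apply (hL n); auto|].
  intros u x y hu hnu [i hi] [j hj] h.
  apply (proj2 (hL (i + j)) u x y); auto.
  - intros h'; apply hnu; exists (i+j); auto.
  - apply (@Lu_mono i (i+j)); auto; lia.
  - apply (@Lu_mono j (i+j)); auto; lia.
Qed.

(** [D] may be all of [A], so both kinds of connectedness have to be compared. A letter [b] far
    enough out is a common neighbour of any two given vertices, and a letter [a] is one in the
    complement. *)
Lemma D_conn s : conn E D /\ conn (co E) D /\ conn E (Y s) /\ conn (co E) (Y s).
Proof.
  assert (hp : forall x y, D x -> D y -> exists n, L n x /\ L n y).
  { intros x y [i hi] [j hj]. exists (i+j); split; [apply (@Lu_mono i (i+j)) | apply (@Lu_mono j (i+j))]; auto; lia. }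
  assert (hb' : forall x y, D x -> D y -> near E (Y s) x y).
  { intros x y hx hy. destruct (hp x y hx hy) as [n [h1 h2]].
    right; right; exists (be (5*n)); split; [apply Yu_be0|].
    split; [apply (cog_sym hE)|]; apply beu_adj; apply (@Lu_mono n (5*n)); auto; lia. }
  assert (ha' : forall x y, D x -> D y -> near (co E) (Y s) x y).
  { intros x y hx hy. destruct (hp x y hx hy) as [n [h1 h2]].
    assert (h3 : L (5*n+1) x) by (apply (@Lu_mono n (5*n+1)); auto; lia).
    assert (h4 : L (5*n+1) y) by (apply (@Lu_mono n (5*n+1)); auto; lia).
    pose proof (alu_Q (5*n+1)) as [_ h5].
    right; right; exists (al (5*n+1)); split; [apply Yu_al1|].
    split; [apply (cog_sym (cog_co hE))|]; split; try (apply alu_adj; auto); intros h6; rewrite h6 in h5; auto. }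
  assert (hsub : sub (Y s) D) by (intros z; apply Yu_D).
  repeat split; intros x y hx hy; try (apply near_sub with (Y s); auto; fail); auto.
Qed.

Lemma H_cases s u : H s u -> (A u /\ ~ D u) \/ L 0 u \/ exists i, Q i u /\ pat Q e a0 b0 s i u.
Proof.
  intros [h|[h|[i h]]]; auto. right; right; exists i; split; auto. apply (pat_Q up_shift h).
Qed.

Lemma Y_level s k u : Y s u -> L (5*k+1) u -> u = be (5*k) \/ L (5*k) u.
Proof.
  intros hY hu. destruct (classic (L (5*k) u)) as [|hn]; auto. left.
  assert (hQ : Q (5*k) u) by (split; auto; replace (S (5*k)) with (5*k+1) by lia; auto).
  pose proof (Ysig_pat up_shift hY hQ) as hp.
  destruct hp as [[n [hn' hz']]|[[n [hn' hz']]|[[n [hn' [ht hz']]]|[[n [hn' hz']]|[n [w [hn' _]]]]]]]; try lia.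
  auto.
Qed.

Lemma Z_be s k : Z s k (be (5*k)).
Proof. split; [apply Yu_be0|]. replace (5*k+1) with (S (5*k)) by lia. apply beu_Q. Qed.
Lemma Z_x0 s k : Z s k x0.
Proof. split; [left; auto | apply (@Lu_mono 0 (5*k+1)); auto; lia]. Qed.

Lemma H_out s k u : H s u -> ~ Z s k u ->
  (A u /\ ~ D u) \/ exists i, 5*k+1 <= i /\ Q i u /\ pat Q e a0 b0 s i u.
Proof.
  intros hu hn. destruct (H_cases hu) as [h|[h|[i [h1 h2]]]]; auto.
  - exfalso; apply hn; split; [left; auto | apply (@Lu_mono 0 (5*k+1)); auto; lia].
  - right; exists i; split; auto. apply NNPP; intros hi. apply hn; split.
    + right; exists i; auto.
    + apply (@Lu_mono (S i) (5*k+1)); [lia | apply h1].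
Qed.

Lemma out_const s k u i : (A u /\ ~ D u) \/ (k <= i /\ Q i u) ->
  (forall x, Y s x -> L k x -> E u x) \/ (forall x, Y s x -> L k x -> ~ E u x).
Proof.
  intros [[h1 h2]|[h1 h2]].
  - destruct (classic (E u x0)) as [h|h]; [left|right]; intros x hx hx'.
    + apply (proj2 D_mod u x0 x); auto; [exists 0; auto | exists k; auto].
    + intros h'; apply h. apply (proj2 D_mod u x x0); auto; [exists k; auto | exists 0; auto].
  - destruct (classic (lab u)) as [h|h]; [left|right]; intros x hx hx'.
    + apply (labu_iff h2); auto. apply (@Lu_mono k i); auto.
    + rewrite (labu_iff h2); auto. apply (@Lu_mono k i); auto.
Qed.

Lemma Z_H s k : sub (Z s k) (H s).
Proof. intros z [h _]; right; auto. Qed.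

(** The letter [b] in slot [5k] connects the prefix, and the letter [a] in slot [5k+1] is the
    separating vertex for the complement. *)
Lemma Z_strong s k : strong E (H s) (Z s k).
Proof.
  assert (hc : conn E (Z s k)).
  { assert (hz : forall x, Z s k x -> x = be (5*k) \/ E (be (5*k)) x).
    { intros x [h1 h2]. destruct (Y_level h1 h2) as [->|h]; auto. right. apply beu_adj; auto. }
    intros x y hx hy. destruct (hz x hx) as [->|h1]; destruct (hz y hy) as [->|h2].
    - left; auto.
    - right; left; auto.
    - right; left; ea.
    - right; right; exists (be (5*k)); split; [apply Z_be | ea]. }
  split.
  - exists x0; apply Z_x0.
  - split; [apply Z_H|].
    intros u x y hu hnu [hx hx'] [hy hy'] h.
    assert (hk : (A u /\ ~ D u) \/ exists i, 5*k+1 <= i /\ Q i u).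
    { destruct (H_out hu hnu) as [h1|[i [h1 [h2 _]]]]; eauto. }
    destruct hk as [hk|[i hk]];
      [destruct (@out_const s (5*k+1) u 0 (or_introl hk)) as [h1|h1]
      |destruct (@out_const s (5*k+1) u i (or_intror hk)) as [h1|h1]]; auto;
      exfalso; apply (h1 x); auto.
  - intros hc'; contradiction.
  - intros _ z hz hnz hzZ.
    assert (hzp : forall x, Z s k x -> E z x).
    { intros x hx. apply NNPP; intros h. apply (hzZ x hx). split; auto. intros ->; auto. }
    pose proof (alu_Q (5*k+1)) as [hal1 hal2].
    exists (al (5*k+1)). split; [right; apply Yu_al1|]. split; [intros [_ h]; auto|]. split.
    + intros x [hx hx']. split; [intros hh; rewrite hh in hal2; auto | apply alu_adj; auto].
    + intros [_ h]. apply h. apply (cog_sym hE).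
      destruct (H_out hz hnz) as [[h1 h2]|[i [h1 [h2 h3]]]].
      * apply (proj2 D_mod z x0); auto; [exists 0; auto | exists (S (5*k+1)); auto | apply hzp, Z_x0].
      * assert (hlab : lab z) by (apply hzp, Z_x0).
        assert (hi : i <> 5*k+1).
        { intros ->. destruct h3 as [[n [hn' hz']]|[[n [hn' hz']]|[[n [hn' [ht hz']]]|[[n [hn' hz']]|[n [w [hn' _]]]]]]]; try lia.
          rewrite hz' in hlab. apply (sh_alab up_shift hlab). }
        apply (labu_iff h2); auto. apply (@Lu_mono (S (5*k+1)) i); [lia | auto].
Qed.

Let Wd (s : nat -> bool) k : set U := fun z => z = al (5*k+1) \/ (s k = true /\ z = al (5*k+2)).

Lemma Wu_step s k : Wset E (H s) (Z s k) = Wd s k.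
Proof.
  pose proof (alu_Q (5*k+1)) as hq1. pose proof (alu_Q (5*k+2)) as hq2. pose proof (beu_Q (5*k+3)) as hq3.
  assert (hW : forall w, Wd s k w -> exists i, 5*k+1 <= i <= 5*k+2 /\ Q i w /\ w = al i /\ Y s w).
  { intros w [->|[h ->]]; eexists; (split; [|split; [eauto|split; auto]]); try lia; [apply Yu_al1 | apply Yu_al2; auto]. }
  assert (hlow : forall x, Z s k x \/ Wd s k x \/ x = be (5*k+3) -> Y s x /\ L (5*k+4) x).
  { intros x [[h1 h2]|[h| ->]].
    - split; auto. apply (@Lu_mono (5*k+1) (5*k+4)); auto; lia.
    - destruct (hW x h) as [i [hi [hQ [_ hY]]]]. split; auto. apply (@Lu_mono (S i)); [lia | apply hQ].
    - split; [apply Yu_be3|]. replace (5*k+4) with (S (5*k+3)) by lia. apply hq3. }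
  apply (Wset_compute hE) with (g := be (5*k+3)) (x0 := x0).
  - apply Z_x0.
  - intros w hw; right. destruct (hW w hw) as [i [_ [_ [_ h]]]]; auto.
  - intros w x hw [_ hx]. destruct (hW w hw) as [i [hi [_ [-> _]]]]. apply alu_adj.
    apply (@Lu_mono (5*k+1)); auto; lia.
  - intros w hw [_ h]. destruct (hW w hw) as [i [hi [[_ hQ] _]]]. apply hQ.
    apply (@Lu_mono (5*k+1)); auto; lia.
  - right; apply Yu_be3.
  - intros [_ h]. apply hq3. apply (@Lu_mono (5*k+1)); auto; lia.
  - intros x [_ hx]. apply beu_adj. apply (@Lu_mono (5*k+1)); auto; lia.
  - intros w hw. destruct (hW w hw) as [i [hi [[hQ _] _]]]. apply beu_adj. apply (@Lu_mono (S i)); auto; lia.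
  - intros u hu hn1 hn2 hn3.
    assert (hk : (A u /\ ~ D u) \/ exists i, 5*k+4 <= i /\ Q i u).
    { destruct (H_out hu hn1) as [h1|[i [h1 [h2 h3]]]]; auto. right; exists i; split; auto.
      apply NNPP; intros hlt.
      destruct h3 as [[n [hn' hz']]|[[n [hn' hz']]|[[n [hn' [ht hz']]]|[[n [hn' hz']]|[n [w [hn' _]]]]]]]; try lia;
        assert (n = k) by lia; subst n i.
      - apply hn2; left; auto.
      - apply hn2; right; auto.
      - apply hn3; auto. }
    assert (hcst : (forall x, Y s x -> L (5*k+4) x -> E u x) \/ (forall x, Y s x -> L (5*k+4) x -> ~ E u x)).
    { destruct hk as [hk|[i hk]]; [apply (@out_const s (5*k+4) u 0 (or_introl hk)) | apply (@out_const s (5*k+4) u i (or_intror hk))]. }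
    destruct hcst as [h|h]; [left|right]; intros x hx; destruct (hlow x hx); auto.
Qed.

Lemma Z_agree s t k : (forall j, j < k -> s j = t j) -> Z s k = Z t k.
Proof.
  assert (one : forall s t, (forall j, j < k -> s j = t j) -> sub (Z s k) (Z t k)).
  { clear s t; intros s t hst z [[hz|[i hz]] hl]; split; auto; [left; auto|].
    right; exists i. assert (hi : i < 5*k+1).
    { apply NNPP; intros h. apply (proj2 (pat_Q up_shift hz)). apply (@Lu_mono (5*k+1)); auto; lia. }
    destruct hz as [hz|[hz|[[n [h1 [h2 h3]]]|hz]]].
    - left; auto.
    - right; left; auto.
    - right; right; left. exists n; split; auto; split; auto. rewrite <- hst; auto; lia.
    - do 3 right; auto. }
  intros hst; apply set_ext; intros z; split; apply one; auto. intros; symmetry; auto.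
Qed.

Lemma H_ksib s : ksib E A (H s).
Proof.
  apply swap_ksib; auto.
  - apply D_mod.
  - exists x0, 0; auto.
  - intros z; apply Yu_D.
  - apply (shift_le hE up_shift).
  - intros _. destruct (D_conn s) as [h1 [h2 [h3 h4]]]. tauto.
Qed.

(** Both prefixes contain [x0], so these strong modules are comparable; being isomorphic, they
    coincide by [fin_nonest], which takes the place of the case analysis for descending
    sequences. *)
Lemma up_step s t phi k : isof E phi (H s) (H t) -> phi x0 = x0 -> (forall j, j < k -> s j = t j) ->
  img phi (Z s k) = Z t k.
Proof.
  intros hphi hx hst.
  assert (hns : nonest E (H t)) by (apply (fin_nonest hE hcode (m:=m)); apply finl_ksib with A; auto; apply H_ksib).
  assert (hM' : strong E (H t) (img phi (Z s k))) by (apply strong_img with (H s); auto; apply Z_strong).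
  assert (hM := Z_strong t k).
  assert (hi : iso E (Z s k) (img phi (Z s k))).
  { exists phi. apply isof_img with (H t). apply emb_restrict with (H s) (H t); [apply hphi | apply Z_H|].
    intros x h; apply (emb_in (proj1 hphi)), (@Z_H s k); auto. }
  rewrite (Z_agree hst) in hi at 1.
  assert (hx1 : img phi (Z s k) x0) by (exists x0; split; auto; apply Z_x0).
  apply set_ext; intros z.
  destruct (strong_nested hE hM (strong_mod hM') (Z_x0 t k) hx1) as [h|h]; split; auto.
  - apply hns; auto. apply iso_le; auto.
  - apply hns; auto. apply iso_le, iso_sym; auto.
Qed.

Lemma up_false : False.
Proof.
  apply (@cantor U E code m A H (fun _ => x0) (fun _ => x0)); auto.
  - apply H_ksib.
  - intros s; split; right; left; auto.
  - intros s t phi hphi hx _.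
    assert (hall : forall n k, k < n -> s k = t k).
    { induction n; intros k hk; [lia|].
      destruct (Nat.eq_dec k n) as [->|hkn]; [|apply IHn; lia].
      assert (hZ := up_step hphi hx (fun j hj => IHn j hj)).
      assert (hW : img phi (Wd s n) = Wd t n).
      { rewrite <- (Wu_step s n), (Wset_img hphi), hZ; [apply Wu_step | apply Z_H]. }
      assert (hne : al (5*n+1) <> al (5*n+2)).
      { intros h. pose proof (alu_Q (5*n+1)) as h1. rewrite h in h1.
        pose proof (Qu_dis h1 (alu_Q (5*n+2))). lia. }
      destruct (s n) eqn:es; destruct (t n) eqn:et; auto; exfalso; apply hne.
      - assert (h1 : Wd t n (phi (al (5*n+1)))) by (rewrite <- hW; eexists; split; [left; eauto | auto]).
        assert (h2 : Wd t n (phi (al (5*n+2)))) by (rewrite <- hW; eexists; split; [right; eauto | auto]).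
        destruct h1 as [h1|[h1 _]]; [|congruence]. destruct h2 as [h2|[h2 _]]; [|congruence].
        apply (emb_inj (proj1 hphi)); [right; apply Yu_al1 | right; apply Yu_al2; auto | congruence].
      - assert (h1 : img phi (Wd s n) (al (5*n+1))) by (rewrite hW; left; auto).
        assert (h2 : img phi (Wd s n) (al (5*n+2))) by (rewrite hW; right; auto).
        destruct h1 as [x [[->|[h _]] h1]]; [|congruence]. destruct h2 as [y [[->|[h _]] h2]]; congruence. }
    intros n. apply (hall (S n)). lia.
Qed.
End Up.

Theorem fin_up U (E : U -> U -> Prop) (hE : cog E) (code : U -> nat) (hcode : injective code) m A P g x y :
  finl E m A -> strong E A P -> emb E g A A -> P x -> P (g x) -> P y -> P (g y).
Proof.
  intros hfin hP hg hx hgx hy. apply NNPP; intros hngy.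
  set (L := fix L n := match n with 0 => P | S n => hull E A (img g (L n)) end : set U).
  assert (hLS : forall n, L (S n) = hull E A (img g (L n))) by reflexivity.
  assert (hL0 : L 0 = P) by reflexivity. clearbody L. rewrite <- hL0 in hP, hx, hgx, hy, hngy.
  assert (h1 : forall n, strong E A (L n)).
  { induction n as [|n h1]; auto. rewrite hLS. apply hull_strong; auto.
    + intros y' [x' [hx' <-]]. apply hg, (strong_sub h1); auto.
    + destruct (strong_ne h1) as [x' hx']; exists (g x'), x'; auto. }
  assert (heL : forall n z, L n z -> L (S n) (g z)).
  { intros n z hz. rewrite hLS. apply hull_ge. exists z; auto. }
  assert (hesc : forall n z, A z -> ~ L n z -> ~ L (S n) (g z)).
  { intros n z hz hnz. rewrite hLS. apply (hull_escape hE) with (A0 := A); auto. }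
  (* At the first step [g x] makes the two modules comparable, and [g y] decides the direction of
     the inclusion. *)
  assert (hinc : forall n, sub (L n) (L (S n))).
  { induction n as [|n IH].
    - destruct (strong_nested hE (h1 0) (strong_mod (h1 1)) hgx (heL 0 x hx)) as [h|h]; auto.
      exfalso; apply hngy, h, (heL 0); auto.
    - assert (h := hull_mono (E:=E) (A:=A) (img_mono (f:=g) IH)). rewrite <- !hLS in h; exact h. }
  assert (hAy : A (g y)) by (apply hg, (strong_sub hP); auto).
  assert (hz1 : L 1 (g y) /\ ~ L 0 (g y)) by (split; [apply (heL 0); auto | auto]).
  assert (hz2 : L 2 (g (g y)) /\ ~ L 1 (g (g y))).
  { split; [apply (heL 1); apply hz1 | apply (hesc 0); auto]. }
  assert (hAy2 : A (g (g y))) by (apply hg; auto).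
  assert (h01 : sub (L 0) (L 1)) by (apply (hinc 0)).
  assert (h12 : sub (L 1) (L 2)) by (apply (hinc 1)).
  assert (hab : exists a b, (L 2 a /\ ~ L 0 a /\ forall x, L 0 x -> ~ E a x) /\ (L 2 b /\ ~ L 0 b /\ forall x, L 0 x -> E b x)).
  { destruct (strong_mod (h1 1)) as [_ hm1]. assert (hw : L 1 x) by (apply h01; auto).
    destruct (classic (E (g (g y)) x)) as [hlab|hlab].
    - destruct (@up_label U (co E) (cog_co hE) A (L 2) (L 1) (L 0) (g y) (g (g y))) as [u [hu [hnu hu1]]];
        try apply hz1; try apply hz2; auto; try (apply strong_co; auto; apply h1).
      + intros y' hy' [_ h]. apply h. apply (hm1 (g (g y)) x y'); auto; apply hz2.
      + exists u, (g (g y)). split; [split; [auto|split; [auto|]]|].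
        * intros x' hx'; apply (hu1 x' hx').
        * split; [apply hz2|split]. { intros h; apply hz2; auto. }
          intros x' hx'. apply (hm1 (g (g y)) x x'); auto; apply hz2.
    - destruct (@up_label U E hE A (L 2) (L 1) (L 0) (g y) (g (g y))) as [u [hu [hnu hu1]]];
        try apply hz1; try apply hz2; auto; try apply h1.
      + intros y' hy' h. apply hlab. apply (hm1 (g (g y)) y' x); auto; apply hz2.
      + exists (g (g y)), u. split; [|auto].
        split; [apply hz2|split]. { intros h; apply hz2; auto. }
        intros x' hx' h. apply hlab. apply (hm1 (g (g y)) x' x); auto; apply hz2. }
  destruct hab as [a [b [[ha1 [ha2 ha3]] [hb1 [hb2 hb3]]]]].
  apply (@up_false U E hE code hcode m A (fun n => L (2*n)) (fun x => g (g x)) x a b); auto.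
  - intros n; apply (h1 (2*n)).
  - intros n z hz. replace (2 * S n) with (1 + (1 + (2*n))) by lia. apply hinc, hinc; auto.
  - apply emb_comp with A; auto.
  - intros n z hz. replace (2 * S n) with (1 + (1 + (2*n))) by lia. apply heL, heL; auto.
  - intros n z hz hnz. replace (2 * S n) with (1 + (1 + (2*n))) by lia.
    assert (hz' : A z) by (apply (strong_sub (h1 (2 * S n))); auto).
    apply hesc; [apply hg; auto|]. apply hesc; auto.
Qed.

(** * Replacing all modules of a given type *)

Definition Occ {U} (E : U -> U -> Prop) (N K : set U) : set U -> Prop :=
  fun M => strong E N M /\ ksib E K M.

Lemma occ_disj U (E : U -> U -> Prop) (hE : cog E) N K M M' z :
  nonest E N -> Occ E N K M -> Occ E N K M' -> M z -> M' z -> M = M'.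
Proof.
  intros hn [h1 [h2 _ _]] [h3 [h4 _ _]] hz hz'.
  assert (hle : le E M M' /\ le E M' M).
  { split; apply le_trans with K; apply h2 || apply h4. }
  apply set_ext; intros x.
  destruct (strong_nested hE h1 (strong_mod h3) hz hz') as [h|h]; split; auto.
  - apply hn; auto; apply hle.
  - apply hn; auto; apply hle.
Qed.

(** The separating vertex [u] may have been deleted; the vertex [r u] that remains at its place does
    the same work. *)
Lemma repl_half U (E : U -> U -> Prop) (hE : cog E) N F B M :
  replable E N F B -> F M -> halfstrong E N M -> (conn E M -> conn E (B M)) -> (exists x, B M x) ->
  halfstrong E (repl N F B) (B M).
Proof.
  intros hr hM hh hc [b hb] hcB z hz hnz hzB.
  destruct (repl_map hE hr) as [r [hr1 [_ hr3]]]. destruct (rp_mod hr hM) as [hs hm].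
  assert (hzN : N z) by apply hz. assert (hzM : ~ M z) by (intros h; apply hnz, hz; auto).
  assert (hbM : M b) by (apply (rp_sub hr hM); auto).
  destruct (hh) with (z := z) as [u [hu [hnu [h1 h2]]]]; auto.
  { intros x hx h. apply (hzB b hb). apply (hm z x b); auto. }
  assert (hp := hr3 u hu).
  assert (hru : N (r u)) by (apply repl_sub with F B, hr1; auto).
  assert (hruM : ~ M (r u)).
  { intros h. destruct hp as [e|[M' [hM' [h3 h4]]]]; [rewrite <- e in h; auto|].
    rewrite (rp_disj hr hM' hM h4 h) in h3; auto. }
  exists (r u). split; [apply hr1; auto|]. split; [intros h; apply hruM, (rp_sub hr hM); auto|]. split.
  - intros x hx. assert (hxM : M x) by (apply (rp_sub hr hM); auto).
    apply (place_adj hE hr (x:=u) (y:=x)); auto; [left; auto|].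
    intros [M' [hM' [h3 h4]]]. rewrite (rp_disj hr hM' hM h4 hxM) in h3; auto.
  - intros h. apply h2.
    destruct (classic (exists M', F M' /\ M' (r u) /\ M' z)) as [[M' [hM' [h3 h4]]]|hno].
    + exfalso. assert (hu' : M' u).
      { destruct hp as [e|[M2 [hM2 [h5 h6]]]]; [rewrite e; auto|]. rewrite <- (rp_disj hr hM2 hM' h6 h3); auto. }
      assert (hbM' : ~ M' b).
      { intros h5. rewrite (rp_disj hr hM' hM h5 hbM) in h4; auto. }
      destruct (rp_mod hr hM') as [_ hm']. apply (hzB b hb). apply (cog_sym hE).
      apply (hm' b u z); auto. apply (cog_sym hE); auto.
    + apply (place_adj hE hr (x:=r u) (y:=z)); auto using place_sym. left; auto.
Qed.

Lemma repl_mod U (E : U -> U -> Prop) N F B M :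
  replable E N F B -> F M -> module E (repl N F B) (B M).
Proof.
  intros hr hM. destruct (rp_mod hr hM) as [hs hm]. split.
  - intros z hz. assert (hzM : M z) by (apply (rp_sub hr hM); auto). split; auto.
    intros M' hM' hz'. rewrite (rp_disj hr hM' hM hz' hzM); auto.
  - intros u x y hu hnu hx hy. apply hm; try (apply (rp_sub hr hM); auto).
    + apply hu.
    + intros h; apply hnu, hu; auto.
Qed.

(** Here it is the vertex [z] that may be missing from the reduced graph, where [r z] stands in for
    it. *)
Lemma unrepl_half U (E : U -> U -> Prop) (hE : cog E) N F B T :
  replable E N F B -> sub T (repl N F B) -> (forall M z, F M -> M z -> ~ T z) -> (exists x, T x) ->
  halfstrong E (repl N F B) T -> halfstrong E N T.
Proof.
  intros hr hT hTF [x0 hx0] hh hc z hz hnz hzT.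
  destruct (repl_map hE hr) as [r [hr1 [_ hr3]]].
  assert (hsep : forall u x, T x -> ~ (exists M, F M /\ M u /\ M x)).
  { intros u x hx [M [hM [h1 h2]]]. apply (hTF M x); auto. }
  assert (hrz : N (r z)) by (apply repl_sub with F B, hr1; auto).
  assert (hpz := hr3 z hz).
  destruct (hh hc (r z)) as [u [hu [hnu [h1 h2]]]].
  - apply hr1; auto.
  - intros h. destruct hpz as [e|[M [hM [h3 h4]]]]; [rewrite <- e in h; auto | apply (hTF M (r z)); auto].
  - intros x hx h. apply (hzT x hx). assert (N x) by apply (hT x hx).
    apply (place_adj hE hr (x:=r z) (y:=x)); auto using place_sym. left; auto.
  - assert (huN : N u) by apply hu. exists u; split; auto; split; auto; split; auto.
    intros h. apply h2.
    destruct (classic (exists M, F M /\ M u /\ M z)) as [[M [hM [h3 h4]]]|hno].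
    + exfalso. destruct (rp_mod hr hM) as [_ hm]. assert (hx0N : N x0) by apply (hT x0 hx0).
      apply (hzT x0 hx0). apply (cog_sym hE). apply (hm x0 u z); auto.
      * intros h5; apply (hTF M x0); auto.
      * apply (cog_sym hE); auto.
    + apply (place_adj hE hr (x:=u) (y:=z)); auto. left; auto.
Qed.

Lemma unrepl_mod U (E : U -> U -> Prop) (hE : cog E) N F B T :
  replable E N F B -> (forall M z, F M -> M z -> ~ T z) ->
  module E (repl N F B) T -> module E N T.
Proof.
  intros hr hTF [hT hm]. destruct (repl_map hE hr) as [r [hr1 [_ hr3]]].
  split; [intros z hz; apply (hT z hz)|].
  intros u x y hu hnu hx hy h.
  assert (hsep : forall u x, T x -> ~ (exists M, F M /\ M u /\ M x)).
  { intros u' x' hx' [M [hM [h1 h2]]]. apply (hTF M x'); auto. }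
  assert (hru : N (r u)) by (apply repl_sub with F B, hr1; auto).
  assert (hxN : N x) by apply (hT x hx). assert (hyN : N y) by apply (hT y hy).
  assert (hp := hr3 u hu).
  apply (place_adj hE hr (x:=r u) (y:=y)); auto using place_sym; [left; auto|].
  apply (hm (r u) x y); auto.
  - apply hr1; auto.
  - intros h1. destruct hp as [e|[M [hM [h3 h4]]]]; [rewrite <- e in h1; auto | apply (hTF M (r u)); auto].
  - apply (place_adj hE hr (x:=u) (y:=x)); auto. left; auto.
Qed.

Section Occurrences.
Variables (U : Type) (E : U -> U -> Prop) (hE : cog E) (code : U -> nat) (hcode : injective code).

Definition asg (N K : set U) (B : set U -> set U) :=
  forall M, Occ E N K M -> sub (B M) M /\ ksib E K (B M).

Lemma asg_replable m N K B : finl E m N -> asg N K B -> replable E N (Occ E N K) B.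
Proof.
  intros hf hB. assert (hn := fin_nonest hE hcode hf). split.
  - intros M [h _]; apply h.
  - intros M M' z h1 h2. apply occ_disj with (N := N) (K := K) (E := E); auto.
  - intros M hM; apply hB; auto.
  - intros M hM. apply le_trans with K; [apply hM | apply (hB M hM)].
  - intros M hM; apply hM.
  - intros hN. destruct hN as [h1 h2]. destruct (hB N) as [_ h3]; [split; auto|].
    rewrite <- (ksib_conn h2). apply (ksib_conn h3).
  - intros hN. destruct hN as [h1 h2]. destruct (hB N) as [_ h3]; [split; auto|].
    rewrite <- (ksib_coconn h2). apply (ksib_coconn h3).
Qed.

Lemma ksib_ne (A B : set U) : ksib E A B -> (exists x, A x) -> exists x, B x.
Proof. intros [[[f hf] _] _ _] [x hx]; exists (f x); apply hf; auto. Qed.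

Lemma occ_strong m N K B M : finl E m N -> asg N K B -> Occ E N K M -> strong E (repl N (Occ E N K) B) (B M).
Proof.
  intros hf hB hM. assert (hr := asg_replable hf hB).
  destruct (hB M hM) as [h1 h2]. destruct hM as [h3 h4].
  assert (hne : exists x, B M x).
  { apply (ksib_ne h2). apply (ksib_ne (ksib_sym h4)). apply h3. }
  split; auto.
  - apply repl_mod; auto; split; auto.
  - apply repl_half; auto; [split; auto | apply h3|].
    rewrite <- (ksib_conn h4), (ksib_conn h2); auto.
  - apply repl_half; auto using cog_co, replable_co; [split; auto | apply h3|].
    rewrite <- (ksib_coconn h4), (ksib_coconn h2); auto.
Qed.

(** A strong module of this type that meets some [B M] equals it by rigidity. One that avoids all of
    them would already have been an occurrence in [N] and would have been replaced itself. *)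
Lemma occ_complete m N K B T : finl E m N -> asg N K B ->
  strong E (repl N (Occ E N K) B) T -> ksib E K T -> exists M, Occ E N K M /\ T = B M.
Proof.
  intros hf hB hT hK. assert (hr := asg_replable hf hB).
  assert (hn : nonest E (repl N (Occ E N K) B)).
  { apply (fin_nonest hE hcode (m:=m)). apply finl_ksib with N; auto. apply repl_ksib; auto. }
  destruct (classic (exists M z, Occ E N K M /\ B M z /\ T z)) as [[M [z [hM [h1 h2]]]]|hno].
  - exists M; split; auto. symmetry.
    apply (@occ_disj U E hE (repl N (Occ E N K) B) K (B M) T z); auto.
    + split; [eapply occ_strong; eauto | apply (hB M hM)].
    + split; auto.
  - exfalso. assert (hTF : forall M z, Occ E N K M -> M z -> ~ T z).
    { intros M z hM hz hTz. apply hno; exists M, z; split; auto; split; auto.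
      destruct (strong_sub hT hTz) as [_ hr0]. apply hr0; auto. }
    assert (hO : Occ E N K T).
    { split; auto. split; [apply hT | | |].
      - apply (unrepl_mod hE hr); auto. apply hT.
      - apply (unrepl_half hE hr); auto; [apply (strong_sub hT) | apply hT | apply hT].
      - apply (unrepl_half (cog_co hE) (replable_co hE hr)); auto; [apply (strong_sub hT) | apply hT | apply hT]. }
    destruct (strong_ne (occ_strong hf hB hO)) as [z hz].
    apply hno; exists T, z; split; auto; split; auto. apply (hB T hO); auto.
Qed.

Lemma homog_asg N K X : ksib E K X -> exists B, asg N K B /\ forall M, Occ E N K M -> iso E X (B M).
Proof.
  intros hX.
  assert (h : forall M : set U, exists B : set U, Occ E N K M -> sub B M /\ ksib E K B /\ iso E X B).
  { intros M. destruct (classic (Occ E N K M)) as [hM|hM].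
    - assert (hle : le E X M) by (apply le_trans with K; [apply hX | apply hM]).
      destruct hle as [f hf]. exists (img f X). intros _. split; [apply img_sub with E; auto|].
      assert (hi := iso_img hf). split; auto. apply ksib_trans with X; auto. apply iso_ksib; auto.
    - exists M; tauto. }
  apply choice in h. destruct h as [B hB]. exists B; split; [|intros M hM; apply hB; auto].
  intros M hM; destruct (hB M hM) as [h1 [h2 _]]; auto.
Qed.

Lemma homog_pick m N K B X W T : finl E m N -> asg N K B -> (forall M, Occ E N K M -> iso E X (B M)) ->
  iso E (repl N (Occ E N K) B) W -> strong E W T -> ksib E K T -> iso E X T.
Proof.
  intros hf hB hX hW hT hK. apply iso_sym in hW. destruct hW as [phi hphi].
  assert (hi : iso E T (img phi T)).
  { apply iso_img with (repl N (Occ E N K) B). apply emb_restrict with W (repl N (Occ E N K) B); [apply hphi | apply (strong_sub hT)|].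
    intros x hx; apply (emb_in (proj1 hphi)), (strong_sub hT); auto. }
  destruct (@occ_complete m N K B (img phi T)) as [M [hM e]]; auto.
  - apply strong_img with W; auto.
  - apply ksib_trans with T; auto. apply iso_ksib; auto.
  - apply iso_trans with (B M); auto. rewrite <- e. apply iso_sym; auto.
Qed.

(** The choice is arbitrary; after a homogeneous replacement all modules of the type of [K] are
    isomorphic. *)
Definition pick K (W : set U) : set U :=
  epsilon (inhabits (fun _ => True)) (fun T => strong E W T /\ ksib E K T).

Lemma pick_iso m N K B X W : finl E m N -> strong E N K -> asg N K B ->
  (forall M, Occ E N K M -> iso E X (B M)) -> iso E (repl N (Occ E N K) B) W -> iso E X (pick K W).
Proof.
  intros hf hK hB hX hW.
  assert (hO : Occ E N K K) by (split; auto using ksib_refl).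
  assert (hp : strong E W (pick K W) /\ ksib E K (pick K W)).
  { unfold pick. apply epsilon_spec. destruct hW as [phi hphi]. exists (img phi (B K)).
    assert (hs := occ_strong hf hB hO). split.
    - apply strong_img with (repl N (Occ E N K) B); auto.
    - apply ksib_trans with (B K); [apply (hB K hO)|]. apply iso_ksib.
      apply iso_img with W. apply emb_restrict with (repl N (Occ E N K) B) W; [apply hphi | apply (strong_sub hs)|].
      intros x hx; apply (emb_in (proj1 hphi)), (strong_sub hs); auto. }
  destruct hp as [h1 h2]. apply (homog_pick hf hB hX hW h1 h2).
Qed.

(** [pick] recovers [X] from the sibling of [N] obtained by putting [X] at all occurrences, so
    non-isomorphic siblings of [K] give non-isomorphic siblings of [N]. *)
Lemma finl_strong m N K : finl E m N -> strong E N K -> finl E m K.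
Proof.
  intros hf hK. assert (hf' := hf). destruct hf' as [l [hl1 hl2]].
  exists (map (pick K) l); split; [rewrite length_map; auto|].
  intros X hX. destruct (homog_asg N hX) as [B [hB hBX]].
  destruct (hl2 (repl N (Occ E N K) B)) as [W [hW1 hW2]].
  - apply repl_ksib; auto. eapply asg_replable; eauto.
  - exists (pick K W); split; [apply in_map; auto|]. eapply pick_iso; eauto.
Qed.

Lemma filter_lt (T : Type) (f : T -> bool) l x : In x l -> f x = false -> length (filter f l) < length l.
Proof.
  induction l as [|y l IH]; simpl; [tauto|]. intros [->|h] hx.
  - rewrite hx. pose proof (filter_length_le f l). lia.
  - specialize (IH h hx). destruct (f y); simpl; lia.
Qed.

Definition smaller m := forall m' A, m' < m -> finl E m' A -> uniq E A.

(** If [Z] were not obtained in this way, its type would be missed by all the graphs made from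
    siblings of [K]. Then [K] would have fewer than [m] siblings and would be unique. *)
Lemma step_every m N K Z : smaller m -> finl E m N -> strong E N K -> ~ uniq E K -> ksib E N Z ->
  exists B X, asg N K B /\ (forall M, Occ E N K M -> iso E X (B M)) /\ iso E Z (repl N (Occ E N K) B).
Proof.
  intros hIH hf hK hnu hZ. apply NNPP; intros hno. apply hnu.
  assert (hf' := hf). destruct hf' as [l [hl1 hl2]].
  destruct (hl2 Z hZ) as [W0 [hW0 hZW0]].
  set (f := fun W => if excluded_middle_informative (iso E Z W) then false else true).
  assert (hf0 : f W0 = false) by (unfold f; destruct (excluded_middle_informative (iso E Z W0)); tauto).
  pose proof (filter_lt hW0 hf0) as hlt.
  apply (hIH (length (filter f l))); [lia|].
  exists (map (pick K) (filter f l)); split; [rewrite length_map; auto|].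
  intros X hX. destruct (homog_asg N hX) as [B [hB hBX]].
  destruct (hl2 (repl N (Occ E N K) B)) as [W [hW1 hW2]].
  - apply repl_ksib; auto. eapply asg_replable; eauto.
  - exists (pick K W); split; [|eapply pick_iso; eauto].
    apply in_map, filter_In; split; auto. unfold f.
    destruct (excluded_middle_informative (iso E Z W)) as [h|h]; auto.
    exfalso; apply hno. exists B, X; split; auto; split; auto.
    apply iso_trans with W; auto. apply iso_sym; auto.
Qed.

Lemma not_uniq_ex K : ~ uniq E K -> exists X, ksib E K X /\ ~ iso E K X.
Proof.
  intros h. apply not_all_ex_not in h. destruct h as [X h]. apply imply_to_and in h. eauto.
Qed.

(** Given a second occurrence [M], one can keep [K] and put a non-isomorphic sibling at [M]. By
    [step_every] the result is also a homogeneous replacement, which makes the two pieces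
    isomorphic. *)
Lemma step_single m N K M : smaller m -> finl E m N -> strong E N K -> ~ uniq E K -> Occ E N K M -> M = K.
Proof.
  intros hIH hf hK hnu hM. apply NNPP; intros hne.
  destruct (not_uniq_ex hnu) as [X [hX hKX]].
  destruct (homog_asg N hX) as [B0 [hB0 hBX]].
  set (B := fun T => if excluded_middle_informative (T = K) then K else B0 T).
  assert (hB : asg N K B).
  { intros T hT. unfold B. destruct (excluded_middle_informative (T = K)) as [->|h]; auto.
    split; [intros x; auto | apply ksib_refl]. }
  assert (hO : Occ E N K K) by (split; auto using ksib_refl).
  destruct (@step_every m N K (repl N (Occ E N K) B)) as [B' [X' [h1 [h2 h3]]]]; auto.
  { apply repl_ksib; auto. eapply asg_replable; eauto. }
  apply iso_sym in h3.
  assert (ht : forall T, Occ E N K T -> iso E X' (B T)).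
  { intros T hT. apply (homog_pick hf h1 h2 h3); [eapply occ_strong; eauto | apply (hB T hT)]. }
  assert (e1 : B K = K) by (unfold B; destruct (excluded_middle_informative (K = K)); tauto).
  assert (e2 : B M = B0 M) by (unfold B; destruct (excluded_middle_informative (M = K)); tauto).
  apply hKX. apply iso_trans with X'.
  - apply iso_sym. rewrite <- e1. auto.
  - apply iso_trans with (B M); auto. rewrite e2. apply iso_sym; auto.
Qed.

Definition diff (A K : set U) : set U := fun z => A z /\ ~ K z.

Record cut (N K Y K' : set U) (th : U -> U) : Prop := {
  cut_sub : sub K N;
  cut_sub' : sub K' Y;
  cut_iso : isof E th (diff N K) (diff Y K');
  cut_lab : forall z x x', N z -> ~ K z -> K x -> K' x' -> (E z x <-> E (th z) x')
}.

(** As [K] is the only module that gets replaced, the isomorphism from the reduced graph to [Y]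
    restricts to the complement of [K]. The uniqueness of [K'] is pulled back to the reduced graph
    and settled by [occ_complete]. *)
Lemma step_cut m N K Y : smaller m -> finl E m N -> strong E N K -> ~ uniq E K -> ksib E N Y ->
  exists K' th, Occ E Y K K' /\ (forall T, Occ E Y K T -> T = K') /\ cut N K Y K' th.
Proof.
  intros hIH hf hK hnu hY.
  assert (hO : Occ E N K K) by (split; auto using ksib_refl).
  destruct (@step_every m N K Y) as [B [X [h1 [h2 h3]]]]; auto.
  apply iso_sym in h3. destruct h3 as [psi hpsi].
  set (R := repl N (Occ E N K) B) in *.
  assert (hRd : forall z, N z -> ~ K z -> R z).
  { intros z hz hnz. split; auto. intros M hM hMz. exfalso; apply hnz.
    rewrite <- (step_single hIH hf hK hnu hM); auto. }
  assert (hRB : forall z, R z -> K z -> B K z) by (intros z hz hKz; apply hz; auto).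
  assert (hs := occ_strong hf h1 hO). fold R in hs.
  destruct (h1 K hO) as [hBs hBk].
  assert (hi : iso E (B K) (img psi (B K))).
  { apply iso_img with Y. apply emb_restrict with R Y; [apply hpsi | apply (strong_sub hs)|].
    intros x hx; apply (emb_in (proj1 hpsi)), (strong_sub hs); auto. }
  assert (hs' : strong E Y (img psi (B K))) by (apply strong_img with R; auto).
  assert (hnimg : forall z, N z -> ~ K z -> ~ img psi (B K) (psi z)).
  { intros z hz hnz [x [hx e]]. apply hnz. apply (emb_inj (proj1 hpsi)) in e.
    - subst; auto.
    - apply (strong_sub hs); auto.
    - apply hRd; auto. }
  exists (img psi (B K)), psi. split; [|split].
  - split; auto. apply ksib_trans with (B K); auto. apply iso_ksib; auto.
  - intros T [hT hKT]. pose proof (isof_inv hpsi) as hq.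
    assert (hiT : iso E T (img (inv psi R) T)).
    { apply iso_img with R. apply emb_restrict with Y R; [apply hq | apply (strong_sub hT)|].
      intros x hx; apply (emb_in (proj1 hq)), (strong_sub hT); auto. }
    destruct (@occ_complete m N K B (img (inv psi R) T)) as [M [hM e]]; auto.
    + apply strong_img with Y; auto.
    + apply ksib_trans with T; auto. apply iso_ksib; auto.
    + rewrite (step_single hIH hf hK hnu hM) in e. rewrite <- e.
      apply set_ext; intros z; split.
      * intros hz. exists (inv psi R z). split; [exists z; auto|]. apply (isof_inv_r hpsi), (strong_sub hT); auto.
      * intros [y [[z' [hz' <-]] <-]]. rewrite (isof_inv_r hpsi); auto. apply (strong_sub hT); auto.
  - split.
    + apply (strong_sub hK).
    + apply (strong_sub hs').
    + split.
      * apply emb_restrict with R Y; [apply hpsi | intros z [hz hnz]; auto |].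
        intros z [hz hnz]. split; auto. apply (emb_in (proj1 hpsi)); auto.
      * intros y [hy hny]. destruct (proj2 hpsi y hy) as [z [hz <-]]. exists z; split; auto.
        split; [apply hz|]. intros h. apply hny. exists z; auto.
    + intros z x x' hz hnz hx hx'. destruct (strong_ne hs) as [b hb].
      assert (hRz : R z) by auto. assert (hRb : R b) by (apply (strong_sub hs); auto).
      assert (hYz : Y (psi z)) by (apply (emb_in (proj1 hpsi)); auto).
      assert (hpb : img psi (B K) (psi b)) by (exists b; auto).
      assert (t1 : E z x <-> E z b).
      { destruct (strong_mod hK) as [_ hm]. split; intros h; [apply (hm z x b) | apply (hm z b x)]; auto. }
      assert (t2 : E (psi z) (psi b) <-> E (psi z) x').
      { destruct (strong_mod hs') as [_ hm]. split; intros h; [apply (hm (psi z) (psi b) x') | apply (hm (psi z) x' (psi b))]; auto. }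
      rewrite t1, (emb_adj (proj1 hpsi)), t2; auto. tauto.
Qed.

Definition glue (K : set U) (f g : U -> U) z := if excluded_middle_informative (K z) then f z else g z.

Lemma glue_in K f g z : K z -> glue K f g z = f z.
Proof. unfold glue; destruct (excluded_middle_informative (K z)); tauto. Qed.
Lemma glue_out K f g z : ~ K z -> glue K f g z = g z.
Proof. unfold glue; destruct (excluded_middle_informative (K z)); tauto. Qed.

Lemma glue_emb N K Y K' th f : cut N K Y K' th -> emb E f K K' -> emb E (glue K f th) N Y.
Proof.
  intros hc hf. destruct (cut_iso hc) as [ht _].
  assert (hd : forall z, N z -> ~ K z -> diff Y K' (th z)) by (intros z h1 h2; apply ht; split; auto).
  split.
  - intros z hz. destruct (classic (K z)) as [h|h]; [rewrite glue_in | rewrite glue_out]; auto.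
    + apply (cut_sub' hc), hf; auto.
    + apply hd; auto.
  - intros x y hx hy. destruct (classic (K x)) as [h1|h1]; destruct (classic (K y)) as [h2|h2];
      rewrite ?(glue_in _ _ h1), ?(glue_in _ _ h2), ?(glue_out _ _ h1), ?(glue_out _ _ h2); intros e.
    + apply (emb_inj hf); auto.
    + exfalso. apply (hd y hy h2). rewrite <- e. apply hf; auto.
    + exfalso. apply (hd x hx h1). rewrite e. apply hf; auto.
    + apply (emb_inj ht); auto; split; auto.
  - intros x y hx hy. destruct (classic (K x)) as [h1|h1]; destruct (classic (K y)) as [h2|h2];
      rewrite ?(glue_in _ _ h1), ?(glue_in _ _ h2), ?(glue_out _ _ h1), ?(glue_out _ _ h2).
    + apply (emb_adj hf); auto.
    + assert (h := cut_lab hc hy h2 h1 (emb_in hf h1)).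
      split; intros h'; apply (cog_sym hE), h, (cog_sym hE); auto.
    + apply (cut_lab hc); auto. apply hf; auto.
    + apply (emb_adj ht); split; auto.
Qed.

Lemma glue_iso N K Y K' th f : cut N K Y K' th -> isof E f K K' -> isof E (glue K f th) N Y.
Proof.
  intros hc [hf hs]. split; [eapply glue_emb; eauto|].
  intros y hy. destruct (classic (K' y)) as [h|h].
  - destruct (hs y h) as [x [hx <-]]. exists x; split; [apply (cut_sub hc); auto | apply glue_in; auto].
  - destruct (proj2 (cut_iso hc) y) as [x [[hx hnx] <-]]; [split; auto|].
    exists x; split; auto. apply glue_out; auto.
Qed.

Lemma cut_sym N K Y K' th : cut N K Y K' th -> (exists x, K x) -> (exists x, K' x) ->
  cut Y K' N K (inv th (diff N K)).
Proof.
  intros hc [k hk] [k' hk']. assert (hi := isof_inv (cut_iso hc)). split; try apply hc; auto.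
  intros z x x' hz hnz hx hx'.
  assert (h : diff N K (inv th (diff N K) z)) by (apply (emb_in (proj1 hi)); split; auto).
  rewrite (cut_lab hc (x:=x') (x':=x)); auto; try apply h.
  rewrite (isof_inv_r (cut_iso hc)); [tauto | split; auto].
Qed.

(** Replace all occurrences of [K] by a sibling [X] not isomorphic to it. Were the result isomorphic
    to [C], the module [K] would be found in it and be isomorphic to [X]. *)
Lemma nonuniq_up m C K : finl E m C -> strong E C K -> ~ uniq E K -> ~ uniq E C.
Proof.
  intros hf hK hnu hu. destruct (not_uniq_ex hnu) as [X [hX hKX]].
  destruct (homog_asg C hX) as [B [hB hBX]].
  assert (hk : ksib E C (repl C (Occ E C K) B)) by (apply repl_ksib; auto; eapply asg_replable; eauto).
  apply hKX, iso_sym. apply (homog_pick hf hB hBX (iso_sym (hu _ hk)) hK). apply ksib_refl.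
Qed.
End Occurrences.

Lemma infinite_seq (T : Type) (P : T -> Prop) (R : T -> T -> Prop) :
  (forall l, exists y, P y /\ forall a, In a l -> ~ R a y) ->
  exists s : nat -> T, (forall n, P (s n)) /\ forall i j, i < j -> ~ R (s i) (s j).
Proof.
  intros h. apply choice in h. destruct h as [F hF].
  set (pre := fun n => Nat.iter n (fun l => F l :: l) nil).
  assert (hp : forall i j, i < j -> In (F (pre i)) (pre j)).
  { intros i j hij. induction hij as [|j hij IH]; [left; auto | right; auto]. }
  exists (fun n => F (pre n)). split; [intros n; apply hF|].
  intros i j hij. apply hF. auto.
Qed.

(** * Disconnected graphs *)

Lemma emb_comp_set U (E : U -> U -> Prop) f (A B : set U) x :
  emb E f A B -> A x -> emb E f (comp E A x) (comp E B (f x)).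
Proof.
  intros hf hx. apply emb_restrict with A B; auto; [intros z hz; apply hz|].
  intros z [hz hn]. split; [apply (emb_in hf); auto | apply (emb_near hf); auto].
Qed.

Lemma isof_comp_set U (E : U -> U -> Prop) f (A B : set U) x :
  isof E f A B -> A x -> isof E f (comp E A x) (comp E B (f x)).
Proof.
  intros hf hx. split; [apply emb_comp_set; auto; apply hf|].
  intros y [hy hn]. destruct (proj2 hf y hy) as [z [hz <-]]. exists z; split; auto.
  split; auto. apply (isof_near hf); auto.
Qed.

(** By [strong_sep] the image of the component of [x] lies in a strong module that misses [h y], so
    the component of [h x] would embed into a properly smaller strong module. *)
Lemma far_sep U (E : U -> U -> Prop) (hE : cog E) (A B : set U) h x y :
  nonest E B -> emb E h A B -> A x -> A y -> ~ near E A x y -> near E B (h x) (h y) ->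
  le E (comp E B (h x)) (comp E A x) -> False.
Proof.
  intros hn hh hx hy hxy hnear hle.
  assert (hBx : B (h x)) by (apply (emb_in hh); auto).
  assert (hc := emb_comp_set hh hx).
  assert (hyc : ~ comp E A x y) by (intros [_ h0]; auto).
  destruct (@strong_sep U E hE (comp E B (h x)) (img h (comp E A x)) (h y) (h x)) as [M [hM [h1 h2]]].
  - apply img_sub with E; auto.
  - apply (isof_conn (isof_img hc)). apply comp_conn; auto.
  - exists x; split; auto using comp_self.
  - split; auto. apply (emb_in hh); auto.
  - intros [z [hz e]]. apply (emb_inj hh) in e; auto; [subst; auto | apply hz].
  - intros w [z [hz <-]] he. apply (emb_neg hh) in he; auto; [|apply hz].
    apply (comp_nonadj hE hx hy hz hyc). apply (cog_sym hE); auto.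
  - assert (hs := strong_comp hE hBx).
    apply h2. apply (hn M (comp E B (h x))); auto.
    + apply (strong_trans hE hs hM).
    + apply (strong_sub hM).
    + apply le_trans with (comp E A x); auto. exists h.
      apply emb_restrict with A B; auto; [intros z hz; apply hz | intros z hz; apply h1; exists z; auto].
    + split; auto. apply (emb_in hh); auto.
Qed.

(** If the orbit never returns to the component of [x], its points lie in pairwise different
    components. Applying [g] only on the components of the orbit, and the identity elsewhere,
    vacates the component of [x]. *)
Lemma orbit_cycle U (E : U -> U -> Prop) (hE : cog E) (A : set U) g x :
  nonest E A -> emb E g A A -> A x ->
  (exists r, near E A (it (S r) g x) x) \/
  (exists g', emb E g' A A /\ forall z, A z -> ~ comp E A x (g' z)).
Proof.
  intros hn hg hx. destruct (classic (exists r, near E A (it (S r) g x) x)) as [h|hno]; auto. right.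
  assert (hA : forall n, A (it n g x)) by (intros n; apply (emb_in (emb_iter n hg)); auto).
  assert (hfar : forall i j, i < j -> ~ near E A (it i g x) (it j g x)).
  { induction i as [|i IH]; intros j hij h.
    - apply hno. exists (j - 1). replace (S (j - 1)) with j by lia. apply near_sym; auto.
    - destruct j as [|j]; [lia|].
      apply (@far_sep U E hE A A g (it j g x) (it i g x)); auto.
      + intros h'. apply (IH j); [lia | apply near_sym; auto].
      + apply near_sym; auto.
      + change (g (it j g x)) with (it (S j) g x). rewrite <- (comp_eq hE (hA _) (hA _) h).
        exists (fun z => it (j - S i) g z).
        replace (it j g x) with (it (j - S i) g (it (S i) g x)).
        * apply (emb_comp_set (emb_iter (j - S i) hg)); auto.
        * rewrite <- iter_add. replace (j - S i + S i) with j by lia. auto. }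
  set (O := fun z => exists n, near E A (it n g x) z).
  assert (hO : forall z, A z -> O z -> O (g z)).
  { intros z hz [n h]. exists (S n). exact (emb_near hg (hA n) hz h). }
  assert (hsep : forall z z', A z -> A z' -> O z -> near E A z z' -> O z').
  { intros z z' hz hz' [n h] h'. exists n. apply (near_trans hE) with z; auto. }
  exists (fun z => if excluded_middle_informative (O z) then g z else z). split; [split|].
  - intros z hz. destruct (excluded_middle_informative (O z)); auto. apply (emb_in hg); auto.
  - intros z z' hz hz'.
    destruct (excluded_middle_informative (O z)) as [h1|h1];
      destruct (excluded_middle_informative (O z')) as [h2|h2]; intros e; auto.
    + apply (emb_inj hg); auto.
    + exfalso; apply h2. rewrite <- e. auto.
    + exfalso; apply h1. rewrite e. auto.
  - assert (hx' : forall z z', A z -> A z' -> O z -> ~ O z' -> ~ E z z').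
    { intros z z' hz hz' h1 h2 h. apply h2. apply (hsep z z'); auto. right; left; auto. }
    assert (hgA : forall z, A z -> A (g z)) by (intros z hz; apply (emb_in hg); auto).
    intros z z' hz hz'.
    destruct (excluded_middle_informative (O z)) as [h1|h1];
      destruct (excluded_middle_informative (O z')) as [h2|h2].
    + apply (emb_adj hg); auto.
    + split; intros h; exfalso; [apply (hx' z z') | apply (hx' (g z) z')]; auto.
    + split; intros h; exfalso; [apply (hx' z' z) | apply (hx' (g z') z)]; auto; apply (cog_sym hE); auto.
    + tauto.
  - intros z hz [_ h]. destruct (excluded_middle_informative (O z)) as [[n h1]|h1].
    + apply (hfar 0 (S n)); [lia|]. apply near_sym; auto.
      apply (near_trans hE (y:=g z)); auto; [apply (emb_in hg); auto |..].
      * exact (emb_near hg (hA n) hz h1).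
      * apply near_sym; auto.
    + apply h1. exists 0. auto.
Qed.

(** * Adding components of a given type *)

Section Absorb.
Variables (U : Type) (E : U -> U -> Prop) (hE : cog E).
Variables (A K : set U) (g : U -> U) (k0 : U).
Hypotheses (hg : emb E g A A) (hKA : sub K A) (hKc : conn E K) (hk0 : K k0).
Hypotheses (hdis : forall z w, A z -> K w -> g z <> w /\ ~ E (g z) w).

(** [K] becomes a component beside a copy of [X]. *)
Definition grow (X : set U) : set U := fun y => K y \/ img g X y.

Lemma grow_sub X : sub X A -> sub (grow X) A.
Proof.
  intros hX y [hy|[z [hz <-]]]; [apply hKA; auto | apply (emb_in hg), hX; auto].
Qed.

Lemma grow_near_in X w y : sub X A -> K w -> grow X y -> near E (grow X) w y -> K y.
Proof.
  intros hX hw.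
  assert (hst : forall a b, K a -> grow X b -> E a b -> K b).
  { intros a b ha [hb|[z [hz <-]]] he; auto. exfalso.
    apply (proj2 (hdis (hX z hz) ha)). apply (cog_sym hE); auto. }
  intros hy [->|[h|[u [hu [h1 h2]]]]]; auto; [apply (hst w y); auto|].
  apply (hst u y); auto. apply (hst w u); auto.
Qed.

Lemma grow_near_out X z y : sub X A -> X z -> grow X y -> near E (grow X) (g z) y ->
  exists z', X z' /\ g z' = y /\ near E X z z'.
Proof.
  intros hX hz hy hn.
  assert (hout : ~ K y).
  { intros h. apply near_sym in hn; auto.
    assert (h1 : K (g z)) by (apply (@grow_near_in X y); auto; right; exists z; auto).
    exact (proj1 (hdis (hX z hz) h1) eq_refl). }
  destruct hy as [hy|[z' [hz' <-]]]; [tauto|]. exists z'; split; auto; split; auto.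
  destruct hn as [e|[h|[u [hu [h1 h2]]]]].
  - left. apply (emb_inj hg); auto.
  - right; left. apply (emb_neg hg) in h; auto.
  - destruct hu as [hu|[u' [hu' <-]]].
    + exfalso. exact (proj2 (hdis (hX z hz) hu) h1).
    + right; right. exists u'; split; auto. split; [apply (emb_neg hg) in h1 | apply (emb_neg hg) in h2]; auto.
Qed.

Lemma grow_comp_in X w : sub X A -> K w -> comp E (grow X) w = K.
Proof.
  intros hX hw. apply set_ext; intros y; split.
  - intros [hy h]. apply (grow_near_in hX hw hy h).
  - intros hy. split; [left; auto|]. apply near_sub with K; [intros u hu; left; auto | apply hKc; auto].
Qed.

Lemma grow_comp_out X z : sub X A -> X z -> iso E (comp E X z) (comp E (grow X) (g z)).
Proof.
  intros hX hz. exists g. split.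
  - apply emb_comp_set; auto. apply emb_restrict with A A; auto. intros x hx; right; exists x; auto.
  - intros y [hy h]. destruct (grow_near_out hX hz hy h) as [z' [h1 [h2 h3]]]. exists z'; split; auto. split; auto.
Qed.

(** [cover] bounds the number of components equimorphic to [K] from above by the length of [l], and
    [points] bounds it from below by [n]. *)
Definition cover X l := forall y, X y -> eqm E (comp E X y) K -> exists a, In a l /\ X a /\ near E X a y.
Definition points X n := exists f : nat -> U, forall i, i < n ->
  X (f i) /\ eqm E (comp E X (f i)) K /\ forall j, j < i -> ~ near E X (f j) (f i).

Lemma cover_iso X W l : cover X l -> iso E X W -> exists l', length l' = length l /\ cover W l'.
Proof.
  intros hl [phi hphi]. exists (map phi l); split; [apply length_map|].
  intros y hy he. destruct (proj2 hphi y hy) as [z [hz <-]].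
  destruct (hl z hz) as [a [h1 [h2 h3]]].
  - apply eqm_trans with (comp E W (phi z)); auto. apply iso_eqm. exists phi. apply isof_comp_set; auto.
  - exists (phi a). split; [apply in_map; auto|]. split; [apply (emb_in (proj1 hphi)); auto|].
    apply (emb_near (proj1 hphi)); auto.
Qed.

Lemma cover_grow X l : sub X A -> cover X l -> cover (grow X) (k0 :: map g l).
Proof.
  intros hX hl y [hy|[z [hz <-]]] he.
  - exists k0. split; [left; auto|]. split; [left; auto|].
    apply near_sub with K; [intros u hu; left; auto | apply hKc; auto].
  - destruct (hl z hz) as [a [h1 [h2 h3]]].
    + apply eqm_trans with (comp E (grow X) (g z)); auto. apply iso_eqm, grow_comp_out; auto.
    + exists (g a). split; [right; apply in_map; auto|]. split; [right; exists a; auto|].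
      apply emb_near with X; auto. apply emb_restrict with A A; auto. intros x hx; right; exists x; auto.
Qed.

Lemma points_grow X n : sub X A -> points X n -> points (grow X) (S n).
Proof.
  intros hX [f hf]. exists (fun i => match i with 0 => k0 | S i => g (f i) end).
  intros [|i] hi.
  - split; [left; auto|]. split; [|intros j hj; lia].
    rewrite grow_comp_in; auto. apply eqm_refl.
  - destruct (hf i) as [h1 [h2 h3]]; [lia|].
    assert (hgi : grow X (g (f i))) by (right; exists (f i); auto).
    split; auto. split.
    + apply eqm_trans with (comp E X (f i)); auto. apply eqm_sym, iso_eqm, grow_comp_out; auto.
    + intros [|j] hj h.
      * assert (h4 := grow_near_in hX hk0 hgi h). exact (proj1 (hdis (hX _ h1) h4) eq_refl).
      * destruct (hf j) as [h4 _]; [lia|].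
        destruct (grow_near_out hX h4 hgi h) as [z' [h5 [h6 h7]]].
        apply (emb_inj hg) in h6; auto. subst z'. apply (h3 j); auto; lia.
Qed.

Lemma points_cover X n l : points X n -> cover X l -> n <= length l.
Proof.
  intros [f hf] hl.
  assert (h : forall i, exists a, i < n -> In a l /\ X a /\ near E X a (f i)).
  { intros i. destruct (classic (i < n)) as [hi|hi]; [|exists k0; tauto].
    destruct (hf i hi) as [h1 [h2 _]]. destruct (hl _ h1 h2) as [a ha]; exists a; auto. }
  apply choice in h. destruct h as [a ha].
  assert (hinj : forall i j, i < n -> j < n -> i < j -> a i <> a j).
  { intros i j hi hj hij e. destruct (hf j hj) as [h1 [_ h2]]. apply (h2 i hij).
    destruct (ha i hi) as [_ [h3 h4]]. destruct (ha j hj) as [_ [h5 h6]].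
    apply (near_trans hE) with (a i); auto; [apply (hf i hi) | apply near_sym; auto | rewrite e; auto]. }
  rewrite <- (length_seq n 0), <- (length_map a).
  apply NoDup_incl_length.
  - apply Injective_map_NoDup_in; [|apply seq_NoDup].
    intros i j hi hj e. apply in_seq in hi, hj.
    destruct (lt_eq_lt_dec i j) as [[h|h]|h]; auto; exfalso;
      [apply (hinj i j) | apply (hinj j i)]; auto; lia.
  - intros y hy. apply in_map_iff in hy. destruct hy as [i [<- hi]]. apply in_seq in hi. apply ha; lia.
Qed.

Definition tower n := Nat.iter n grow A.

Lemma tower_sub n : sub (tower n) A.
Proof. induction n; [intros x; auto | apply grow_sub; auto]. Qed.

Lemma tower_ksib n : ~ conn E A -> ksib E A (tower n).
Proof.
  intros hd.
  assert (hle : forall n, le E A (tower n)).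
  { induction n0 as [|j IH]; [apply le_refl|]. apply le_trans with (tower j); auto.
    exists g. apply emb_restrict with A A; auto; [apply tower_sub | intros x hx; right; exists x; auto]. }
  assert (hd' : ~ conn E (tower n)).
  { destruct n as [|n]; auto. intros hc.
    assert (hne : exists x, tower n x).
    { destruct (hle n) as [f hf]. exists (f k0). apply (emb_in hf); auto. }
    destruct hne as [x hx].
    assert (hgx : tower (S n) (g x)) by (right; exists x; auto).
    assert (h1 : K (g x)).
    { apply (@grow_near_in (tower n) k0); auto; [apply tower_sub|]. apply hc; auto. left; auto. }
    exact (proj1 (hdis (tower_sub hx) h1) eq_refl). }
  split.
  - split; auto. apply le_sub, tower_sub.
  - tauto.
  - split; intros _; apply disc_coconn; auto.
Qed.

(** Otherwise every [tower n] has finitely many components of this type, but at least [n] of them.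
    The towers are siblings of [A], and finitely many isomorphism types would bound these
    numbers. *)
Lemma absorb_seq m l : finl E m A -> ~ conn E A ->
  exists y, (A y /\ eqm E (comp E A y) K) /\ forall a, In a l -> A a -> ~ near E A a y.
Proof.
  intros [L [_ hL]] hd. apply NNPP; intros hno.
  assert (hc : forall n, exists l', cover (tower n) l').
  { induction n as [|n [l' IH]].
    - exists l. intros y hy he. apply NNPP; intros h. apply hno. exists y; split; auto.
      intros a ha hA hn. apply h; exists a; auto.
    - exists (k0 :: map g l'). apply cover_grow; auto. apply tower_sub. }
  assert (hb : exists b, forall W, In W L -> (exists n, iso E (tower n) W) -> exists l', length l' <= b /\ cover W l').
  { clear hL. induction L as [|W L [b IH]]; [exists 0; simpl; tauto|].
    destruct (classic (exists n, iso E (tower n) W)) as [[n hn]|hn].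
    - destruct (hc n) as [l1 h1]. destruct (cover_iso h1 hn) as [l2 [h2 h3]].
      exists (b + length l2). intros W' [<-|hW'] h; [exists l2; split; auto; lia|].
      destruct (IH W' hW' h) as [l3 [h4 h5]]. exists l3; split; auto; lia.
    - exists b. intros W' [<-|hW'] h; auto; tauto. }
  destruct hb as [b hb].
  assert (hp : forall n, points (tower n) n).
  { induction n as [|n IH]; [exists (fun _ => k0); intros i hi; lia|]. apply points_grow; auto. apply tower_sub. }
  destruct (hL (tower (S b)) (tower_ksib (S b) hd)) as [W [h1 h2]].
  destruct (hb W h1) as [l1 [h3 h4]]; [exists (S b); auto|].
  destruct (cover_iso h4 (iso_sym h2)) as [l2 [h5 h6]].
  assert (h7 := points_cover (hp (S b)) h6). lia.
Qed.
End Absorb.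

Definition big {U} (E : U -> U -> Prop) (A K : set U) := forall l, exists y,
  (A y /\ eqm E (comp E A y) K) /\ forall a, In a l -> A a -> ~ near E A a y.

(** The bijection is recorded to be [j1] or an inverse of [j2] at each point, so that it keeps
    equimorphy types when both maps do. *)
Lemma cantor_bernstein U (P Q : set U) (j1 j2 : U -> U) :
  (forall x, P x -> Q (j1 x)) -> (forall x, Q x -> P (j2 x)) ->
  (forall x y, P x -> P y -> j1 x = j1 y -> x = y) ->
  (forall x y, Q x -> Q y -> j2 x = j2 y -> x = y) ->
  exists b, (forall x, P x -> Q (b x) /\ (b x = j1 x \/ j2 (b x) = x)) /\
    (forall x y, P x -> P y -> b x = b y -> x = y) /\ (forall y, Q y -> exists x, P x /\ b x = y).
Proof.
  intros h1 h2 i1 i2.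
  set (C := fun x => exists n z, P z /\ ~ (exists y, Q y /\ j2 y = z) /\ x = it n (fun z => j2 (j1 z)) z).
  assert (hC : forall x, C x -> C (j2 (j1 x))).
  { intros x [n [z [a1 [a2 ->]]]]. exists (S n), z. auto. }
  assert (hCi : forall y, Q y -> C (j2 y) -> exists x, P x /\ C x /\ j1 x = y).
  { intros y hy [n [z [a1 [a2 e]]]]. destruct n as [|n].
    - exfalso. apply a2. exists y; auto.
    - simpl in e.
      assert (hP : P (it n (fun z => j2 (j1 z)) z)) by (clear e; induction n; simpl; auto).
      apply i2 in e; auto. exists (it n (fun z => j2 (j1 z)) z). split; auto. split; auto. exists n, z; auto. }
  assert (hnC : forall x, P x -> ~ C x -> exists y, Q y /\ j2 y = x).
  { intros x hx hn. apply NNPP; intros h. apply hn. exists 0, x. auto. }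
  set (b := fun x => if excluded_middle_informative (C x) then j1 x
                     else epsilon (inhabits x) (fun y => Q y /\ j2 y = x)).
  assert (b1 : forall x, C x -> b x = j1 x).
  { intros x hx. unfold b. destruct (excluded_middle_informative (C x)); tauto. }
  assert (b2 : forall x, P x -> ~ C x -> Q (b x) /\ j2 (b x) = x).
  { intros x hx hn. unfold b. destruct (excluded_middle_informative (C x)); [tauto|].
    apply epsilon_spec. auto. }
  exists b. split; [|split].
  - intros x hx. destruct (classic (C x)) as [h|h]; [rewrite b1; auto|].
    destruct (b2 x hx h); auto.
  - assert (hmix : forall x y, P x -> P y -> C x -> ~ C y -> b x <> b y).
    { intros x y hx hy hcx hcy e. apply hcy. destruct (b2 y hy hcy) as [_ <-]. rewrite <- e, b1; auto. }
    intros x y hx hy e. destruct (classic (C x)) as [hcx|hcx]; destruct (classic (C y)) as [hcy|hcy].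
    + rewrite !b1 in e; auto.
    + exfalso. apply (hmix x y); auto.
    + exfalso. apply (hmix y x); auto.
    + destruct (b2 x hx hcx) as [_ <-]. destruct (b2 y hy hcy) as [_ <-]. rewrite e; auto.
  - intros y hy. destruct (classic (C (j2 y))) as [h|h].
    + destruct (hCi y hy h) as [x [a1 [a2 a3]]]. exists x; split; auto. rewrite b1; auto.
    + exists (j2 y); split; auto. destruct (b2 (j2 y)) as [a1 a2]; auto.
Qed.

Lemma big_eqm U (E : U -> U -> Prop) (B K K' : set U) : eqm E K K' -> big E B K -> big E B K'.
Proof.
  intros he hb l. destruct (hb l) as [y [[h1 h2] h3]]. exists y; split; auto. split; auto.
  apply eqm_trans with K; auto.
Qed.

(** Apply [orbit_cycle] to [h] after [f]. If the orbit of [x] returns, the component of [f x] embeds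
    back into that of [x]. If not, a self-embedding of [A] vacates the component of [x], and
    transported to [B] it allows copies to be added indefinitely. *)
Lemma big_or_eqm U (E : U -> U -> Prop) (hE : cog E) m (A B : set U) f h x :
  nonest E A -> finl E m B -> ~ conn E B -> emb E f A B -> emb E h B A -> A x ->
  eqm E (comp E B (f x)) (comp E A x) \/ big E B (comp E A x).
Proof.
  intros hn hfin hd hf hh hx. assert (hhf := emb_comp hf hh).
  assert (hc := emb_comp_set hf hx).
  destruct (orbit_cycle hE hn hhf hx) as [[r hr]|[g' [hg hav]]].
  - left. split; [|exists f; auto].
    assert (hx1 : A (h (f x))) by (apply (emb_in hhf); auto).
    assert (hit : emb E (fun z => it r (fun x => h (f x)) z) A A) by (apply emb_iter; auto).
    rewrite <- (@comp_eq U E hE A (it r (fun x => h (f x)) (h (f x))) x); auto.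
    + apply le_trans with (comp E A (h (f x))).
      * exists h. apply emb_comp_set; auto. apply (emb_in hf); auto.
      * eexists. apply (emb_comp_set hit); auto.
    + apply (emb_in hit); auto.
    + replace (it r (fun x => h (f x)) (h (f x))) with (it (S r) (fun x => h (f x)) x); auto.
      replace (S r) with (r + 1) by lia. rewrite iter_add. auto.
  - right. assert (hi : iso E (comp E A x) (img f (comp E A x))) by (eapply iso_img; eauto).
    apply big_eqm with (img f (comp E A x)); [apply eqm_sym, iso_eqm; auto|].
    intros l. apply (@absorb_seq U E hE B (img f (comp E A x)) (fun z => f (g' (h z))) (f x)) with (m := m); auto.
    + apply (emb_comp (f := fun z => g' (h z)) (B := A)); auto. apply (emb_comp hh hg).
    + intros w [v [hv <-]]. apply (emb_in hf), hv.
    + apply (iso_conn hi). apply comp_conn; auto.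
    + exists x; split; auto using comp_self.
    + intros z w hz [v [hv <-]].
      assert (hhz : A (h z)) by (apply (emb_in hh); auto).
      assert (hgz : A (g' (h z))) by (apply (emb_in hg); auto).
      assert (hno := hav _ hhz). assert (hvA : A v) by apply hv. split.
      * intros e. apply (emb_inj hf) in e; auto. apply hno. rewrite e; auto.
      * intros e. apply (emb_neg hf) in e; auto.
        apply (comp_nonadj hE hx hgz hv hno). apply (cog_sym hE); auto.
Qed.

(** * Matching the components of two siblings *)

Section Components.
Variables (U : Type) (E : U -> U -> Prop) (hE : cog E) (code : U -> nat) (hcode : injective code) (u0 : U).

(** The choice is made from the component as a set, hence it is the same for all its vertices. *)
Definition rep (A : set U) x := epsilon (inhabits u0) (comp E A x).
Definition spread (B K : set U) : nat -> U := epsilon (inhabits (fun _ : nat => u0)) (fun s =>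
  (forall n, B (s n) /\ eqm E (comp E B (s n)) K) /\ forall i j, i <> j -> ~ near E B (s i) (s j)).

Lemma rep_spec A x : A x -> comp E A x (rep A x).
Proof. intros hx. apply (epsilon_spec (inhabits u0) (comp E A x)). exists x; apply comp_self; auto. Qed.

Lemma rep_eq A x y : A x -> A y -> near E A x y -> rep A x = rep A y.
Proof. intros hx hy h. unfold rep. rewrite (comp_eq hE hx hy h); auto. Qed.

Lemma rep_near A x y : A x -> A y -> rep A x = rep A y -> near E A x y.
Proof.
  intros hx hy e. destruct (rep_spec hx) as [h1 h2]. destruct (rep_spec hy) as [h3 h4].
  apply (near_trans hE) with (rep A x); auto. rewrite e. apply near_sym; auto.
Qed.

Lemma spread_spec B K : big E B K ->
  (forall n, B (spread B K n) /\ eqm E (comp E B (spread B K n)) K) /\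
  forall i j, i <> j -> ~ near E B (spread B K i) (spread B K j).
Proof.
  intros hb. unfold spread. apply epsilon_spec.
  destruct (@infinite_seq U (fun y => B y /\ eqm E (comp E B y) K) (fun a y => B a /\ near E B a y))
    as [s [h1 h2]].
  { intros l. destruct (hb l) as [y [h3 h4]]. exists y; split; auto. intros a ha [h5 h6].
    apply (h4 a); auto. }
  exists s; split; auto. intros i j hij h.
  destruct (lt_eq_lt_dec i j) as [[h3|h3]|h3]; [apply (h2 i j) | | apply (h2 j i)]; auto.
  - split; auto. apply h1.
  - split; [apply h1 | apply near_sym; auto].
Qed.

(** A type with infinitely many components in [B] is served from [spread], indexed by the code of a
    representative. For the other types [f] itself keeps the type, and [far_sep] keeps different
    components apart. *)
Lemma comps_inj m m' A B f h : finl E m A -> finl E m' B -> ~ conn E B -> emb E f A B -> emb E h B A ->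
  exists j, (forall x, A x -> B (j x) /\ eqm E (comp E B (j x)) (comp E A x)) /\
    forall x y, A x -> A y -> (near E A x y <-> near E B (j x) (j y)).
Proof.
  intros hA hB hd hf hh.
  assert (nA := fin_nonest hE hcode hA). assert (nB := fin_nonest hE hcode hB).
  set (j := fun x => if excluded_middle_informative (big E B (comp E A x))
                     then spread B (comp E A x) (code (rep A x)) else f x).
  assert (j1 : forall x, big E B (comp E A x) -> j x = spread B (comp E A x) (code (rep A x))).
  { intros x hx. unfold j. destruct (excluded_middle_informative (big E B (comp E A x))); tauto. }
  assert (j2 : forall x, ~ big E B (comp E A x) -> j x = f x).
  { intros x hx. unfold j. destruct (excluded_middle_informative (big E B (comp E A x))); tauto. }
  assert (j3 : forall x, A x -> B (j x) /\ eqm E (comp E B (j x)) (comp E A x)).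
  { intros x hx. destruct (classic (big E B (comp E A x))) as [hb|hb].
    - rewrite j1; auto. apply (spread_spec hb).
    - rewrite j2; auto. split; [apply (emb_in hf); auto|].
      destruct (big_or_eqm hE nA hB hd hf hh hx); tauto. }
  exists j. split; auto. intros x y hx hy. split.
  - intros hn. destruct (classic (big E B (comp E A x))) as [hb|hb].
    + rewrite !j1; auto; [|rewrite <- (comp_eq hE hx hy hn); auto].
      rewrite (comp_eq hE hx hy hn), (rep_eq hx hy hn). apply near_refl.
    + rewrite !j2; auto; [|rewrite <- (comp_eq hE hx hy hn); auto]. apply (emb_near hf); auto.
  - intros hn. apply NNPP; intros hno.
    destruct (j3 x hx) as [h1 h2]. destruct (j3 y hy) as [h3 h4].
    assert (he : eqm E (comp E A x) (comp E A y)).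
    { apply eqm_trans with (comp E B (j x)); [apply eqm_sym; auto|]. rewrite (comp_eq hE h1 h3 hn); auto. }
    destruct (classic (big E B (comp E A x))) as [hb|hb].
    + assert (hb' := big_eqm he hb). rewrite !j1 in hn; auto.
      (* The predicate from which [spread] is chosen depends on its second argument only up to
         equimorphy, so both choices are the same sequence. *)
      assert (es : spread B (comp E A x) = spread B (comp E A y)).
      { unfold spread. f_equal. apply functional_extensionality; intros s. apply propositional_extensionality.
        split; intros [a1 a2]; split; auto; intros n; destruct (a1 n) as [a3 a4]; split; auto;
          eapply eqm_trans; eauto. apply eqm_sym; auto. }
      rewrite es in hn. apply (spread_spec hb') in hn; auto.
      intros e. apply hcode in e. apply hno. apply rep_near; auto.
    + assert (hb' : ~ big E B (comp E A y)).
      { intros hb'. apply hb. apply big_eqm with (comp E A y); auto. apply eqm_sym; auto. }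
      rewrite !j2 in hn; auto. rewrite j2 in h2; auto.
      apply (far_sep hE nB hf hx hy hno hn). apply h2.
Qed.

Lemma glue_comps A B (b : U -> U) :
  (forall x, A x -> rep A x = x -> B (b x) /\ rep B (b x) = b x /\ iso E (comp E A x) (comp E B (b x))) ->
  (forall x y, A x -> rep A x = x -> A y -> rep A y = y -> b x = b y -> x = y) ->
  (forall y, B y -> rep B y = y -> exists x, A x /\ rep A x = x /\ b x = y) -> iso E A B.
Proof.
  intros hb hinj hsur.
  assert (hr : forall x, A x -> A (rep A x) /\ rep A (rep A x) = rep A x /\ comp E A (rep A x) x).
  { intros x hx. destruct (rep_spec hx) as [h1 h2]. split; auto. split.
    - symmetry. apply rep_eq; auto.
    - split; auto. apply near_sym; auto. }
  assert (hpsi : forall x, exists p, A x -> rep A x = x -> isof E p (comp E A x) (comp E B (b x))).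
  { intros x. destruct (classic (A x /\ rep A x = x)) as [[h1 h2]|h].
    - destruct (hb x h1 h2) as [_ [_ [p hp]]]. exists p; auto.
    - exists (fun z => z); tauto. }
  apply choice in hpsi. destruct hpsi as [p hp].
  assert (hp' : forall x, A x -> isof E (p (rep A x)) (comp E A (rep A x)) (comp E B (b (rep A x)))).
  { intros x hx. destruct (hr x hx) as [h1 [h2 _]]. apply hp; auto. }
  assert (hin : forall x, A x -> comp E B (b (rep A x)) (p (rep A x) x)).
  { intros x hx. apply (emb_in (proj1 (hp' x hx))). apply hr; auto. }
  assert (hBb : forall x, A x -> B (b (rep A x)) /\ rep B (b (rep A x)) = b (rep A x)).
  { intros x hx. destruct (hr x hx) as [h1 [h2 _]]. destruct (hb _ h1 h2) as [h3 [h4 _]]; auto. }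
  assert (hsep : forall x y, A x -> A y -> near E B (p (rep A x) x) (p (rep A y) y) -> rep A x = rep A y).
  { intros x y hx hy hn. destruct (hr x hx) as [h1 [h2 _]]. destruct (hr y hy) as [h3 [h4 _]].
    destruct (hin x hx) as [h5 h6]. destruct (hin y hy) as [h7 h8].
    destruct (hBb x hx) as [h9 h10]. destruct (hBb y hy) as [h11 h12].
    apply hinj; auto. rewrite <- h10, <- h12.
    apply rep_eq; auto. apply (near_trans hE (y:=p (rep A x) x)); auto.
    apply (near_trans hE (y:=p (rep A y) y)); auto. apply near_sym; auto. }
  exists (fun z => p (rep A z) z). split; [split|].
  - intros x hx. apply (hin x hx).
  - intros x y hx hy e. assert (er : rep A x = rep A y) by (apply hsep; auto; rewrite e; apply near_refl).
    rewrite <- er in e. apply (emb_inj (proj1 (hp' x hx))) in e; auto; [apply hr; auto|].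
    rewrite er; apply hr; auto.
  - intros x y hx hy. destruct (classic (rep A x = rep A y)) as [er|er].
    + rewrite <- er. apply (emb_adj (proj1 (hp' x hx))); [apply hr; auto|]. rewrite er; apply hr; auto.
    + split; intros h; exfalso; apply er.
      * apply rep_eq; auto. right; left; auto.
      * apply hsep; auto. right; left; auto.
  - intros y hy. destruct (rep_spec hy) as [h1 h2].
    destruct (hsur (rep B y) h1) as [x [h3 [h4 h5]]]; [symmetry; apply rep_eq; auto|].
    destruct (proj2 (hp x h3 h4) y) as [z [hz <-]].
    { rewrite h5. split; auto. apply near_sym; auto. }
    exists z. split; [apply hz|]. rewrite <- (@rep_eq A x z); [rewrite h4; auto | auto | apply hz | apply hz].
Qed.

(** The Cantor-Bernstein bijection on representatives matches equimorphic components, and these are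
    isomorphic because the components of [N] are unique. *)
Lemma disc_uniq m N : finl E m N -> ~ conn E N -> (forall x, N x -> uniq E (comp E N x)) -> uniq E N.
Proof.
  intros hfin hd hu Y hY.
  assert (hfY := finl_ksib hY hfin). assert (hdY : ~ conn E Y) by (rewrite <- (ksib_conn hY); auto).
  destruct (ksib_eqm hY) as [[f hf] [h hh]].
  assert (nN := fin_nonest hE hcode hfin). assert (nY := fin_nonest hE hcode hfY).
  destruct (comps_inj hfin hfY hdY hf hh) as [j [j1 j2]].
  destruct (comps_inj hfY hfin hd hh hf) as [k [k1 k2]].
  assert (hrr : forall A x, A x -> A (rep A x) /\ rep A (rep A x) = rep A x /\ near E A x (rep A x)).
  { intros A x hx. destruct (rep_spec hx) as [h1 h2]. split; auto. split; auto. symmetry. apply rep_eq; auto. }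
  destruct (@cantor_bernstein U (fun x => N x /\ rep N x = x) (fun y => Y y /\ rep Y y = y)
             (fun x => rep Y (j x)) (fun y => rep N (k y))) as [b [b1 [b2 b3]]].
  - intros x [hx _]. destruct (hrr Y (j x)) as [h1 [h2 _]]; [apply (j1 x hx)|]. auto.
  - intros x [hx _]. destruct (hrr N (k x)) as [h1 [h2 _]]; [apply (k1 x hx)|]. auto.
  - intros x y [hx ex] [hy ey] e. rewrite <- ex, <- ey. apply rep_eq; auto. apply j2; auto.
    apply rep_near; auto; [apply (j1 x hx) | apply (j1 y hy)].
  - intros x y [hx ex] [hy ey] e. rewrite <- ex, <- ey. apply rep_eq; auto. apply k2; auto.
    apply rep_near; auto; [apply (k1 x hx) | apply (k1 y hy)].
  - apply glue_comps with b.
    + intros x hx ex. destruct (b1 x) as [[h1 h2] h3]; auto. split; auto. split; auto.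
      assert (he : eqm E (comp E N x) (comp E Y (b x))).
      { destruct h3 as [h3|h3].
        - rewrite h3. destruct (j1 x hx) as [h4 h5]. destruct (hrr Y (j x) h4) as [h6 [_ h7]].
          rewrite <- (comp_eq hE h4 h6 h7). apply eqm_sym; auto.
        - destruct (k1 _ h1) as [h4 h5]. destruct (hrr N _ h4) as [h6 [_ h7]].
          rewrite (comp_eq hE h4 h6 h7), h3 in h5. auto. }
      apply (hu x hx). apply eqm_ksib; auto.
      * exists x; apply comp_self; auto.
      * apply nonest_strong with N; auto. apply strong_comp; auto.
      * apply nonest_strong with Y; auto. apply strong_comp; auto.
    + intros x y hx ex hy ey. apply b2; auto.
    + intros y hy ey. destruct (b3 y) as [x [[h1 h2] h3]]; auto. exists x; auto.
Qed.
End Components.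

(** * Stability of non-unique modules under self-embeddings *)

Section ClaimG.
Variables (U : Type) (code : U -> nat) (hcode : injective code).

Lemma smaller_co (E : U -> U -> Prop) (hE : cog E) m : smaller E m -> smaller (co E) m.
Proof.
  intros h m' A hm hf. apply uniq_co; auto. apply (h m'); auto. apply (finl_co_iff hE); auto.
Qed.

(** The least strong module [P] of [x] and [g x] is stable under [g], and the component [C] of [x]
    in it contains [K], so [C] is not unique. Either the orbit of [x] returns to [C], or a further
    copy of [C] can be made a component of a sibling of [P]; both give a second occurrence of [C],
    against [step_single]. *)
Lemma nonuniq_stable_half (E : U -> U -> Prop) (hE : cog E) m N K g x :
  smaller E m -> finl E m N -> strong E N K -> ~ uniq E K -> emb E g N N -> K x -> ~ K (g x) ->
  ~ E x (g x) -> False.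
Proof.
  intros hIH hfin hK hnu hg hx hnx hE'.
  assert (hxN : N x) by (apply (strong_sub hK); auto). assert (hgN : N (g x)) by (apply (emb_in hg); auto).
  assert (hne : x <> g x) by (intros e; apply hnx; rewrite <- e; auto).
  set (P := Lset E N x (g x)).
  assert (hP : strong E N P) by (apply strong_Lset; auto).
  assert (hPx : P x) by (apply Lset_l; auto). assert (hPg : P (g x)) by (apply Lset_r; auto).
  assert (hfar : ~ near E P x (g x)) by (apply Lset_far; auto).
  assert (hgP : emb E g P P).
  { apply emb_restrict with N N; auto; [apply (strong_sub hP)|].
    intros y hy. apply (fin_up hE hcode hfin hP hg hPx hPg hy). }
  assert (hfP : finl E m P) by (eapply finl_strong; eauto).
  assert (nP := fin_nonest hE hcode hfP).
  set (C := comp E P x).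
  assert (hC : strong E P C) by (apply strong_comp; auto).
  assert (hKP : sub K P).
  { destruct (strong_nested hE hK (strong_mod hP) hx hPx) as [h|h]; auto. exfalso; apply hnx; auto. }
  assert (hKsP : strong E P K) by (apply (strong_restrict hE hK hKP); apply hP).
  assert (hKC : sub K C).
  (* Otherwise [K] would have points in different components of [P] and so be all of [P], which
     contains [g x]. *)
  { intros k hk. split; auto. apply NNPP; intros h. apply hnx.
    rewrite (strong_eq_Lset hE hKsP hx hk); [|intros h'; apply h; apply near_sub with K; auto].
    assert (e : P = Lset E P x k).
    { apply (strong_eq_Lset hE); auto. apply strong_self; eauto. }
    rewrite <- e; auto. }
  assert (hfC : finl E m C) by (eapply finl_strong; eauto).
  assert (hCnu : ~ uniq E C).
  { apply (nonuniq_up hE hcode hfC (K:=K)); auto. apply (strong_restrict hE hKsP hKC). apply hC. }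
  destruct (orbit_cycle hE nP hgP hPx) as [[r hr]|[g' [hg' hav]]].
  - assert (hD : strong E P (comp E P (g x))) by (apply strong_comp; auto).
    assert (he : eqm E C (comp E P (g x))).
    { split; [exists g; apply emb_comp_set; auto|].
      assert (hit : emb E (fun z => it r g z) P P) by (apply emb_iter; auto).
      unfold C. rewrite <- (@comp_eq U E hE P (it r g (g x)) x); auto.
      - eexists. apply (emb_comp_set hit); auto.
      - apply (emb_in hit); auto.
      - replace (it r g (g x)) with (it (S r) g x); auto.
        replace (S r) with (r + 1) by lia. rewrite iter_add. auto. }
    assert (e : comp E P (g x) = C).
    { apply (step_single hE hcode hIH hfP hC hCnu). split; auto.
      apply eqm_ksib; auto.
      - exists x; apply comp_self; auto.
      - apply nonest_strong with P; auto.
      - apply nonest_strong with P; auto. }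
    assert (h : C (g x)) by (rewrite <- e; apply comp_self; auto). apply hfar, h.
  - set (A := grow C g' P).
    assert (hCx : C x) by (apply comp_self; auto).
    assert (hdis : forall z w, P z -> C w -> g' z <> w /\ ~ E (g' z) w).
    { intros z w hz hw. assert (h := hav z hz). split; [intros e; apply h; rewrite e; auto|].
      intros h'. apply (comp_nonadj hE hPx (emb_in hg' hz) hw h). apply (cog_sym hE); auto. }
    assert (hCc : conn E C) by (apply comp_conn; auto).
    assert (hPs : sub P P) by (intros z; auto).
    assert (hAk : ksib E P A).
    { apply (@tower_ksib U E hE P C g' x hg' (strong_sub hC) hCx hdis 1).
      intros hc. apply hfar. apply hc; auto. }
    assert (hfA := finl_ksib hAk hfP).
    assert (hgx : A (g' x)) by (right; exists x; auto).
    assert (hCA : strong E A C).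
    { assert (e : comp E A x = C) by (apply (@grow_comp_in U E hE P C g'); auto).
      rewrite <- e at 1. apply strong_comp; auto. left; auto. }
    assert (hD : strong E A (comp E A (g' x))) by (apply strong_comp; auto).
    assert (e : comp E A (g' x) = C).
    { apply (step_single hE hcode hIH hfA hCA hCnu). split; auto. apply iso_ksib.
      apply (@grow_comp_out U E hE P C g'); auto. }
    assert (h : C (g' x)) by (rewrite <- e; apply comp_self; auto).
    apply (hav x hPx h).
Qed.

Lemma nonuniq_stable (E : U -> U -> Prop) (hE : cog E) m N K g x :
  smaller E m -> finl E m N -> strong E N K -> ~ uniq E K -> emb E g N N -> K x -> K (g x).
Proof.
  intros hIH hfin hK hnu hg hx. apply NNPP; intros hnx. destruct (classic (E x (g x))) as [h|h].
  - apply (@nonuniq_stable_half (co E) (cog_co hE) m N K g x); auto using smaller_co, finl_co, strong_co, emb_co.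
    + rewrite (uniq_co_iff hE); auto.
    + intros [_ h']; auto.
  - apply (@nonuniq_stable_half E hE m N K g x); auto.
Qed.
End ClaimG.

(** * Graphs connected together with their complement *)

(** The isomorphism moves one component into the place of the other, and everything else stays
    fixed. *)
Lemma comps_cancel U (E : U -> U -> Prop) (hE : cog E) (A : set U) x y :
  A x -> A y -> iso E (comp E A x) (comp E A y) -> iso E (diff A (comp E A y)) (diff A (comp E A x)).
Proof.
  intros hx hy [t ht].
  assert (hcc : forall z, comp E A x z -> comp E A y z -> near E A x y).
  { intros z [h1 h2] [_ h3]. apply (near_trans hE) with z; auto. apply near_sym; auto. }
  destruct (classic (near E A x y)) as [hn|hn].
  { rewrite (comp_eq hE hx hy hn). apply iso_refl. }
  assert (hd : forall z, comp E A x z -> ~ comp E A y z) by (intros z h1 h2; apply hn; eauto).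
  assert (htA : forall z, comp E A x z -> comp E A y (t z)) by (intros z hz; apply (emb_in (proj1 ht)); auto).
  assert (hyA : sub (comp E A y) A) by (intros z hz; apply hz).
  exists (glue (comp E A x) t (fun z => z)). split; [split|].
  - intros z [hz hnz]. destruct (classic (comp E A x z)) as [h|h].
    + rewrite glue_in; auto. split; [apply hyA; auto|]. intros h'. apply (hd (t z)); auto.
    + rewrite glue_out; auto. split; auto.
  - intros z w [hz hnz] [hw hnw].
    destruct (classic (comp E A x z)) as [h1|h1]; destruct (classic (comp E A x w)) as [h2|h2];
      rewrite ?(glue_in _ _ h1), ?(glue_in _ _ h2), ?(glue_out _ _ h1), ?(glue_out _ _ h2); intros e; auto.
    + apply (emb_inj (proj1 ht)); auto.
    + exfalso. apply hnw. rewrite <- e; auto.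
    + exfalso. apply hnz. rewrite e; auto.
  - intros z w [hz hnz] [hw hnw].
    destruct (classic (comp E A x z)) as [h1|h1]; destruct (classic (comp E A x w)) as [h2|h2];
      rewrite ?(glue_in _ _ h1), ?(glue_in _ _ h2), ?(glue_out _ _ h1), ?(glue_out _ _ h2).
    + apply (emb_adj (proj1 ht)); auto.
    + split; intros h; exfalso.
      * apply (comp_nonadj hE hx hw h1 h2); auto.
      * apply (comp_nonadj hE hy hw (htA z h1) hnw); auto.
    + split; intros h; exfalso; apply (cog_sym hE) in h.
      * apply (comp_nonadj hE hx hz h2 h1); auto.
      * apply (comp_nonadj hE hy hz (htA w h2) hnz); auto.
    + tauto.
  - intros z [hz hnz]. destruct (classic (comp E A y z)) as [h|h].
    + destruct (proj2 ht z h) as [w [hw <-]]. exists w. split; [split; [apply hw | apply hd; auto]|].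
      apply glue_in; auto.
    + exists z. split; [split; auto|]. apply glue_out; auto.
Qed.

Definition pair {U} (x z : U) : set U := fun w => w = x \/ w = z.
Definition level {U} (E : U -> U -> Prop) A x z := hull E A (pair x z).
(** The tiers slice the graph along the chain of strong modules around [x]. *)
Definition tier {U} (E : U -> U -> Prop) (A : set U) x (S : set U) : set U := fun w => A w /\ level E A x w = S.

Lemma level_co U (E : U -> U -> Prop) (hE : cog E) A x z : level (co E) A x z = level E A x z.
Proof. apply hull_co; auto. Qed.

Lemma tier_co U (E : U -> U -> Prop) (hE : cog E) (A : set U) x S : tier (co E) A x S = tier E A x S.
Proof. apply set_ext; intros w; unfold tier; rewrite level_co; tauto. Qed.

Lemma level_l U (E : U -> U -> Prop) (A : set U) x z : level E A x z x.
Proof. apply hull_ge. left; auto. Qed.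

Lemma level_r U (E : U -> U -> Prop) (A : set U) x z : level E A x z z.
Proof. apply hull_ge. right; auto. Qed.

Lemma level_strong U (E : U -> U -> Prop) (hE : cog E) (A : set U) x z : A x -> A z -> strong E A (level E A x z).
Proof. intros hx hz. apply hull_strong; auto; [intros w [-> | ->]; auto | exists x; left; auto]. Qed.

Lemma level_le U (E : U -> U -> Prop) (A : set U) x z M : strong E A M -> M x -> M z -> sub (level E A x z) M.
Proof. intros hM hx hz. apply hull_le; auto. intros w [-> | ->]; auto. Qed.

Lemma level_far U (E : U -> U -> Prop) (hE : cog E) (A : set U) x z :
  A x -> A z -> x <> z -> ~ E x z -> level E A x z = Lset E A x z /\ ~ near E (level E A x z) x z.
Proof.
  intros hx hz hne hE'.
  assert (hs : sub (level E A x z) (Lset E A x z)).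
  { apply level_le; [apply strong_Lset; auto | apply Lset_l; auto | apply Lset_r; auto]. }
  assert (hf : ~ near E (level E A x z) x z).
  { intros h. apply (@Lset_far U E hE A x z hne hE'). apply near_sub with (level E A x z); auto. }
  split; auto. apply (strong_eq_Lset hE); auto using level_strong, level_l, level_r.
Qed.

Lemma far_level U (E : U -> U -> Prop) (hE : cog E) (A S : set U) x z :
  strong E A S -> S x -> S z -> ~ near E S x z -> level E A x z = S.
Proof.
  intros hS hx hz hf. rewrite (strong_eq_Lset hE hS hx hz hf).
  apply level_far; auto; try (apply (strong_sub hS); auto).
  - intros e; apply hf; left; auto.
  - intros e; apply hf; right; left; auto.
Qed.

Lemma tier_far U (E : U -> U -> Prop) (hE : cog E) (A S : set U) x z :
  strong E A S -> S x -> S z -> ~ near E S x z -> tier E A x S = diff S (comp E S x).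
Proof.
  intros hS hx hz hf. apply set_ext; intros w; split.
  - intros [hw e]. assert (hSw : S w) by (rewrite <- e; apply level_r). split; auto.
    intros hc. assert (hs : sub S (comp E S x)).
    { rewrite <- e at 1. apply level_le; auto; [|apply comp_self; auto].
      apply (strong_trans hE hS). apply strong_comp; auto. }
    apply hf, (hs z hz).
  - intros [hw hn]. split; [apply (strong_sub hS); auto|]. apply far_level; auto.
    intros h; apply hn; split; auto.
Qed.

Lemma uniq_single U (E : U -> U -> Prop) (A : set U) x : A x -> (forall z, A z -> z = x) -> uniq E A.
Proof.
  intros hx hA Y [[[f hf] [h hh]] _ _]. exists f; split; auto.
  intros y hy. exists x; split; auto. apply (emb_inj hh); auto; [apply (emb_in hf); auto|].
  rewrite (hA (h y)), (hA (h (f x))); auto; apply (emb_in hh); auto. apply (emb_in hf); auto.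
Qed.

(* [x] is the base point; [P = base] contains [x] and its image under [h f], so every strong module
   [S] containing [P] is stable under [h f] and corresponds to the strong module [prime S] of [Y]. *)
Record frame {U} (E : U -> U -> Prop) m (N Y : set U) f h x : Prop := {
  fr_fin : finl E m N;
  fr_fin' : finl E m Y;
  fr_f : emb E f N Y;
  fr_h : emb E h Y N;
  fr_x : N x;
  fr_conn : conn E N;
  fr_coconn : conn (co E) N;
  fr_uniq : forall S, strong E N S -> S <> N -> uniq E S
}.

Lemma frame_co U (E : U -> U -> Prop) (hE : cog E) m N Y f h x : frame E m N Y f h x -> frame (co E) m N Y f h x.
Proof.
  intros []; split; auto using finl_co, emb_co.
  - rewrite (co_co hE); auto.
  - intros S hS hne. apply uniq_co; auto. apply fr_uniq0; auto. apply (strong_co_iff hE); auto.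
Qed.

Definition base {U} (E : U -> U -> Prop) (N : set U) (f h : U -> U) x := level E N x (h (f x)).
Definition prime {U} (E : U -> U -> Prop) (Y : set U) (f : U -> U) S := hull E Y (img f S).

Section Frame.
Variables (U : Type) (code : U -> nat) (hcode : injective code).
Variables (E : U -> U -> Prop) (hE : cog E) (m : nat) (N Y : set U) (f h : U -> U) (x : U).
Hypothesis (F : frame E m N Y f h x).
Let hf := fr_f F.
Let hh := fr_h F.
Let P := base E N f h x.
Let P' := prime E Y f P.

Lemma frame_g : N (h (f x)).
Proof. apply (emb_in hh), (emb_in hf), F. Qed.

Lemma base_strong : strong E N P.
Proof. apply level_strong; auto; [apply F | apply frame_g]. Qed.

Lemma prime_strong S : strong E N S -> strong E Y (prime E Y f S).
Proof.
  intros hS. apply hull_strong; auto.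
  - intros y [z [hz <-]]. apply (emb_in hf), (strong_sub hS); auto.
  - destruct (strong_ne hS) as [z hz]. exists (f z), z; split; [exact hz | reflexivity].
Qed.

Lemma prime_in S z : S z -> prime E Y f S (f z).
Proof. intros hz. apply hull_ge. exists z; split; [exact hz | reflexivity]. Qed.

Lemma prime_out S z : strong E N S -> N z -> ~ S z -> ~ prime E Y f S (f z).
Proof. intros hS hz hn. apply (hull_escape hE hS hz hn hf). Qed.

(** If [h y] left [S], then [f (h y)] would leave [prime E Y f S] by [prime_out]. But [f] after [h]
    sends [f x] into this module again, so the module is stable by [fin_up]. *)
Lemma prime_emb S : strong E N S -> sub P S -> emb E f S (prime E Y f S) /\ emb E h (prime E Y f S) S.
Proof.
  intros hS hP. assert (hS' := prime_strong hS).
  assert (hPx : P x) by apply level_l. assert (hPg : P (h (f x))) by apply level_r.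
  split.
  - apply emb_restrict with N Y; auto; [apply (strong_sub hS)|]. intros z hz; apply prime_in; auto.
  - apply emb_restrict with Y N; auto; [apply (strong_sub hS')|].
    intros y hy. apply NNPP; intros hn.
    assert (hYy : Y y) by (apply (strong_sub hS'); auto).
    apply (prime_out hS (emb_in hh hYy) hn).
    apply (fin_up hE hcode (fr_fin' F) hS' (g:=fun y => f (h y)) (x := f x)); auto.
    + apply (emb_comp hh hf).
    + apply prime_in; auto.
    + apply (prime_in (z := h (f x))); auto.
Qed.

Lemma base_sub S z : strong E N S -> S x -> S z -> ~ P z -> sub P S.
Proof.
  intros hS hx hz hn.
  destruct (strong_nested hE base_strong (strong_mod hS) (@level_l U E N x _) hx) as [hs|hs]; auto.
  exfalso; apply hn; apply hs; auto.
Qed.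

Lemma strong_nonest_N S : strong E N S -> nonest E S.
Proof. intros hS. apply nonest_strong with N; auto. apply (fin_nonest hE hcode (fr_fin F)). Qed.

Lemma strong_nonest_Y S : strong E Y S -> nonest E S.
Proof. intros hS. apply nonest_strong with Y; auto. apply (fin_nonest hE hcode (fr_fin' F)). Qed.

Lemma far_neq S : strong E N S -> ~ conn E S -> S <> N.
Proof. intros hS hd e. apply hd. rewrite e. apply F. Qed.

(** Both [S] and the component of [x] in [S] are proper strong modules of [N], hence isomorphic to
    their counterparts in [Y]. An isomorphism of [S] need not send [x] to the component of [f x],
    but cancelling isomorphic components still matches the tiers. *)
Lemma level_half z : N z -> ~ P z -> ~ E x z ->
  let S := level E N x z in let S' := prime E Y f S in
  S' = level E Y (f x) (f z) /\ iso E (tier E N x S) (tier E Y (f x) S') /\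
  (forall w, tier E N x S w -> ~ E x w) /\ (forall w, tier E Y (f x) S' w -> ~ E (f x) w).
Proof.
  intros hz hnP hE' S S'. assert (hx := fr_x F).
  assert (hne : x <> z) by (intros e; subst; apply hnP, level_l).
  destruct (level_far hE hx hz hne hE') as [eS hfar]. fold S in eS, hfar.
  assert (hS : strong E N S) by (apply level_strong; auto).
  assert (hSx : S x) by apply level_l. assert (hSz : S z) by apply level_r.
  assert (hPS : sub P S) by (apply base_sub with z; auto).
  assert (hS' : strong E Y S') by (apply prime_strong; auto).
  destruct (prime_emb hS hPS) as [hfS hhS]. fold S' in hfS, hhS.
  set (C := comp E S x).
  assert (hC : strong E N C) by (apply (strong_trans hE hS), strong_comp; auto).
  assert (hPC : sub P C).
  { intros p hp. split; auto. apply NNPP; intros hn. apply hnP.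
    rewrite (strong_eq_Lset hE base_strong (@level_l U E N x _) hp); [|intros h'; apply hn; apply near_sub with P; auto].
    rewrite <- (strong_eq_Lset hE hS hSx (hPS p hp) hn). auto. }
  assert (hg : near E S x (h (f x))) by (apply hPC; apply level_r).
  assert (hgS : S (h (f x))) by (apply hPS, level_r).
  assert (hSfx : S' (f x)) by (apply (emb_in hfS); auto).
  assert (hSfz : S' (f z)) by (apply (emb_in hfS); auto).
  assert (hCC : emb E h (comp E S' (f x)) C).
  { unfold C. rewrite (comp_eq hE hSx hgS hg). apply emb_comp_set; auto. }
  assert (hfar' : ~ near E S' (f x) (f z)).
  { intros hn. apply (far_sep hE (strong_nonest_Y hS') hfS hSx hSz hfar hn). exists h; auto. }
  assert (hdisc : ~ conn E S) by (intros hc; apply hfar; apply hc; auto).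
  split; [symmetry; apply far_level; auto|].
  assert (t1 : tier E N x S = diff S C) by (apply (tier_far hE hS hSx hSz hfar)).
  assert (t2 : tier E Y (f x) S' = diff S' (comp E S' (f x))) by (apply (tier_far hE hS' hSfx hSfz hfar')).
  split; [|split].
  - assert (hsib : forall T T', strong E N T -> strong E Y T' -> eqm E T T' -> T <> N -> iso E T T').
    { intros T T' h1 h2 h3 h4. apply (fr_uniq F h1 h4).
      apply eqm_ksib; auto using strong_nonest_N, strong_nonest_Y. apply h1. }
    assert (hi : iso E S S').
    { apply hsib; auto using far_neq. split; [exists f | exists h]; auto. }
    assert (hiC : iso E C (comp E S' (f x))).
    { apply hsib; auto.
      - apply (strong_trans hE hS'), strong_comp; auto.
      - split; [exists f; apply emb_comp_set; auto | exists h; auto].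
      - intros e. apply hfar. assert (hCz : C z) by (rewrite e; auto). apply hCz. }
    destruct hi as [phi hphi].
    assert (hpx : S' (phi x)) by (apply (emb_in (proj1 hphi)); auto).
    assert (hpC : isof E phi C (comp E S' (phi x))) by (apply isof_comp_set; auto).
    assert (hcan : iso E (diff S' (comp E S' (phi x))) (diff S' (comp E S' (f x)))).
    { apply comps_cancel; auto. apply iso_trans with C; [apply iso_sym; auto | exists phi; auto]. }
    rewrite t1, t2. apply iso_trans with (diff S' (comp E S' (phi x))); auto.
    exists phi. split.
    + apply emb_restrict with S S'; [apply hphi | intros w hw; apply hw|].
      intros w [hw hn]. split; [apply (emb_in (proj1 hphi)); auto|].
      intros [_ hc]. apply hn. split; auto. apply (isof_near hphi); auto.
    + intros w [hw hn]. destruct (proj2 hphi w hw) as [v [hv <-]]. exists v; split; auto. split; auto.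
      intros hc. apply hn. apply (emb_in (proj1 hpC)); auto.
  - rewrite t1. intros w [hw hn] he. apply hn. split; auto. right; left; auto.
  - rewrite t2. intros w [hw hn] he. apply hn. split; auto. right; left; auto.
Qed.

(** The level [T] of [y] is stable under [f] after [h], and [f x] stays in its component there. By
    [far_sep] the vertex [f (h y)] stays outside that component, so [T] is also the level of
    [f (h y)], to which [level_half] applies. *)
Lemma level_onto_half y : Y y -> ~ P' y -> ~ E (f x) y ->
  ~ P (h y) /\ level E Y (f x) y = prime E Y f (level E N x (h y)).
Proof.
  intros hy hnP hE'.
  assert (hx := fr_x F). assert (hfx : Y (f x)) by (apply (emb_in hf); auto).
  assert (hP' : strong E Y P') by (apply prime_strong, base_strong).
  assert (hP'x : P' (f x)) by (apply prime_in, level_l).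
  assert (hP'g : P' (f (h (f x)))) by (apply (prime_in (z := h (f x))), level_r).
  assert (hne : f x <> y) by (intros e; subst; auto).
  destruct (level_far hE hfx hy hne hE') as [eT hfar].
  set (T := level E Y (f x) y) in *.
  assert (hT : strong E Y T) by (apply level_strong; auto).
  assert (hTx : T (f x)) by apply level_l. assert (hTy : T y) by apply level_r.
  assert (hPT : sub P' T).
  { destruct (strong_nested hE hP' (strong_mod hT) hP'x hTx) as [hs|hs]; auto. exfalso; apply hnP; apply hs; auto. }
  assert (hgT : emb E (fun y => f (h y)) T T).
  { apply emb_restrict with Y Y; [apply (emb_comp hh hf) | apply (strong_sub hT)|].
    intros w hw. apply (fin_up hE hcode (fr_fin' F) hT (g:=fun y => f (h y)) (x := f x)); auto.
    apply (emb_comp hh hf). }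
  assert (hPC : forall p, P' p -> near E T (f x) p).
  { intros p hp. apply NNPP; intros hn. apply hnP.
    rewrite (strong_eq_Lset hE hP' hP'x hp); [|intros h'; apply hn; apply near_sub with P'; auto].
    rewrite <- (strong_eq_Lset hE hT hTx (hPT p hp) hn). auto. }
  assert (hTg : T (f (h (f x)))) by auto.
  assert (hTgy : T (f (h y))) by (apply (emb_in hgT); auto).
  assert (hfar' : ~ near E T (f x) (f (h y))).
  { intros hn. apply (far_sep hE (strong_nonest_Y hT) hgT hTx hTy hfar); auto.
    - apply (near_trans hE) with (f x); auto. apply near_sym; auto.
    - rewrite <- (comp_eq hE hTx hTg (hPC _ hP'g)). apply le_refl. }
  assert (hhy : N (h y)) by (apply (emb_in hh); auto).
  assert (hnPy : ~ P (h y)) by (intros hp; apply hfar', hPC, prime_in; auto).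
  split; auto.
  destruct (@level_half (h y)) as [e _]; auto.
  - intros he. apply hfar'. right; left. apply (emb_pos hf); auto.
  - rewrite e. symmetry. apply far_level; auto.
Qed.
End Frame.

Section FrameIso.
Variables (U : Type) (code : U -> nat) (hcode : injective code).
Variables (E : U -> U -> Prop) (hE : cog E) (m : nat) (N Y : set U) (f h : U -> U) (x : U).
Hypothesis (F : frame E m N Y f h x).
Let hf := fr_f F.
Let hh := fr_h F.
Let P := base E N f h x.
Let P' := prime E Y f P.
Let Lv := level E N x.

Lemma base_co : base (co E) N f h x = base E N f h x.
Proof. apply level_co; auto. Qed.

Lemma prime_co S : prime (co E) Y f S = prime E Y f S.
Proof. apply hull_co; auto. Qed.

Lemma level_tier z : N z -> ~ P z ->
  exists p, isof E p (tier E N x (Lv z)) (tier E Y (f x) (prime E Y f (Lv z))) /\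
    forall w, tier E N x (Lv z) w -> (E x w <-> E (f x) (p w)).
Proof.
  intros hz hn. destruct (classic (E x z)) as [he|he].
  - destruct (@level_half U code hcode (co E) (cog_co hE) m N Y f h x (frame_co hE F) z) as [_ [[p hp] [h2 h3]]]; auto.
    + rewrite base_co; auto.
    + intros [_ h']; auto.
    + rewrite (level_co hE), prime_co, !(tier_co hE) in *.
      exists p. split.
      { split; [apply (emb_co_iff hE); apply hp | apply hp]. }
      intros w hw. assert (hw' := emb_in (proj1 hp) hw). split; intros _.
      * apply NNPP; intros hn'. apply (h3 (p w)); auto. split; auto. intros e.
        destruct hw' as [h4 h5]. apply (prime_out hE F (S:=base E N f h x) (z:=z)); auto.
        -- apply (base_strong hE F).
        -- assert (h6 : sub (prime E Y f (level E N x z)) (prime E Y f (base E N f h x))).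
           { rewrite <- h5, <- e. apply level_le; [apply (prime_strong hE F), (base_strong hE F) | |];
               apply prime_in; apply level_l. }
           apply h6. apply prime_in. apply level_r.
      * apply NNPP; intros hn'. apply (h2 w); auto. split; auto. intros e.
        destruct hw as [h4 h5]. apply hn. assert (h6 : sub (Lv z) P).
        { rewrite <- h5, <- e. apply level_le; [apply (base_strong hE F) | apply level_l | apply level_l]. }
        apply h6, level_r.
  - destruct (@level_half U code hcode E hE m N Y f h x F z) as [_ [[p hp] [h2 h3]]]; auto.
    exists p; split; auto. intros w hw. split; intros h'; exfalso; [apply (h2 w) | apply (h3 (p w))]; auto.
    apply (emb_in (proj1 hp)); auto.
Qed.

Lemma level_onto y : Y y -> ~ P' y ->
  ~ P (h y) /\ level E Y (f x) y = prime E Y f (level E N x (h y)).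
Proof.
  intros hy hn. destruct (classic (E (f x) y)) as [he|he].
  - destruct (@level_onto_half U code hcode (co E) (cog_co hE) m N Y f h x (frame_co hE F) y) as [h1 h2]; auto.
    + rewrite prime_co, base_co; auto.
    + intros [_ h']; auto.
    + rewrite base_co in h1. rewrite !(level_co hE), prime_co in h2. auto.
  - apply (@level_onto_half U code hcode E hE m N Y f h x F y); auto.
Qed.

(** If the base were all of [N], then [x] and [h (f x)] would lie in different components of [N] or
    of its complement. If the two vertices coincide, the base is a single vertex. *)
Lemma base_uniq : uniq E P.
Proof.
  assert (hP := base_strong hE F). fold P in hP.
  destruct (classic (x = h (f x))) as [e|e].
  - apply uniq_single with x; [apply level_l|]. intros z hz.
    apply (level_le (strong_single E (fr_x F)) (x := x) (z := h (f x))); auto.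
  - apply (fr_uniq F hP). intros eN. destruct (classic (E x (h (f x)))) as [he|he].
    + destruct (@level_far U (co E) (cog_co hE) N x (h (f x))) as [_ h1]; auto; [apply F | apply (frame_g F) | intros [_ h']; auto|].
      rewrite (level_co hE) in h1. fold (base E N f h x) in h1. fold P in h1. apply h1. rewrite eN. apply (fr_coconn F); [apply F | apply (frame_g F)].
    + destruct (@level_far U E hE N x (h (f x))) as [_ h1]; auto; [apply F | apply (frame_g F)|].
      fold (base E N f h x) in h1. fold P in h1. apply h1. rewrite eN. apply (fr_conn F); [apply F | apply (frame_g F)].
Qed.

(** The isomorphisms of the base and of the tiers fit together whatever the order type of the chain:
    between different levels, adjacency depends only on whether the outer vertex is adjacent to [x],
    and this is preserved. *)
Lemma frame_iso : iso E N Y.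
Proof.
  assert (hx := fr_x F). assert (hfx : Y (f x)) by (apply (emb_in hf); auto).
  assert (hP : strong E N P) by apply (base_strong hE F).
  assert (hP' : strong E Y P') by (apply (prime_strong hE F); auto).
  assert (hPx : P x) by apply level_l. assert (hP'x : P' (f x)) by (apply prime_in; auto).
  assert (hLs : forall z, N z -> strong E N (Lv z)) by (intros z hz; apply level_strong; auto).
  assert (hLs' : forall z, N z -> strong E Y (prime E Y f (Lv z))) by (intros z hz; apply (prime_strong hE F); auto).
  assert (hb : iso E P P').
  { apply base_uniq. destruct (prime_emb hcode hE F hP) as [h1 h2]; [intros z hz; auto|].
    apply eqm_ksib; auto.
    - exists x; auto.
    - split; [exists f | exists h]; auto.
    - apply (strong_nonest_N hcode hE F); auto.
    - apply (strong_nonest_Y hcode hE F); auto. }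
  destruct hb as [p hp].
  (* One isomorphism is fixed for each level as a set, so that all vertices of a tier use the same
     one. *)
  assert (ht : forall S : set U, exists q, forall z, N z -> ~ P z -> Lv z = S ->
    isof E q (tier E N x S) (tier E Y (f x) (prime E Y f S)) /\
    forall w, tier E N x S w -> (E x w <-> E (f x) (q w))).
  { intros S. destruct (classic (exists z, N z /\ ~ P z /\ Lv z = S)) as [[z [h1 [h2 <-]]]|hno].
    - destruct (level_tier h1 h2) as [q hq]. exists q; auto.
    - exists (fun z => z). intros z h1 h2 h3. exfalso; apply hno; eauto. }
  apply choice in ht. destruct ht as [q hq].
  set (phi := glue P p (fun z => q (Lv z) z)).
  assert (phi1 : forall z, P z -> phi z = p z) by (intros z hz; apply glue_in; auto).
  assert (phi2 : forall z, ~ P z -> phi z = q (Lv z) z) by (intros z hz; exact (glue_out p (fun z => q (Lv z) z) hz)).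
  assert (hti : forall z, N z -> tier E N x (Lv z) z) by (intros z hz; split; auto).
  assert (hto : forall z, N z -> ~ P z -> tier E Y (f x) (prime E Y f (Lv z)) (phi z)).
  { intros z hz hn. rewrite phi2; auto. destruct (hq (Lv z) z) as [h1 _]; auto. apply (emb_in (proj1 h1)); auto. }
  assert (hmin : forall z T, N z -> ~ P z -> strong E Y T -> T (f x) -> T (phi z) -> T (f z)).
  { intros z T hz hn hT h1 h2. destruct (hto z hz hn) as [h3 h4].
    assert (h5 : sub (prime E Y f (Lv z)) T) by (rewrite <- h4; apply level_le; auto).
    apply h5, prime_in, level_r. }
  assert (hout : forall z, N z -> ~ P z -> ~ P' (phi z)).
  { intros z hz hn h1. apply (prime_out hE F hP hz hn). apply hmin; auto. }
  assert (hin : forall z, P z -> P' (phi z)) by (intros z hz; rewrite phi1; auto; apply (emb_in (proj1 hp)); auto).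
  assert (hsep : forall z w, N z -> ~ P z -> N w -> ~ Lv w z -> ~ prime E Y f (Lv w) (phi z)).
  { intros z w hz hn hw hzw h1. apply (prime_out hE F (hLs w hw) hz hzw). apply hmin; auto.
    apply prime_in, level_l. }
  assert (hadj1 : forall z w, N z -> ~ P z -> P w -> (E z w <-> E (phi z) (phi w))).
  { intros z w hz hn hw. assert (e1 : E z w <-> E z x).
    { destruct (strong_mod hP) as [_ hm]. split; apply hm; auto. }
    assert (e2 : E (phi z) (phi w) <-> E (phi z) (f x)).
    { destruct (strong_mod hP') as [_ hm]. destruct (hto z hz hn) as [h1 _].
      split; apply hm; auto. }
    destruct (hq (Lv z) z) as [_ h3]; auto. specialize (h3 z (hti z hz)). rewrite <- phi2 in h3; auto.
    rewrite e1, e2. split; intros h4; apply (cog_sym hE), h3, (cog_sym hE); auto. }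
  assert (hadj2 : forall z w, N z -> ~ P z -> N w -> ~ P w -> ~ Lv w z -> (E z w <-> E (phi z) (phi w))).
  { intros z w hz hnz hw hnw hzw. assert (e1 : E z w <-> E z x).
    { destruct (strong_mod (hLs w hw)) as [_ hm]. split; apply hm; auto using level_l, level_r; apply level_l || apply level_r. }
    assert (e2 : E (phi z) (phi w) <-> E (phi z) (f x)).
    { destruct (strong_mod (hLs' w hw)) as [_ hm]. destruct (hto z hz hnz) as [h1 _].
      destruct (hto w hw hnw) as [h2 h2'].
      assert (h5 : prime E Y f (Lv w) (phi w)) by (rewrite <- h2'; apply level_r).
      assert (h6 : prime E Y f (Lv w) (f x)) by (apply prime_in, level_l).
      assert (h7 := hsep z w hz hnz hw hzw).
      split; apply hm; auto. }
    destruct (hq (Lv z) z) as [_ h3]; auto. specialize (h3 z (hti z hz)). rewrite <- phi2 in h3; auto.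
    rewrite e1, e2. split; intros h4; apply (cog_sym hE), h3, (cog_sym hE); auto. }
  assert (hsame : forall z w, N z -> N w -> Lv w z -> Lv z w -> Lv z = Lv w).
  { intros z w hz hw h1 h2. apply set_ext; intros v; split; intros hv.
    - apply (level_le (hLs w hw) (@level_l U E N x w) h1); auto.
    - apply (level_le (hLs z hz) (@level_l U E N x z) h2); auto. }
  exists phi. split; [split|].
  - intros z hz. destruct (classic (P z)) as [h1|h1].
    + apply (strong_sub hP'); auto.
    + apply (hto z hz h1).
  - intros z w hz hw e. destruct (classic (P z)) as [h1|h1]; destruct (classic (P w)) as [h2|h2].
    + rewrite !phi1 in e; auto. apply (emb_inj (proj1 hp)); auto.
    + exfalso. apply (hout w hw h2). rewrite <- e; auto.
    + exfalso. apply (hout z hz h1). rewrite e; auto.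
    + assert (hl : forall v, N v -> ~ P v -> prime E Y f (Lv v) (phi v)).
      { intros v hv hnv. destruct (hto v hv hnv) as [_ e']. rewrite <- e'. apply level_r. }
      assert (e' : Lv z = Lv w).
      { apply hsame; auto; apply NNPP; intros hn.
        - apply (hsep z w); auto. rewrite e; auto.
        - apply (hsep w z); auto. rewrite <- e; auto. }
      rewrite !phi2 in e; auto. rewrite <- e' in e. destruct (hq (Lv z) z) as [h3 _]; auto.
      apply (emb_inj (proj1 h3)) in e; auto. split; auto.
  - intros z w hz hw. destruct (classic (P z)) as [h1|h1]; destruct (classic (P w)) as [h2|h2].
    + rewrite !phi1; auto. apply (emb_adj (proj1 hp)); auto.
    + rewrite (conj (@cog_sym U E hE z w) (@cog_sym U E hE w z) : _ <-> _), (hadj1 w z); auto. split; apply (cog_sym hE).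
    + apply hadj1; auto.
    + destruct (classic (Lv w z)) as [h3|h3]; [|apply hadj2; auto].
      destruct (classic (Lv z w)) as [h4|h4].
      * assert (e := hsame z w hz hw h3 h4). rewrite !phi2; auto. rewrite <- e.
        destruct (hq (Lv z) z) as [h5 _]; auto. apply (emb_adj (proj1 h5)); auto. split; auto.
      * rewrite (conj (@cog_sym U E hE z w) (@cog_sym U E hE w z) : _ <-> _), (hadj2 w z); auto. split; apply (cog_sym hE).
  - intros y hy. destruct (classic (P' y)) as [h1|h1].
    + destruct (proj2 hp y h1) as [z [hz <-]]. exists z; split; [apply (strong_sub hP); auto | apply phi1; auto].
    + destruct (level_onto hy h1) as [h2 h3].
      assert (hhy : N (h y)) by (apply (emb_in hh); auto).
      destruct (hq (Lv (h y)) (h y)) as [h4 _]; auto.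
      destruct (proj2 h4 y) as [z [[hz e] <-]]; [split; auto|].
      assert (hnz : ~ P z).
      { intros hPz. apply h2. apply (level_le hP hPx hPz). rewrite e. apply level_r. }
      exists z; split; auto. rewrite phi2; auto. fold (Lv z) in e. rewrite e. auto.
Qed.
End FrameIso.

Lemma cut_in U (E : U -> U -> Prop) N K Y K' th z : cut E N K Y K' th -> N z -> ~ K z -> Y (th z) /\ ~ K' (th z).
Proof. intros hc hz hn. exact (emb_in (proj1 (cut_iso hc)) (conj hz hn)). Qed.

(** * Uniqueness of the sibling *)

(** A vertex that leaves the sequence after [K n] moves by [th n], and one that never leaves moves
    by [nu]; [cut_lab] takes care of adjacency between different stages. *)
Lemma glue_tower U (E : U -> U -> Prop) (hE : cog E) (K K' : nat -> set U) (th : nat -> U -> U) nu :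
  (forall n, cut E (K n) (K (S n)) (K' n) (K' (S n)) (th n)) ->
  isof E nu (fun z => forall n, K n z) (fun z => forall n, K' n z) -> iso E (K 0) (K' 0).
Proof.
  intros hc hnu.
  assert (hdec : forall i j, i <= j -> sub (K j) (K i)).
  { intros i j hij. induction hij as [|j hij IH]; intros z hz; auto. apply IH, (cut_sub (hc j)); auto. }
  assert (hdec' : forall i j, i <= j -> sub (K' j) (K' i)).
  { intros i j hij. induction hij as [|j hij IH]; intros z hz; auto. apply IH, (cut_sub' (hc j)); auto. }
  assert (hlast : forall (L : nat -> set U) z, L 0 z -> ~ (forall n, L n z) -> exists n, L n z /\ ~ L (S n) z).
  { intros L z hz hn. apply NNPP; intros hno. apply hn. intros n. induction n as [|n IH]; auto.
    apply NNPP; intros h. apply hno. exists n; auto. }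
  assert (huni : forall z i j, K i z -> ~ K (S i) z -> K j z -> ~ K (S j) z -> i = j).
  { intros z i j h1 h2 h3 h4. destruct (lt_eq_lt_dec i j) as [[h|h]|h]; auto; exfalso.
    - apply h2. apply (hdec (S i) j); auto.
    - apply h4. apply (hdec (S j) i); auto. }
  assert (hphi : forall z, exists y, (forall n, K n z -> ~ K (S n) z -> y = th n z) /\ ((forall n, K n z) -> y = nu z)).
  { intros z. destruct (classic (exists n, K n z /\ ~ K (S n) z)) as [[n [h1 h2]]|hno].
    - exists (th n z). split; [|intros h; exfalso; auto].
      intros n' h3 h4. rewrite (huni z n n'); auto.
    - exists (nu z). split; auto. intros n h1 h2. exfalso; eauto. }
  apply choice in hphi. destruct hphi as [phi hphi].
  assert (p1 : forall n z, K n z -> ~ K (S n) z -> phi z = th n z) by (intros n z; apply hphi).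
  assert (p2 : forall z, (forall n, K n z) -> phi z = nu z) by (intros z; apply hphi).
  assert (hin : forall n z, K n z -> K' n (phi z)).
  { intros n z hz. destruct (classic (forall n, K n z)) as [h|h].
    - rewrite p2; auto. apply (emb_in (proj1 hnu)); auto.
    - destruct (hlast K z) as [i [h1 h2]]; auto; [apply (hdec 0 n); auto; lia|].
      rewrite (p1 i); auto. assert (hni : n <= i).
      { destruct (le_lt_dec n i); auto. exfalso. apply h2, (hdec (S i) n); auto. }
      apply (hdec' n i hni). apply (cut_in (hc i)); auto. }
  assert (hout : forall n z, K 0 z -> ~ K n z -> ~ K' n (phi z)).
  { intros n z hz hn h. destruct (hlast K z) as [i [h1 h2]]; auto.
    assert (hi : S i <= n).
    { destruct (le_lt_dec (S i) n); auto. exfalso. apply hn, (hdec n i); auto; lia. }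
    apply (hdec' _ _ hi) in h. rewrite (p1 i) in h; auto. apply (cut_in (hc i) h1 h2); auto. }
  assert (hadj : forall n z w, K n z -> ~ K (S n) z -> K (S n) w -> (E z w <-> E (phi z) (phi w))).
  { intros n z w h1 h2 h3. rewrite (p1 n z); auto. apply (cut_lab (hc n)); auto. }
  assert (hsplit : forall z, K 0 z -> (forall n, K n z) \/ exists n, K n z /\ ~ K (S n) z).
  { intros z hz. destruct (classic (forall n, K n z)); auto. }
  exists phi. split; [split|].
  - intros z hz. auto.
  - intros z w hz hw e.
    assert (hiff : forall n, K n z <-> K n w).
    { intros n. split; intros h; apply NNPP; intros h'.
      - apply (hout n w hw h'). rewrite <- e; auto.
      - apply (hout n z hz h'). rewrite e; auto. }
    destruct (hsplit z hz) as [h|[n [h1 h2]]].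
    + assert (h' : forall n, K n w) by (intros n; apply hiff; auto).
      rewrite !p2 in e; auto. apply (emb_inj (proj1 hnu)); auto.
    + rewrite hiff in h2. assert (h1' := h1). rewrite hiff in h1'.
      rewrite !(p1 n) in e; auto; [|rewrite hiff; auto].
      apply (emb_inj (proj1 (cut_iso (hc n)))) in e; auto; split; auto. rewrite hiff; auto.
  - intros z w hz hw. destruct (hsplit z hz) as [h|[n [h1 h2]]].
    + destruct (hsplit w hw) as [h'|[n [h3 h4]]].
      * rewrite !p2; auto. apply (emb_adj (proj1 hnu)); auto.
      * rewrite (conj (@cog_sym U E hE z w) (@cog_sym U E hE w z) : _ <-> _), (hadj n w z); auto.
        split; apply (cog_sym hE).
    + destruct (classic (K (S n) w)) as [h3|h3]; [apply (hadj n); auto|].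
      destruct (hsplit w hw) as [h'|[n' [h4 h5]]]; [exfalso; auto|].
      destruct (lt_eq_lt_dec n n') as [[h|h]|h].
      * exfalso. apply h3, (hdec (S n) n'); auto.
      * subst n'. rewrite !(p1 n); auto. apply (emb_adj (proj1 (cut_iso (hc n)))); split; auto.
      * rewrite (conj (@cog_sym U E hE z w) (@cog_sym U E hE w z) : _ <-> _), (hadj n' w z); auto.
        { split; apply (cog_sym hE). }
        apply (hdec (S n') n); auto.
  - intros y hy. destruct (classic (forall n, K' n y)) as [h|h].
    + destruct (proj2 hnu y h) as [z [hz <-]]. exists z; split; auto.
    + destruct (hlast K' y hy h) as [n [h1 h2]].
      destruct (proj2 (cut_iso (hc n)) y) as [z [[h3 h4] <-]]; [split; auto|].
      exists z. split; [apply (hdec 0 n); auto; lia | auto].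
Qed.

Section Final.
Variables (U : Type) (E : U -> U -> Prop) (hE : cog E) (code : U -> nat) (hcode : injective code).

Lemma minimal_uniq m N : (exists x, N x) -> finl E m N ->
  (forall S, strong E N S -> S <> N -> uniq E S) -> uniq E N.
Proof.
  intros [x hx] hf hu.
  destruct (classic (conn E N)) as [hc|hc].
  - destruct (classic (conn (co E) N)) as [hcc|hcc].
    + intros Y hY. destruct (ksib_eqm hY) as [[f hF] [h hh]].
      apply (@frame_iso U code hcode E hE m N Y f h x). split; auto. apply finl_ksib with N; auto.
    + apply (uniq_co_iff hE). apply (@disc_uniq U (co E) (cog_co hE) code hcode x m); auto using finl_co.
      intros z hz. apply uniq_co; auto. apply hu.
      * apply (strong_co_iff hE). apply strong_comp; auto using cog_co.
      * intros e. apply hcc. rewrite <- e. apply comp_conn; auto using cog_co.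
  - apply (@disc_uniq U E hE code hcode x m); auto. intros z hz. apply hu.
    + apply strong_comp; auto.
    + intros e. apply hc. rewrite <- e. apply comp_conn; auto.
Qed.

(** If the modules were disjoint, [L] alone could be replaced by a sibling [X]. Seen from [K], which
    is untouched, the result is isomorphic to [G] by [step_cut]; as [L] is the only module of its
    type in [G], this makes [X] isomorphic to [L]. *)
Lemma nonuniq_nested m G K L : smaller E m -> finl E m G -> strong E G K -> strong E G L ->
  ~ uniq E K -> ~ uniq E L -> sub K L \/ sub L K.
Proof.
  intros hIH hf hK hL nK nL.
  destruct (classic (exists z, K z /\ L z)) as [[z [h1 h2]]|hdis].
  { destruct (strong_nested hE hK (strong_mod hL) h1 h2); auto. }
  exfalso. destruct (not_uniq_ex nL) as [X [hX hLX]].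
  destruct (strong_ne hK) as [k0 hk0]. destruct (strong_ne hL) as [l0 hl0].
  assert (hKL : K <> L) by (intros e; apply hdis; exists k0; split; auto; rewrite <- e; auto).
  destruct (ksib_eqm hX) as [_ [f hfX]].
  assert (hi : iso E X (img f X)) by (apply iso_img with L; auto).
  assert (hLi : ksib E L (img f X)) by (apply ksib_trans with X; auto; apply iso_ksib; auto).
  set (F := fun M : set U => M = K \/ M = L).
  set (B := fun M : set U => if excluded_middle_informative (M = L) then img f X else M).
  assert (BK : B K = K) by (unfold B; destruct (excluded_middle_informative (K = L)); tauto).
  assert (BL : B L = img f X) by (unfold B; destruct (excluded_middle_informative (L = L)); tauto).
  assert (hnG : ~ F G).
  { intros [e|e]; apply hdis.
    - exists l0; split; auto. rewrite <- e; apply (strong_sub hL); auto.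
    - exists k0; split; auto. rewrite <- e; apply (strong_sub hK); auto. }
  assert (hFs : forall M, F M -> strong E G M /\ ksib E M (B M) /\ sub (B M) M).
  { intros M [-> | ->].
    - rewrite BK. split; auto. split; [apply ksib_refl | intros z; auto].
    - rewrite BL. split; auto. split; auto. apply img_sub with E; auto. }
  assert (hr : replable E G F B).
  { split; try (intros h; exfalso; auto; fail).
    - intros M hM; apply (hFs M hM).
    - intros M M' z [-> | ->] [-> | ->] h1 h2; auto; exfalso; apply hdis; exists z; auto.
    - intros M hM; apply (hFs M hM).
    - intros M hM. apply (hFs M hM).
    - intros M hM; apply (hFs M hM). }
  assert (hs : forall M, F M -> strong E (repl G F B) (B M)).
  { intros M hM. destruct (hFs M hM) as [h1 [h2 h3]].
    assert (hne : exists z, B M z) by (apply (ksib_ne h2), h1). split; auto.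
    - apply repl_mod; auto.
    - apply repl_half; auto; [apply h1 | apply (ksib_conn h2)].
    - apply repl_half; auto using cog_co, replable_co; [apply h1 | apply (ksib_coconn h2)]. }
  set (Z := repl G F B) in *.
  assert (hZ : ksib E G Z) by (apply repl_ksib; auto).
  destruct (step_cut hE hcode hIH hf hK nK hZ) as [K' [th [_ [h2 h3]]]].
  assert (e : K = K').
  { apply h2. split; [rewrite <- BK; apply hs; left; auto | apply ksib_refl]. }
  subst K'.
  assert (hGZ : iso E Z G).
  { apply iso_sym. exists (glue K (fun z => z) th). apply (glue_iso hE h3). split; [apply emb_id|].
    intros y hy; exists y; auto. }
  destruct hGZ as [psi hpsi].
  assert (hsL := hs L (or_intror eq_refl)). rewrite BL in hsL.
  assert (hiL : iso E (img f X) (img psi (img f X))).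
  { apply iso_img with G. apply emb_restrict with Z G; [apply hpsi | apply (strong_sub hsL)|].
    intros z hz; apply (emb_in (proj1 hpsi)), (strong_sub hsL); auto. }
  assert (e : img psi (img f X) = L).
  { apply (step_single hE hcode hIH hf hL nL). split; [apply strong_img with Z; auto|].
    apply ksib_trans with (img f X); auto. apply iso_ksib; auto. }
  apply hLX. apply iso_sym. apply iso_trans with (img f X); auto. rewrite <- e. auto.
Qed.

Lemma uniq_ksib (A B : set U) : ksib E A B -> uniq E A -> uniq E B.
Proof.
  intros hk hu Y hY. apply iso_trans with A; [apply iso_sym; auto|]. apply hu. apply ksib_trans with B; auto.
Qed.

(** Following [f] by the embedding of [H] into [G] that matches the outside parts gives a
    self-embedding of [G], under which [K] is stable. A vertex of [K] sent outside [K'] would end up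
    outside [K]. *)
Lemma cut_stable m G K H K' th f : smaller E m -> finl E m G -> ksib E G H -> strong E G K -> ~ uniq E K ->
  cut E G K H K' th -> ksib E K K' -> emb E f G H -> forall z, K z -> K' (f z).
Proof.
  intros hIH hfin hk hK hnu hc hKK hf z hz.
  destruct (ksib_eqm hKK) as [[b hb] [a ha]].
  assert (hne : exists x, K x) by apply hK.
  assert (hne' : exists x, K' x) by (apply (ksib_ne hKK hne)).
  assert (hc' := cut_sym hc hne hne').
  assert (he := glue_emb hE hc' ha).
  assert (hzG : G z) by (apply (strong_sub hK); auto).
  assert (h1 : K (glue K' a (inv th (diff G K)) (f z))).
  { apply (nonuniq_stable hcode hE (g := fun z => glue K' a (inv th (diff G K)) (f z)) hIH hfin hK hnu); auto.
    apply (emb_comp hf he). }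
  apply NNPP; intros hn. rewrite glue_out in h1; auto.
  apply (cut_in hc' (emb_in hf hzG) hn); auto.
Qed.

Lemma step_uniq m G : smaller E m -> finl E m G -> (exists x, G x) -> uniq E G.
Proof.
  intros hIH hfin hne. apply NNPP; intros hnu. destruct (not_uniq_ex hnu) as [H [hH hGH]]. apply hGH.
  set (Bad := fun K => strong E G K /\ ~ uniq E K).
  assert (hG : Bad G) by (split; auto; apply strong_self; auto).
  assert (hfH := finl_ksib hH hfin).
  assert (hneH := ksib_ne hH hne).
  (* This intersection may be empty. Otherwise its proper strong modules are not in [Bad], so
     [minimal_uniq] applies. *)
  set (N := fun z => forall K, Bad K -> K z).
  assert (hNs : (exists z, N z) -> strong E G N).
  { intros h. apply strong_inter with G; auto. intros M hM; apply hM. }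
  assert (hNu : (exists z, N z) -> uniq E N).
  { intros h. assert (hN := hNs h). apply minimal_uniq with m; [exact h | apply (finl_strong hE hcode hfin hN) |].
    intros S hS hSN. apply NNPP; intros hn. apply hSN. apply set_ext; intros z; split.
    - apply (strong_sub hS).
    - intros hz. apply hz. split; auto. apply (strong_trans hE hN hS). }
  (* Step [n] passes to a module that misses the vertex of code [n] if one exists; thus a sequence
     of modules already has intersection [N]. *)
  assert (hnx : forall nK : nat * set U, exists L, Bad (snd nK) -> Bad L /\ sub L (snd nK) /\
            forall v, code v = fst nK -> (exists L', Bad L' /\ ~ L' v) -> ~ L v).
  { intros [n K]; simpl. destruct (classic (exists v, code v = n /\ K v /\ exists L', Bad L' /\ ~ L' v))
      as [[v [h1 [h2 [L [h3 h4]]]]]|hno].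
    - exists L. intros hK. split; auto. split.
      + destruct (@nonuniq_nested m G L K) as [h|h]; auto; try apply h3; try apply hK.
        exfalso; apply h4; auto.
      + intros v' h5 _. assert (e : v' = v) by (apply hcode; congruence). subst; auto.
    - exists K. intros hK. split; auto. split; [intros z; auto|].
      intros v h1 h2 h3. apply hno; exists v; auto. }
  apply choice in hnx. destruct hnx as [nx hnx].
  set (K := nat_rect (fun _ => set U) G (fun n K => nx (n, K))).
  assert (hK : forall n, Bad (K n)).
  { induction n as [|n IH]; auto. apply (hnx (n, K n) IH). }
  assert (hKsub : forall n, sub (K (S n)) (K n)) by (intros n; apply (hnx (n, K n) (hK n))).
  assert (hKN : N = fun z => forall n, K n z).
  { apply set_ext; intros z; split; [intros hz n; apply hz; auto|].
    intros hz L hL. apply NNPP; intros hn.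
    destruct (hnx (code z, K (code z)) (hK _)) as [_ [_ h]].
    apply (h z eq_refl); [exists L; auto|]. apply (hz (S (code z))). }
  (* The counterparts in [H] are found successively, each inside the previous one. *)
  assert (hst : forall nY : nat * set U, exists Y', ksib E (K (fst nY)) (snd nY) ->
            Occ E (snd nY) (K (S (fst nY))) Y' /\
            exists th, cut E (K (fst nY)) (K (S (fst nY))) (snd nY) Y' th).
  { intros [n Y]; simpl. destruct (classic (ksib E (K n) Y)) as [hY|hY]; [|exists Y; tauto].
    assert (hf : finl E m (K n)) by (apply (finl_strong hE hcode hfin); apply hK).
    assert (hs : strong E (K n) (K (S n))).
    { apply strong_restrict with G; auto; apply hK. }
    destruct (step_cut hE hcode hIH hf hs (proj2 (hK (S n))) hY) as [Y' [th [h1 [_ h2]]]].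
    exists Y'. intros _. split; auto. exists th; auto. }
  apply choice in hst. destruct hst as [st hst].
  set (K' := nat_rect (fun _ => set U) H (fun n Y => st (n, Y))).
  assert (hK' : forall n, ksib E (K n) (K' n) /\ strong E H (K' n)).
  { induction n as [|n [IH1 IH2]]; [split; [auto | apply strong_self; auto]|].
    destruct (hst (n, K' n) IH1) as [[h1 h2] _]. split; auto. apply (strong_trans hE IH2 h1). }
  assert (hth : forall n, exists th, cut E (K n) (K (S n)) (K' n) (K' (S n)) th).
  { intros n. destruct (hK' n) as [h1 _]. apply (hst (n, K' n) h1). }
  apply choice in hth. destruct hth as [th hth].
  (* [cut_stable] compares the whole graphs [G] and [H], so cuts from [G] itself are needed besides
     the successive ones. *)
  assert (hcut : forall n, exists t, cut E G (K n) H (K' n) t).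
  { intros n. destruct (hK n) as [h1 h2]. destruct (hK' n) as [h3 h4].
    destruct (step_cut hE hcode hIH hfin h1 h2 hH) as [K2 [t [_ [h5 h6]]]].
    exists t. rewrite (h5 (K' n)); auto. split; auto. }
  destruct (ksib_eqm hH) as [[f hf] [h hh]].
  assert (hfK : forall n z, K n z -> K' n (f z)).
  { intros n. destruct (hK n) as [h1 h2]. destruct (hK' n) as [h3 h4]. destruct (hcut n) as [t ht].
    apply (cut_stable hIH hfin hH h1 h2 ht h3 hf). }
  assert (hhK : forall n z, K' n z -> K n (h z)).
  { intros n. destruct (hK n) as [h1 h2]. destruct (hK' n) as [h3 h4]. destruct (hcut n) as [t ht].
    apply (@cut_stable m H (K' n) G (K n) (inv t (diff G (K n))) h); auto using ksib_sym.
    - intros hu. apply h2. apply uniq_ksib with (K' n); auto using ksib_sym.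
    - apply (cut_sym ht); [apply h1 | apply h4]. }
  (* The embeddings [f] and [h] respect every module of the two sequences, so they restrict to the
     intersections. *)
  assert (hnu' : iso E N (fun z => forall n, K' n z)).
  { assert (e1 : emb E f N (fun z => forall n, K' n z)).
    { rewrite hKN. apply emb_restrict with G H; auto. intros z hz; apply (hz 0). }
    assert (e2 : emb E h (fun z => forall n, K' n z) N).
    { rewrite hKN. apply emb_restrict with H G; auto. intros z hz; apply (hz 0). }
    destruct (classic (exists z, N z)) as [hz|hz].
    - apply (hNu hz). apply eqm_ksib; auto.
      + split; [exists f | exists h]; auto.
      + apply nonest_strong with G; auto. apply (fin_nonest hE hcode hfin).
      + apply nonest_strong with H; auto; [|apply (fin_nonest hE hcode hfH)].
        assert (e : (fun z => forall n, K' n z) = (fun z => forall M, (exists n, M = K' n) -> M z)).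
        { apply set_ext; intros z'; split; [intros hz' M [n ->]; auto | intros hz' n; apply hz'; eauto]. }
        rewrite e. apply strong_inter with H; auto.
        * intros M [n ->]; apply hK'.
        * exists 0; auto.
        * destruct hz as [z hz]. exists (f z). intros M [n ->]. apply (emb_in e1); auto.
    - exists f. split; auto. intros y hy. exfalso; apply hz. exists (h y). apply (emb_in e2); auto. }
  rewrite hKN in hnu'. destruct hnu' as [nu hnu'].
  apply (glue_tower hE hth hnu').
Qed.

Lemma finl_uniq m A : finl E m A -> uniq E A.
Proof.
  revert A. induction m as [m IH] using lt_wf_ind. intros A hf.
  destruct (classic (exists x, A x)) as [hne|hne].
  - apply step_uniq with m; auto. intros m' A' hm. apply IH; auto.
  - intros Y [[[f hF] [h hh]] _ _]. exists f. split; auto.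
    intros y hy. exfalso; apply hne. exists (h y). apply (emb_in hh); auto.
Qed.
End Final.

(** * From sets of vertices back to graphs *)

Lemma cograph_cog (G : graph) : cograph G -> cog (adj G).
Proof.
  intros hG. split; [apply adj_sym | apply adj_irr|].
  intros a b c d h1 h2 h3 h4 h5 h6. apply hG.
  assert (s1 := adj_sym _ _ _ h1). assert (s2 := adj_sym _ _ _ h2). assert (s3 := adj_sym _ _ _ h3).
  assert (t4 : ~ adj G c a) by (intros h; apply h4, adj_sym, h).
  assert (t5 : ~ adj G d b) by (intros h; apply h5, adj_sym, h).
  assert (t6 : ~ adj G d a) by (intros h; apply h6, adj_sym, h).
  pose proof (adj_irr G a). pose proof (adj_irr G b). pose proof (adj_irr G c). pose proof (adj_irr G d).
  exists (fun n : P4_vtx => match proj1_sig n with 0 => a | 1 => b | 2 => c | _ => d end). split.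
  - assert (hn : a <> b /\ a <> c /\ a <> d /\ b <> c /\ b <> d /\ c <> d).
    { repeat split; intros e; subst; tauto. }
    intros [n hn1] [k hk]; simpl; intros e.
    assert (e' : n = k).
    { destruct n as [|[|[|[|n]]]]; destruct k as [|[|[|[|k]]]]; try lia;
        exfalso; intuition congruence. }
    subst k. f_equal. apply le_unique.
  - intros [n hn] [k hk]; simpl; unfold P4_adj; simpl.
    destruct n as [|[|[|[|n]]]]; destruct k as [|[|[|[|k]]]]; try lia;
      split; intros hadj; try tauto; lia.
Qed.

Definition induced (G : graph) (A : set (vtx G)) : graph :=
  Graph (sig A) (fun u v => adj G (proj1_sig u) (proj1_sig v))
    (fun u v => adj_sym G (proj1_sig u) (proj1_sig v)) (fun u => adj_irr G (proj1_sig u)).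

Lemma induced_connected (G : graph) (A : set (vtx G)) : (exists z, A z) -> conn (adj G) A -> connected (induced A).
Proof.
  intros [z hz] hc. split; [exact (inhabits (exist A z hz))|].
  intros [x hx] [y hy]. destruct (hc x y hx hy) as [e|[h|[w [hw [h1 h2]]]]].
  - subst y. rewrite (proof_irrelevance _ hy hx). apply rt_refl.
  - apply rt_step. exact h.
  - apply rt_trans with (exist A w hw); apply rt_step; [exact h1 | exact h2].
Qed.


Lemma induced_iso (G : graph) (A B : set (vtx G)) :
  isomorphic (induced A) (induced B) -> iso (adj G) A B.
Proof.
  intros [p [h1 [h2 h3]]].
  set (f := fun z => match excluded_middle_informative (A z) with
                     | left hz => proj1_sig (p (exist A z hz)) | right _ => z end).
  assert (hf : forall z (hz : A z), f z = proj1_sig (p (exist A z hz))).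
  { intros z hz. unfold f. destruct (excluded_middle_informative (A z)) as [h|h]; [|tauto].
    rewrite (proof_irrelevance _ h hz); auto. }
  exists f. split; [split|].
  - intros z hz. rewrite (hf z hz). apply proj2_sig.
  - intros x y hx hy e. rewrite (hf x hx), (hf y hy) in e.
    assert (e' : p (exist A x hx) = p (exist A y hy)).
    { destruct (p (exist A x hx)) as [u hu]; destruct (p (exist A y hy)) as [v hv]; simpl in e. subst v.
      f_equal. apply proof_irrelevance. }
    apply h1 in e'. inversion e'; auto.
  - intros x y hx hy. rewrite (hf x hx), (hf y hy). apply (h3 (exist A x hx) (exist A y hy)).
  - intros y hy. destruct (h2 (exist B y hy)) as [[x hx] e]. exists x. split; auto.
    rewrite (hf x hx), e; auto.
Qed.

Lemma sibling_conn (G H : graph) (hE : cog (adj G)) f : connected H ->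
  (forall x y, adj H x y <-> adj G (f x) (f y)) -> conn (adj G) (fun z => exists v, f v = z).
Proof.
  intros [_ hc] hf. set (A := fun z => exists v, f v = z).
  intros x y [v <-] [w <-].
  assert (h := hc v w). induction h as [v w h|v|v w u _ IH1 _ IH2].
  - right; left. apply hf; auto.
  - left; auto.
  - apply (near_trans hE (y := f w)); auto; eexists; eauto.
Qed.

Theorem theorem1p6 (G : graph) :
  connected G -> cograph G -> countable_graph G ->
  (forall H, connected_sibling G H -> isomorphic H G) \/
  (exists F : nat -> graph,
     (forall i, connected_sibling G (F i)) /\
     (forall i j, i <> j -> ~ isomorphic (F i) (F j))).
Proof.
  intros hG hcog [code hcode]. assert (hE := cograph_cog hcog).
  set (E := adj G) in *. set (T := fun _ : vtx G => True).
  assert (hneT : exists z, T z) by (destruct hG as [[z] _]; exists z; exact I).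
  (* Every connected sibling is isomorphic to the subgraph induced on such a set, namely on its
     image in [G]. *)
  set (P := fun Y : set (vtx G) => eqm E T Y /\ conn E Y).
  destruct (classic (exists l, forall Y, P Y -> exists Z, In Z l /\ iso E Z Y)) as [[l hl]|hno].
  - left. intros H [hH [[f [hf1 hf2]] [g [hg1 hg2]]]].
    set (A := fun z => exists v, f v = z).
    assert (hA : P A).
    { split; [|apply (sibling_conn hE hH hf2)]. split.
      - exists (fun z => f (g z)). split.
        + intros z _. exists (g z); auto.
        + intros x y _ _ e. apply hg1, hf1; auto.
        + intros x y _ _. unfold E. rewrite hg2, hf2. tauto.
      - apply le_sub. intros z _; exact I. }
    assert (hT : conn E T).
    { assert (h := sibling_conn hE (f := fun z => z) hG (fun x y => iff_refl _)).
      intros x y _ _. apply near_sub with (fun z => exists v : vtx G, v = z); [intros z _; exact I|].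
      apply h; eexists; eauto. }
    (* A sibling in the sense of [ksib] of a connected set is connected, so the same list serves. *)
    assert (hfin : forall Y, P Y -> finl E (length l) Y).
    { intros Y [h1 h2]. exists l. split; auto. intros X hX.
      destruct (hl X) as [Z [h3 h4]].
      - split; [apply eqm_trans with Y; auto; apply hX | apply (ksib_conn hX); auto].
      - exists Z; split; auto. apply iso_sym; auto. }
    assert (hPT : P T) by (split; auto; apply eqm_refl).
    assert (hi : iso E A T).
    { apply iso_sym. apply (finl_uniq hE hcode (hfin T hPT)).
      (* Whether the complements agree in connectedness is not given; the rigidity of both graphs
         supplies it. *)
      apply eqm_ksib; auto; [apply hA | |]; apply (fin_nonest hE hcode (m := length l)); auto. }
    destruct hi as [p hp].
    assert (hAf : forall v, A (f v)) by (intros v; exists v; auto).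
    exists (fun v => p (f v)). split; [|split].
    + intros x y e. apply hf1. apply (emb_inj (proj1 hp)); auto.
    + intros y. destruct (proj2 hp y I) as [z [[v <-] e]]. exists v; auto.
    + intros x y. rewrite hf2. apply (emb_adj (proj1 hp)); auto.
  - right.
    destruct (@infinite_seq (set (vtx G)) P (iso E)) as [s [hs1 hs2]].
    { intros l. apply NNPP; intros h. apply hno. exists l. intros Y hY. apply NNPP; intros h'.
      apply h. exists Y; split; auto. intros Z hZ hi. apply h'; exists Z; auto. }
    exists (fun i => induced (s i)). split.
    + intros i. destruct (hs1 i) as [[[f hf] _] hc]. split; [|split].
      * apply induced_connected; auto. destruct hneT as [z hz]. exists (f z). apply (emb_in hf); auto.
      * exists (@proj1_sig _ _). split; [|tauto].
        intros [x hx] [y hy] e. simpl in e. subst y. f_equal. apply proof_irrelevance.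
      * exists (fun z => exist (s i) (f z) (emb_in hf I)). split.
        -- intros x y e. apply (f_equal (@proj1_sig _ _)) in e. apply (emb_inj hf) in e; auto; exact I.
        -- intros x y. apply (emb_adj hf); exact I.
    + intros i j hij h. apply induced_iso in h.
      destruct (lt_eq_lt_dec i j) as [[h1|h1]|h1]; [apply (hs2 i j) | auto | apply (hs2 j i)]; auto.
      apply iso_sym; auto.
Qed.
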